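(* Let $0<\theta,\alpha<1$ and $1\le p,q\le\infty$ be such that $\frac1p+\frac1q=1$. Suppose that $u$ is a weak solution of the incompressible Euler equations on $\mathbb{T}^3\times(0,\infty)$ such that $u\in L^\infty_t(W^{\theta,2p}_x)$ and $\omega:=\operatorname{curl}u\in L^\infty_t(W^{\alpha,q}_x)$. Let $H(t)=\int_{\mathbb{T}^3}u(x,t)\cdot\omega(x,t)\,dx$ be the helicity. Then there exists a constant $C>0$ such that, for all times $t,s$, $$|H(t)-H(s)|\le C|t-s|^{\frac{\alpha+\theta}{1-\theta}}.$$
   Context: $\mathbb{T}^3=\mathbb{R}^3/\mathbb{Z}^3$ is the three-dimensional flat torus. The incompressible Euler equations for a velocity $u:\mathbb{T}^3\times(0,\infty)\to\mathbb{R}^3$ and a pressure $p:\mathbb{T}^3\times(0,\infty)\to\mathbb{R}$ (not to be confused with the exponent $p$) are $$\partial_t u+\operatorname{div}(u\otimes u)+\nabla p=0,\qquad \operatorname{div}u=0.$$ A weak solution is a vector field $u$ satisfying these equations in the sense of distributions on $\mathbb{T}^3\times(0,\infty)$ for some distribution $p$. For $0<\alpha<1$ and $1\le m<\infty$, the (spatial) Sobolev norm is $\|f\|_{W^{\alpha,m}}=\|f\|_{L^m}+[f]_{W^{\alpha,m}}$, where $$[f]_{W^{\alpha,m}}=\Big(\int_{\mathbb{T}^3}\int_{\mathbb{T}^3}\frac{|f(x)-f(y)|^m}{|x-y|^{\alpha m+3}}\,dx\,dy\Big)^{1/m};$$ for $m=\infty$, $W^{\alpha,\infty}$ is the Hölder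 space $C^\alpha$. For a spatial Banach space $X$, $f\in L^\infty_t(X_x)$ means $\operatorname{ess\,sup}_{t>0}\|f(t)\|_X<\infty$. The constant $C$ may depend on $u$ (and on the exponents), but not on $t,s$. The helicity $H(t)$ is defined for almost every $t$; statements for all times refer to its representative that is continuous in time (equivalently, the inequality holds for almost every $t,s$). *)

(* Defs.v *)
From HB Require Import structures.
From mathcomp Require Import all_boot all_order all_algebra.
From mathcomp Require Import all_classical all_reals all_analysis.
From mathcomp Require Import ess_sup_inf.
Set Implicit Arguments.
Unset Strict Implicit.
Unset Printing Implicit Defensive.
Import Order.TTheory GRing.Theory Num.Theory.
Import numFieldNormedType.Exports.
Local Open Scope classical_set_scope.
Local Open Scope ring_scope.

(* Functions on the torus T^3 = R^3 / Z^3 are represented by Z^3-periodic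
   functions on R^3, and functions on T^3 x (0, +oo) by functions of
   (x, t) in R^3 x R that are Z^3-periodic in x and of which only the values at
   t > 0 are used. *)
Notation space3 R := (R * R * R)%type.
Notation spacetime R := (R * R * R * R)%type.
(* The same type with the measurable structure on which the library defines
   the Lebesgue measure. *)
Notation mspacetime R := (measurableTypeR R * measurableTypeR R *
                          measurableTypeR R * measurableTypeR R)%type.

Definition lattice (R : realType) (k : int * int * int) : space3 R :=
  (k.1.1%:~R, k.1.2%:~R, k.2%:~R).

Definition torus_periodic (R : realType) (T : Type) (f : space3 R -> T) :=
  forall x k, f (x + lattice R k) = f x.

Definition space_periodic (R : realType) (T : Type) (f : spacetime R -> T) :=
  forall t, torus_periodic (fun x => f (x, t)).

(* The measure of T^3 is the Lebesgue measure of the fundamental domain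
   [0, 1)^3. *)
Definition circle_measure (R : realType) :=
  @mrestr _ (measurableTypeR R) R _ lebesgue_measure
    (measurable_itv `[0%R : R, 1%R[).
Arguments circle_measure : clear implicits.

HB.instance Definition _ (R : realType) := Measure.on (circle_measure R).

Lemma circle_measure_setT (R : realType) : circle_measure R setT = 1%E.
Proof.
rewrite /circle_measure /mrestr setTI lebesgue_measure_itv/= lte_fin ltr01.
by rewrite oppr0 adde0.
Qed.

HB.instance Definition _ (R : realType) :=
  Measure_isProbability.Build _ _ _ (circle_measure R) (circle_measure_setT R).

Definition torus_measure (R : realType) :=
  (circle_measure R \x circle_measure R \x circle_measure R)%E.
Arguments torus_measure : clear implicits.

HB.instance Definition _ (R : realType) := Probability.on (torus_measure R).

Definition spacetime_measure (R : realType) :=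
  (torus_measure R \x @lebesgue_measure R)%E.
Arguments spacetime_measure : clear implicits.

HB.instance Definition _ (R : realType) := Measure.on (spacetime_measure R).

Definition time_measure (R : realType) :=
  @mrestr _ (measurableTypeR R) R _ lebesgue_measure
    (measurable_itv `]0%R : R, +oo[).
Arguments time_measure : clear implicits.

HB.instance Definition _ (R : realType) := Measure.on (time_measure R).

Definition time_domain (R : realType) : set (mspacetime R) :=
  [set z | 0 < z.2].
Arguments time_domain : clear implicits.

Definition time_slab (R : realType) (a b : R) : set (mspacetime R) :=
  [set z | a <= z.2 <= b].

Definition space_norm (R : realType) (x : space3 R) : R :=
  Num.sqrt (x.1.1 ^+ 2 + x.1.2 ^+ 2 + x.2 ^+ 2).

(* The quotient (geodesic) distance |x - y| of T^3. *)
Definition torus_dist (R : realType) (x y : space3 R) : R :=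
  inf (range (fun k => space_norm (x - y + lattice R k))).

Definition dotv (R : realType) (v w : 'rV[R]_3) : R :=
  \sum_i v ord0 i * w ord0 i.

(* The norm `|v| of 'rV[R]_3 in the library is the maximum norm. *)
Definition euclid (R : realType) (v : 'rV[R]_3) : R := Num.sqrt (dotv v v).

Definition gagliardo (R : realType) (alpha m : R) (f : space3 R -> 'rV[R]_3) :
    \bar R :=
  ((\int[torus_measure R]_x \int[torus_measure R]_y
      (euclid (f x - f y) `^ m / torus_dist x y `^ (alpha * m + 3))%:E)
   `^ m^-1)%E.

(* For x = y in T^3 the quotient below is 0 / 0 = 0, so it does not contribute
   to the supremum. *)
Definition holder_norm (R : realType) (alpha : R) (g : space3 R -> 'rV[R]_3) :
    \bar R :=
  (ereal_sup (range (fun x => (euclid (g x))%:E)) +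
   ereal_sup (range (fun xy : space3 R * space3 R =>
     (euclid (g xy.1 - g xy.2) / torus_dist xy.1 xy.2 `^ alpha)%:E)))%E.

(* Elements of W^{alpha,m} are classes modulo equality a.e.: for m = +oo the
   norm is the C^alpha norm of a representative, the infimum being +oo if there
   is no Hoelder representative. The value at m = -oo is irrelevant. *)
Definition sobolev_norm (R : realType) (alpha : R) (m : \bar R)
    (f : space3 R -> 'rV[R]_3) : \bar R :=
  match m with
  | r%:E => (Lnorm (torus_measure R) r%:E (fun x => (euclid (f x))%:E)
             + gagliardo alpha r f)%E
  | +oo%E => ereal_inf [set holder_norm alpha g | g in
      [set g | torus_periodic g /\ {ae torus_measure R, forall x, g x = f x}]]
  | -oo%E => +oo%E
  end.

Definition Linfty_sobolev (R : realType) (alpha : R) (m : \bar R)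
    (u : spacetime R -> 'rV[R]_3) : Prop :=
  (ess_sup (time_measure R)
     (fun t => sobolev_norm alpha m (fun x => u (x, t))) < +oo)%E.

(* [Some i] is the i-th space direction and [None] the time direction. *)
Definition direction (R : realType) (k : option 'I_3) : spacetime R :=
  if k is Some i then
    ((i == 0%N :> nat)%:R, (i == 1%N :> nat)%:R, (i == 2%N :> nat)%:R, 0)
  else (0, 0, 0, 1).

Definition partial (R : realType) (k : option 'I_3) (f : spacetime R -> R) :
    spacetime R -> R :=
  fun z => 'D_(direction R k) f z.

Definition partials (R : realType) (l : seq (option 'I_3))
    (f : spacetime R -> R) : spacetime R -> R :=
  foldr (@partial R) f l.

Definition smooth (R : realType) (f : spacetime R -> R) : Prop :=
  forall l, continuous (partials l f) /\
    forall k z, derivable (partials l f) z (direction R k).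

Definition supported_in (R : realType) (a b : R) (phi : spacetime R -> R) :=
  forall z, phi z != 0 -> time_slab a b z.

(* C^oo functions with compact support in T^3 x (0, +oo), extended by 0 to
   t <= 0. *)
Definition test_function (R : realType) (phi : spacetime R -> R) : Prop :=
  [/\ smooth phi, space_periodic phi &
      exists a b : R, 0 < a /\ supported_in a b phi].

(* A distribution is given by its values on test functions; its values on
   other functions are irrelevant. *)
Definition is_distribution (R : realType) (T : (spacetime R -> R) -> R) :
    Prop :=
  (forall (c : R) phi psi, test_function phi -> test_function psi ->
     T (fun z => c * phi z + psi z) = c * T phi + T psi) /\
  (forall a b : R, 0 < a -> exists (N : nat) (C : R),
     forall phi, test_function phi -> supported_in a b phi ->
     forall M : R,
       (forall l z, (size l <= N)%N -> `|partials l phi z| <= M) ->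
       `|T phi| <= C * M).

Definition slab_integrable (R : realType) (f : spacetime R -> R) : Prop :=
  forall a b : R, 0 < a ->
    (spacetime_measure R).-integrable (time_slab a b) (EFin \o f).

Definition dist_of (R : realType) (f : spacetime R -> R)
    (phi : spacetime R -> R) : R :=
  \int[spacetime_measure R]_(z in time_domain R) (f z * phi z).

Definition dist_partial (R : realType) (k : option 'I_3)
    (T : (spacetime R -> R) -> R) (phi : spacetime R -> R) : R :=
  - T (partial k phi).

Definition coordv (R : realType) (u : spacetime R -> 'rV[R]_3) (i : 'I_3) :
    spacetime R -> R :=
  fun z => u z ord0 i.

Definition vector_field (R : realType) (u : spacetime R -> 'rV[R]_3) : Prop :=
  space_periodic u /\ forall i, measurable_fun (time_domain R) (coordv u i).

(* Local square integrability is what gives u (x) u a meaning as a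
   distribution. *)
Definition euler_weak_solution (R : realType) (u : spacetime R -> 'rV[R]_3) :
    Prop :=
  [/\ vector_field u,
      (forall i, slab_integrable (fun z => coordv u i z ^+ 2)),
      (exists p, is_distribution p /\
         forall phi, test_function phi -> forall i,
           dist_partial None (dist_of (coordv u i)) phi
           + (\sum_(j < 3) dist_partial (Some j)
                (dist_of (fun z => coordv u i z * coordv u j z)) phi)
           + dist_partial (Some i) p phi = 0) &
      forall phi, test_function phi ->
        \sum_(i < 3) dist_partial (Some i) (dist_of (coordv u i)) phi = 0].

(* omega = curl u in the sense of distributions; indices are modulo 3, so that
   omega_i = d_(i+1) u_(i+2) - d_(i+2) u_(i+1). *)
Definition weak_curl (R : realType) (u omega : spacetime R -> 'rV[R]_3) :
    Prop :=
  [/\ vector_field omega,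
      (forall i, slab_integrable (coordv omega i)) &
      forall phi, test_function phi -> forall i : 'I_3,
        dist_of (coordv omega i) phi =
          dist_partial (Some (i + 1)) (dist_of (coordv u (i + 2))) phi
          - dist_partial (Some (i + 2)) (dist_of (coordv u (i + 1))) phi].

Definition helicity (R : realType) (u omega : spacetime R -> 'rV[R]_3)
    (t : R) : R :=
  \int[torus_measure R]_x dotv (u (x, t)) (omega (x, t)).

(* Main.v *)
Require Import Defs.
From HB Require Import structures.
From mathcomp Require Import all_boot all_order all_algebra.
From mathcomp Require Import all_classical all_reals all_analysis.
From mathcomp Require Import ess_sup_inf measurable_realfun zify ring lra.
Import Order.TTheory GRing.Theory Num.Theory.
Import numFieldNormedType.Exports.
Set Implicit Arguments.
Unset Strict Implicit.
Unset Printing Implicit Defensive.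
Local Open Scope classical_set_scope.
Local Open Scope ring_scope.

(** The idea is to regularize in space at a width [delta] and to compare two
    estimates. Let [v] and [w] be the regularizations of [u] and [omega].

    - Replacing [u . omega] by [v . w] in the helicity costs the integral of a
      covariance of [u] and [omega] under the kernel. A covariance is quadratic
      in increments, hence the error is of order [delta^(theta + alpha)]
      ([helicity_regularization_le]).
    - The helicity of [v] changes at the rate
      [2 \int \sum_i \sum_j R_ij d_j w_i], where the stress [R] is the
      regularization of [u_i u_j] minus [v_i v_j]. The cubic term
      [v_i v_j d_j w_i] is missing because it is a divergence when [v] is
      divergence free with curl [w] ([Int_triadic]). Now [R] is quadratic in
      increments of [u], and the gradient of [w] is linear in increments of
      [omega] with a loss of [delta^-1], hence the rate is of order
      [delta^(2 theta + alpha - 1)] ([helicity_flux_le]).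

    So the increment of the helicity over a time [tau] is of order
    [delta^(theta + alpha) + delta^(2 theta + alpha - 1) tau], and both terms
    equal [tau^((alpha + theta) / (1 - theta))] when [delta] is
    [tau^(1 / (1 - theta))] ([optimal_scale]).

    Exponents. The two Sobolev bounds meet only in a pointwise inequality
    [U^2 W <= c + kappa (Phi U + Psi W)] between difference quotients [U] of
    [u] and [W] of [omega] ([young]); [Phi] and [Psi] are powers, or zero in
    the endpoint cases. The Gagliardo densities [Phi U / r^3] and [Psi W / r^3]
    are integrable, and the factor [r^3] that is left is absorbed by the kernel,
    which satisfies [Ker * r^(s + 3) <= C delta^s] pointwise ([Ker_sup]). The
    distance [r] is the chordal one, made of the same trigonometric functions
    as the kernel and equivalent to the distance of the torus.

    Time. The kernel is a product of powers of cosines of [x_i - y_i], that is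
    a finite sum of products of a function of [x] and a function of [y]
    ([KerE]). A regularized field is therefore given by finitely many scalar
    functions of time, for which the vorticity equation, obtained by testing
    the momentum equation with curls so that the pressure drops out
    ([vorticity_equation]), is a weak ordinary differential equation. At common
    Lebesgue points of these functions an increment in time is bounded by the
    mean of the flux ([weak_mean_value]). The helicity of [v] is a quadratic
    form, symmetric because the curl is ([reg_helicity_sym]); its increment is
    the increment of [w] paired with [v(t) + v(s)], at most [2 A |t - s|] up to
    a multiple of [|t - s|^2], where [A] bounds the flux integral at almost
    every time ([reg_helicity_quadratic]). The quadratic term disappears by
    subdivision ([linear_of_quadratic]). This proves the inequality at almost
    all times, and [hoelder_extension] extends the helicity from these times. *)

(** * One-variable smooth functions *)

Section Smooth1.
Variable R : realType.
Implicit Types (f g : R -> R) (x s : R).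

Fixpoint derivable_upto n f : Prop :=
  if n is m.+1 then (forall x, derivable f x 1) /\ derivable_upto m (derive1 f)
  else True.

Definition smooth1 f := forall n, derivable_upto n f.

Lemma is_derive1_derive1 f g : (forall x, is_derive (x : R) (1 : R) f (g x)) ->
  (forall x, derivable f x 1) /\ derive1 f = g.
Proof.
move=> fg; split=> [x|]; first exact: ex_derive.
by apply/funext => x; rewrite derive1E; exact: derive_val.
Qed.

Lemma smooth1_derivable f : smooth1 f -> forall x, derivable f x 1.
Proof. by move=> /(_ 1%N)[]. Qed.

Lemma smooth1_is_derive f : smooth1 f -> forall x, is_derive (x : R) (1 : R) f (derive1 f x).
Proof.
move=> sf x; apply: DeriveDef; first exact: smooth1_derivable.
by rewrite derive1E.
Qed.

Lemma smooth1_derive1 f : smooth1 f -> smooth1 (derive1 f).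
Proof. by move=> sf n; have [] := sf n.+1. Qed.

Lemma derivable1_continuous f : (forall x, derivable f x 1) -> continuous f.
Proof. by move=> df x; apply: differentiable_continuous; apply/derivable1_diffP. Qed.

Lemma smooth1_continuous f : smooth1 f -> continuous f.
Proof. by move=> /smooth1_derivable; exact: derivable1_continuous. Qed.

Lemma derivable_uptoW n f : derivable_upto n.+1 f -> derivable_upto n f.
Proof. by elim: n f => //= n IH f [df [d2 u2]]; split=> //; apply: IH. Qed.

Lemma derive1_cst_fun (c : R) : derive1 (fun _ : R => c) = (fun _ : R => 0).
Proof.
by case: (@is_derive1_derive1 (fun _ : R => c) (fun _ => 0)
  (fun x => is_derive_cst c x (1 : R))).
Qed.

Lemma derivable_upto_cst n (c : R) : derivable_upto n (fun _ : R => c).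
Proof.
elim: n c => //= n IH c; split; last by rewrite derive1_cst_fun.
by move=> x; have := is_derive_cst c x (1 : R) => -[].
Qed.

Lemma derivable_uptoD n f g : derivable_upto n f -> derivable_upto n g ->
  derivable_upto n (fun x => f x + g x).
Proof.
elim: n f g => //= n IH f g [df uf] [dg ug].
have [d ->] := @is_derive1_derive1 (fun x => f x + g x)
  (fun x => derive1 f x + derive1 g x) (fun x => is_deriveD
    (DeriveDef (df x) (esym (derive1E f x))) (DeriveDef (dg x) (esym (derive1E g x)))).
by split=> //; apply: IH.
Qed.

Lemma is_deriveM1 f g x a b : is_derive x (1 : R) f a -> is_derive x (1 : R) g b ->
  is_derive x (1 : R) (fun y => f y * g y) (a * g x + f x * b).
Proof.
move=> fa gb; apply: is_derive_eq (is_deriveM fa gb) _.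
by rewrite addrC; congr (_ + _); rewrite -[LHS]/(_ * _) mulrC.
Qed.

Lemma derivable_uptoM n f g : derivable_upto n f -> derivable_upto n g ->
  derivable_upto n (fun x => f x * g x).
Proof.
elim: n f g => // n IH f g uf ug.
have [/= df udf] := uf; have [/= dg udg] := ug.
rewrite /=.
have [d ->] := @is_derive1_derive1 (fun x => f x * g x)
  (fun x => derive1 f x * g x + f x * derive1 g x) (fun x => is_deriveM1
    (DeriveDef (df x) (esym (derive1E f x))) (DeriveDef (dg x) (esym (derive1E g x)))).
by split=> //; apply: derivable_uptoD; apply: IH => //; exact: derivable_uptoW.
Qed.

Lemma derivable_uptoV n f : (forall x, f x != 0) -> derivable_upto n f ->
  derivable_upto n (fun x => (f x)^-1).
Proof.
move=> f0; elim: n => // n IH uf.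
have [/= df udf] := uf; rewrite /=.
have dV x : is_derive x (1 : R) (fun x => (f x)^-1)
    (((-1) * derive1 f x) * ((f x)^-1 * (f x)^-1)).
  apply: is_derive_eq (is_deriveV (f0 x) (DeriveDef (df x) (esym (derive1E f x)))) _.
  rewrite -[LHS]/(- f x ^- 2 * derive1 f x) mulN1r !mulNr; congr (- _).
  by rewrite mulrC expr2 invfM.
have [d ->] := is_derive1_derive1 dV.
split=> //; apply: derivable_uptoM.
  by apply: derivable_uptoM => //; exact: derivable_upto_cst.
by apply: derivable_uptoM; apply: IH; exact: derivable_uptoW.
Qed.

Lemma derivable_upto_affine n f (a b : R) : derivable_upto n f ->
  derivable_upto n (fun x => f (a * x + b)).
Proof.
elim: n f => // n IH f [/= df uf].
suff dA x : is_derive x (1 : R) (fun x => f (a * x + b)) (derive1 f (a * x + b) * a).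
  have [d ->] := is_derive1_derive1 dA.
  by split=> //; apply: derivable_uptoM; [exact: IH | exact: derivable_upto_cst].
apply: (@is_derive1_comp _ f (fun x => a * x + b)).
  by apply: DeriveDef => //; rewrite derive1E.
have h : is_derive x (1 : R) (fun y : R => a * y) a.
  apply: is_derive_eq (is_deriveM1 (is_derive_cst a x 1) (is_derive_id x (1 : R))) _.
  by rewrite mul0r add0r mulr1.
apply: is_derive_eq (is_deriveD h (is_derive_cst b x (1 : R))) _.
by rewrite addr0.
Qed.

Lemma smooth1_cst (c : R) : smooth1 (fun _ => c).
Proof. by move=> n; exact: derivable_upto_cst. Qed.

Lemma smooth1D f g : smooth1 f -> smooth1 g -> smooth1 (fun x => f x + g x).
Proof. by move=> sf sg n; exact: derivable_uptoD. Qed.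

Lemma smooth1M f g : smooth1 f -> smooth1 g -> smooth1 (fun x => f x * g x).
Proof. by move=> sf sg n; exact: derivable_uptoM. Qed.

Lemma smooth1Z c f : smooth1 f -> smooth1 (fun x => c * f x).
Proof. by move=> sf; apply: smooth1M => //; exact: smooth1_cst. Qed.

Lemma smooth1V f : (forall x, f x != 0) -> smooth1 f -> smooth1 (fun x => (f x)^-1).
Proof. by move=> f0 sf n; exact: derivable_uptoV. Qed.

Lemma smooth1_affine f a b : smooth1 f -> smooth1 (fun x => f (a * x + b)).
Proof. by move=> sf n; exact: derivable_upto_affine. Qed.

Lemma smooth1_exp f n : smooth1 f -> smooth1 (fun x => f x ^+ n).
Proof.
move=> sf; elim: n => [|n IH].
  by under eq_fun do rewrite expr0; exact: smooth1_cst.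
by under eq_fun do rewrite exprS; exact: smooth1M.
Qed.

Lemma derive1M f g : smooth1 f -> smooth1 g ->
  derive1 (fun x => f x * g x) = (fun x => derive1 f x * g x + f x * derive1 g x).
Proof.
move=> sf sg; have [] // := @is_derive1_derive1 (fun x => f x * g x)
  (fun x => derive1 f x * g x + f x * derive1 g x).
by move=> x; apply: is_deriveM1; exact: smooth1_is_derive.
Qed.

Lemma derive1_affine f (a b : R) : smooth1 f ->
  derive1 (fun x => f (a * x + b)) = (fun x => a * derive1 f (a * x + b)).
Proof.
move=> sf; have [] // := @is_derive1_derive1 (fun x => f (a * x + b))
  (fun x => a * derive1 f (a * x + b)).
move=> x; rewrite mulrC; apply: (@is_derive1_comp _ f (fun x => a * x + b)).
  exact: smooth1_is_derive.
have h : is_derive x (1 : R) (fun y : R => a * y) a.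
  apply: is_derive_eq (is_deriveM1 (is_derive_cst a x 1) (is_derive_id x (1 : R))) _.
  by rewrite mul0r add0r mulr1.
apply: is_derive_eq (is_deriveD h (is_derive_cst b x (1 : R))) _.
by rewrite addr0.
Qed.

Lemma is_derive_affine_comp (h : R -> R) (dh c x : R) : is_derive (c * x) 1 h dh ->
  is_derive x (1 : R) (fun y => h (c * y)) (dh * c).
Proof.
move=> hd; apply: (@is_derive1_comp _ h (fun x => c * x)) => //.
apply: is_derive_eq (is_deriveM1 (is_derive_cst c x 1) (is_derive_id x (1 : R))) _.
by rewrite mul0r add0r mulr1.
Qed.

Lemma derive1_cospi : derive1 (fun x : R => cos (pi * x)) = (fun x => - pi * sin (pi * x)).
Proof.
have [] // := @is_derive1_derive1 (fun x : R => cos (pi * x)) (fun x => - pi * sin (pi * x)).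
move=> x; apply: is_derive_eq (is_derive_affine_comp (is_derive_cos _)) _.
by rewrite mulrC mulNr mulrN.
Qed.

Lemma derive1_sinpi : derive1 (fun x : R => sin (pi * x)) = (fun x => pi * cos (pi * x)).
Proof.
have [] // := @is_derive1_derive1 (fun x : R => sin (pi * x)) (fun x => pi * cos (pi * x)).
move=> x; apply: is_derive_eq (is_derive_affine_comp (is_derive_sin _)) _.
by rewrite mulrC.
Qed.

Lemma smooth1_cos_sin : smooth1 (@cos R) /\ smooth1 (@sin R).
Proof.
have dc : derive1 (@cos R) = (fun x => (-1) * sin x).
  have [] // := @is_derive1_derive1 (@cos R) (fun x => (-1) * sin x).
  by move=> x; rewrite mulN1r; exact: is_derive_cos.
have ds : derive1 (@sin R) = (@cos R).
  by have [] // := @is_derive1_derive1 (@sin R) (@cos R).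
suff h n : derivable_upto n (@cos R) /\ derivable_upto n (@sin R).
  by split=> n; case: (h n).
elim: n => // n [IHc IHs] /=; rewrite dc ds; split; split=> //.
  by apply: derivable_uptoM => //; exact: derivable_upto_cst.
Qed.

Lemma smooth1_cospi : smooth1 (fun x : R => cos (pi * x)).
Proof.
have := smooth1_affine pi 0 (proj1 smooth1_cos_sin).
by under eq_fun do rewrite addr0.
Qed.

Lemma smooth1_sinpi : smooth1 (fun x : R => sin (pi * x)).
Proof.
have := smooth1_affine pi 0 (proj2 smooth1_cos_sin).
by under eq_fun do rewrite addr0.
Qed.

(** A derivative of [s^-k exp(-1/s)] is again a combination of such functions,
    so smoothness of the whole family follows by induction; the member [k = 0]
    makes [smooth_step]. *)
Definition flat_exp (k : nat) (s : R) : R :=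
  if 0 < s then s^-1 ^+ k * expR (- s^-1) else 0.

(** A single term of the exponential series gives quadratic decay at 0, which
    is what makes the derivative at 0 vanish. *)
Lemma flat_exp_le k s : 0 < s -> flat_exp k s <= (k.+2)`!%:R * s ^+ 2.
Proof.
move=> s0; rewrite /flat_exp s0.
have := @expR_ge1Dxn R s^-1 k.+1; rewrite invr_ge0 => /(_ (ltW s0)) h.
rewrite expRN ler_pdivrMr ?expR_gt0 //.
apply: (@le_trans _ _ ((k.+2)`!%:R * s ^+ 2 * (s^-1 ^+ k.+2 / (k.+2)`!%:R))).
  have f0 : ((k.+2)`!%:R : R) != 0 by rewrite pnatr_eq0 -lt0n fact_gt0.
  rewrite le_eqVlt; apply/orP; left; apply/eqP.
  rewrite -[k.+2]addn2 exprD; field.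
  by rewrite addn2 f0 gt_eqF.
rewrite ler_wpM2l ?mulr_ge0 ?ler0n ?exprn_ge0 ?ltW //.
by apply: lt_le_trans h; rewrite ltrDr.
Qed.

Lemma flat_exp_ge0 k s : 0 <= flat_exp k s.
Proof.
rewrite /flat_exp; case: ifPn => // s0.
by rewrite mulr_ge0 ?expR_ge0 // exprn_ge0 // invr_ge0 ltW.
Qed.

Lemma flat_exp_gt0 s : 0 < s -> 0 < flat_exp 0 s.
Proof. by move=> s0; rewrite /flat_exp s0 expr0 mul1r expR_gt0. Qed.

Lemma is_derive_flat_exp k s :
  is_derive s (1 : R) (flat_exp k) (flat_exp k.+2 s - k%:R * flat_exp k.+1 s).
Proof.
have [s0|s0|->] := ltgtP s 0.
- have F0 j : flat_exp j s = 0 by rewrite /flat_exp lt_gtF.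
  rewrite !F0 mulr0 subr0; apply: (near_eq_is_derive _ (is_derive_cst (0 : R) s (1 : R))).
  near=> t; rewrite /flat_exp lt_gtF //.
  near: t; exact: lt_nbhsl.
- have F0 j : flat_exp j s = s^-1 ^+ j * expR (- s^-1) by rewrite /flat_exp s0.
  rewrite !F0.
  have h : is_derive s (1 : R) (fun t : R => t^-1 ^+ k * expR (- t^-1))
    (s^-1 ^+ k.+2 * expR (- s^-1) - k%:R * (s^-1 ^+ k.+1 * expR (- s^-1))).
    have dV : is_derive s (1 : R) (fun t : R => t^-1) (- (s ^- 2)).
      apply: is_derive_eq (is_deriveV _ (is_derive_id s 1)) _; rewrite ?gt_eqF//.
      by rewrite -[LHS]/(_ * _) mulr1.
    have dX : is_derive s (1 : R) (fun t : R => t^-1 ^+ k) ((k%:R * s^-1 ^+ k.-1) * (- (s ^- 2))).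
      have -> : (fun t : R => t^-1 ^+ k) = (fun t : R => t^-1) ^+ k.
        by apply/funext => t; rewrite fctE.
      exact: is_deriveX.
    have dE : is_derive s (1 : R) (fun t : R => expR (- t^-1)) (expR (- s^-1) * s ^- 2).
      apply: (@is_derive1_comp _ expR (fun t : R => - t^-1)).
      by apply: is_derive_eq (is_deriveN dV) _; rewrite opprK.
    apply: is_derive_eq (is_deriveM1 dX dE) _.
    rewrite -!exprVn; case: k {dX} => [|k] /=; first by rewrite !mul0r add0r subr0 expr0 mul1r mulrC.
    by rewrite !exprS; ring.
  apply: (near_eq_is_derive _ h).
  near=> t; rewrite /flat_exp ifT //.
  near: t; exact: lt_nbhsr.
- have F0 j : flat_exp j 0 = 0 by rewrite /flat_exp ltxx.
  rewrite !F0 mulr0 subr0.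
  apply/is_derive1_caratheodory; exists (fun s => flat_exp k.+1 s); split.
  + move=> z; rewrite {2}/flat_exp ltxx !subr0 /flat_exp; case: ifPn => z0; last by rewrite mul0r.
    by rewrite exprS; field; rewrite gt_eqF.
  + apply/cvgrPdist_lt => e e0.
    near=> t; rewrite F0 sub0r normrN ger0_norm ?flat_exp_ge0 //.
    have [t0|t0] := ltP 0 t; last by rewrite /flat_exp ifF// ltNge t0.
    apply: (le_lt_trans (flat_exp_le _ t0)).
    rewrite expr2 mulrA -ltr_pdivlMr //.
    apply: (@le_lt_trans _ _ ((k.+3)`!%:R)).
      rewrite -[leRHS]mulr1 ler_wpM2l ?ler0n//; apply/ltW; near: t; apply: lt_nbhsl; exact: ltr01.
    rewrite ltr_pdivlMr// -ltr_pdivlMl ?ltr0n ?fact_gt0//; near: t; apply: lt_nbhsl.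
    by rewrite mulr_gt0// invr_gt0 ltr0n fact_gt0.
  + exact: F0.
Unshelve. all: by end_near. Qed.

Lemma smooth1_flat_exp k : smooth1 (flat_exp k).
Proof.
move=> n; elim: n k => // n IH k /=.
have [d ->] := is_derive1_derive1 (is_derive_flat_exp k); split=> //.
under eq_fun do rewrite -mulNr.
apply: derivable_uptoD => //; apply: derivable_uptoM => //; exact: derivable_upto_cst.
Qed.

Definition smooth_step (s : R) : R :=
  flat_exp 0 (1 + s) * (flat_exp 0 (1 + s) + flat_exp 0 (1 - s))^-1.

Lemma smooth_step_den s : 0 < flat_exp 0 (1 + s) + flat_exp 0 (1 - s).
Proof.
have [s0|s0] := leP 0 s.
  by rewrite ltr_pwDl ?flat_exp_ge0// flat_exp_gt0 //; lra.
by rewrite ltr_wpDl ?flat_exp_ge0// flat_exp_gt0 //; lra.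
Qed.

Lemma smooth1_step : smooth1 smooth_step.
Proof.
have h1 : smooth1 (fun s => flat_exp 0 (1 + s)).
  have := smooth1_affine 1 1 (smooth1_flat_exp 0).
  by under eq_fun do rewrite mul1r addrC.
have h2 : smooth1 (fun s => flat_exp 0 (1 - s)).
  have := smooth1_affine (-1) 1 (smooth1_flat_exp 0).
  by under eq_fun do rewrite mulN1r addrC.
apply: smooth1M => //; apply: smooth1V; last exact: smooth1D.
by move=> s; rewrite gt_eqF // smooth_step_den.
Qed.

Lemma smooth_step_le s : s <= -1 -> smooth_step s = 0.
Proof. by move=> s1; rewrite /smooth_step {1}/flat_exp ifF ?mul0r//; apply/negbTE; rewrite -leNgt; lra. Qed.

Lemma smooth_step_ge s : 1 <= s -> smooth_step s = 1.
Proof.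
move=> s1; rewrite /smooth_step [flat_exp 0 (1 - s)]/flat_exp ifF; last by apply/negbTE; rewrite -leNgt; lra.
by rewrite addr0 divff// gt_eqF// flat_exp_gt0//; lra.
Qed.

Lemma smooth_step_itv s : 0 <= smooth_step s <= 1.
Proof.
apply/andP; split; first by rewrite mulr_ge0 ?flat_exp_ge0// invr_ge0 ltW// smooth_step_den.
by rewrite ler_pdivrMr ?smooth_step_den// mul1r lerDl flat_exp_ge0.
Qed.

Lemma derive1_step_out s : 1 < `|s| -> derive1 smooth_step s = 0.
Proof.
move=> s1; rewrite derive1E.
have [s0|s0] := ltP s 0.
  suff h : is_derive s (1 : R) smooth_step 0 by rewrite derive_val.
  apply: (near_eq_is_derive _ (is_derive_cst (0 : R) s (1 : R))).
  near=> t; rewrite smooth_step_le //; apply/ltW; near: t; apply: lt_nbhsl.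
  by move: s1; rewrite ltr0_norm//; lra.
suff h : is_derive s (1 : R) smooth_step 0 by rewrite derive_val.
apply: (near_eq_is_derive _ (is_derive_cst (1 : R) s (1 : R))).
near=> t; rewrite smooth_step_ge //; apply/ltW; near: t; apply: lt_nbhsr.
by move: s1; rewrite ger0_norm//; lra.
Unshelve. all: by end_near. Qed.

End Smooth1.

(** * Tensor products and test functions *)

Section Tensors.
Variable R : realType.
Implicit Types (f g : 'I_3 -> R -> R) (h : R -> R) (x y : space3 R) (i j : 'I_3).

Definition xcoord x i : R :=
  if i == 0 :> nat then x.1.1 else if i == 1%N :> nat then x.1.2 else x.2.

Definition tens f x : R := \prod_(i < 3) f i (xcoord x i).

Definition tens4 f h (z : spacetime R) : R := tens f z.1 * h z.2.

Definition diff_at j f i : R -> R := if i == j then derive1 (f i) else f i.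

Definition unit_dir j : space3 R :=
  ((j == 0 :> nat)%:R, (j == 1%N :> nat)%:R, (j == 2%N :> nat)%:R).

Lemma I3_cases (P : 'I_3 -> Prop) : P ord0 -> P (inord 1) -> P (inord 2) -> forall i, P i.
Proof.
move=> P0 P1 P2 [[|[|[|//]]] ?].
- by rewrite (_ : Ordinal _ = ord0) //; exact: val_inj.
- by rewrite (_ : Ordinal _ = inord 1) //; apply: val_inj; rewrite /= inordK.
- by rewrite (_ : Ordinal _ = inord 2) //; apply: val_inj; rewrite /= inordK.
Qed.

Lemma coord_line x j (s : R) i : xcoord (s *: unit_dir j + x) i = s * (i == j)%:R + xcoord x i.
Proof.
rewrite /xcoord -val_eqE.
by case: i => [[|[|[|//]]] ?]; case: j => [[|[|[|//]]] ?]; rewrite /= -[_ *: _]/(_ * _).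
Qed.

(** The two difference quotients are the same function of the step, so a
    directional derivative in any normed space reduces to one variable. *)
Lemma is_derive_line (V : normedModType R) (F : V -> R) (z v : V) (d : R) :
  is_derive (0 : R) (1 : R) (fun s : R => F (s *: v + z)) d -> is_derive z v F d.
Proof.
move=> [dF vF].
have E : (fun s : R => s^-1 *: (((fun s : R => F (s *: v + z)) \o shift 0) (s *: (1 : R)) -
   (fun s : R => F (s *: v + z)) 0)) = (fun s : R => s^-1 *: ((F \o shift z) (s *: v) - F z)).
  apply/funext => s /=; rewrite scale0r add0r addr0.
  by congr (_ *: (F (_ + _) - _)); rewrite -[s *: 1]/(s * 1) mulr1.
by apply: DeriveDef; rewrite /derivable /derive -?E.
Qed.

Lemma is_derive_shift1 h (d c : R) : is_derive c (1 : R) h d ->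
  is_derive (0 : R) (1 : R) (fun s => h (s + c)) d.
Proof.
move=> hd; rewrite -[d]mulr1; apply: (@is_derive1_comp _ h (fun s => s + c)).
  by rewrite add0r.
apply: is_derive_eq (is_deriveD (is_derive_id (0 : R) (1 : R)) (is_derive_cst c (0:R) (1:R))) _.
by rewrite addr0.
Qed.

Lemma is_derive_Z h (d c s : R) : is_derive s (1 : R) h d ->
  is_derive s (1 : R) (fun s => c * h s) (c * d).
Proof. by move=> hd; apply: is_derive_eq (is_deriveM1 (is_derive_cst c s 1) hd) _; rewrite mul0r add0r. Qed.

Lemma tens_line f x j (s : R) :
  tens f (s *: unit_dir j + x) = (\prod_(i < 3 | i != j) f i (xcoord x i)) * f j (s + xcoord x j).
Proof.
rewrite /tens (bigD1 j) //= mulrC coord_line eqxx mulr1; congr (_ * _).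
by apply: eq_bigr => i /negbTE ij; rewrite coord_line ij mulr0 add0r.
Qed.

Lemma tens_diff_at f x j :
  tens (diff_at j f) x = (\prod_(i < 3 | i != j) f i (xcoord x i)) * derive1 (f j) (xcoord x j).
Proof.
rewrite /tens (bigD1 j) //= mulrC /diff_at eqxx; congr (_ * _).
by apply: eq_bigr => i /negbTE ij; rewrite ij.
Qed.

Lemma is_derive_tens f x j : (forall i, smooth1 (f i)) ->
  is_derive x (unit_dir j) (tens f) (tens (diff_at j f) x).
Proof.
move=> sf; apply: is_derive_line.
under eq_fun do rewrite tens_line.
rewrite tens_diff_at; apply: is_derive_Z; apply: is_derive_shift1.
exact: smooth1_is_derive.
Qed.

Lemma smooth1_diff_at f j : (forall i, smooth1 (f i)) -> forall i, smooth1 (diff_at j f i).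
Proof. by move=> sf i; rewrite /diff_at; case: ifP => // _; exact: smooth1_derive1. Qed.

Lemma diff_atC f j k : diff_at j (diff_at k f) = diff_at k (diff_at j f).
Proof.
apply/funext => i; rewrite /diff_at; case: (eqVneq i j) => [->|ij]; last by case: ifP.
by case: ifP.
Qed.

Lemma direction_Some j (s : R) (z : spacetime R) :
  s *: direction R (Some j) + z = (s *: unit_dir j + z.1, z.2).
Proof.
case: z => x t /=; rewrite /direction /unit_dir.
by rewrite -[LHS]/(s *: unit_dir j + x, s * 0 + t) mulr0 add0r.
Qed.

Lemma direction_None (s : R) (z : spacetime R) :
  s *: direction R None + z = (z.1, s + z.2).
Proof.
case: z => [[[a b] c] t] /=; rewrite /direction.
congr (_, _, _, _); rewrite /= -[_ *: _]/(_ * _) ?mulr0 ?add0r //.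
by rewrite mulr1.
Qed.

Lemma is_derive_tens4_Some f h z j : (forall i, smooth1 (f i)) ->
  is_derive z (direction R (Some j)) (tens4 f h) (tens4 (diff_at j f) h z).
Proof.
move=> sf; apply: is_derive_line.
under eq_fun do rewrite direction_Some /tens4 /= mulrC.
rewrite /tens4 mulrC; apply: is_derive_Z.
under eq_fun do rewrite tens_line.
rewrite tens_diff_at; apply: is_derive_Z; apply: is_derive_shift1.
exact: smooth1_is_derive.
Qed.

Lemma is_derive_tens4_None f h z : smooth1 h ->
  is_derive z (direction R None) (tens4 f h) (tens4 f (derive1 h) z).
Proof.
move=> sh; apply: is_derive_line.
under eq_fun do rewrite direction_None /tens4 /=.
apply: is_derive_Z; apply: is_derive_shift1.
exact: smooth1_is_derive.
Qed.

Lemma partial_tens4_Some f h j : (forall i, smooth1 (f i)) ->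
  partial (Some j) (tens4 f h) = tens4 (diff_at j f) h.
Proof.
move=> sf; apply/funext => z; rewrite /partial.
by have := is_derive_tens4_Some h z j sf => H; rewrite derive_val.
Qed.

Lemma partial_tens4_None f h : smooth1 h ->
  partial None (tens4 f h) = tens4 f (derive1 h).
Proof.
move=> sh; apply/funext => z; rewrite /partial.
by have := is_derive_tens4_None f z sh => H; rewrite derive_val.
Qed.

Lemma coord_continuous i : continuous (xcoord^~ i : space3 R -> R).
Proof.
elim/I3_cases: i => x; rewrite /xcoord /= ?inordK //=.
- apply: continuous_comp; exact: cvg_fst.
- by apply: continuous_comp; [exact: cvg_fst | exact: cvg_snd].
- exact: cvg_snd.
Qed.

Lemma tens_continuous f : (forall i, smooth1 (f i)) -> continuous (tens f).
Proof.
move=> sf.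
have cf i : continuous (fun x : space3 R => f i (xcoord x i)).
  move=> x; apply: (continuous_comp (f := xcoord^~ i) (g := f i)); first exact: coord_continuous.
  exact: smooth1_continuous.
have -> : tens f = (fun x => f ord0 (xcoord x ord0) *
   (f (lift ord0 ord0) (xcoord x (lift ord0 ord0)) *
    f (lift ord0 (lift ord0 ord0)) (xcoord x (lift ord0 (lift ord0 ord0))))).
  by apply/funext => x; rewrite /tens !big_ord_recl big_ord0 mulr1.
by move=> x; apply: cvgM; [exact: cf | apply: cvgM; exact: cf].
Qed.

Lemma tens4_continuous f h : (forall i, smooth1 (f i)) -> smooth1 h -> continuous (tens4 f h).
Proof.
move=> sf sh z; apply: cvgM.
  by apply: (continuous_comp (f := fst) (g := tens f)); [exact: cvg_fst | exact: tens_continuous].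
by apply: (continuous_comp (f := snd) (g := h)); [exact: cvg_snd | exact: smooth1_continuous].
Qed.

(** Partial derivatives of tensor products are tensor products of derivatives,
    so all iterated partial derivatives are covered by an induction on the
    list of directions. *)
Lemma smooth_tens4 f h : (forall i, smooth1 (f i)) -> smooth1 h -> smooth (tens4 f h).
Proof.
move=> sf sh l.
have [f' [h' [-> sf' sh']]] : exists f' h', [/\ partials l (tens4 f h) = tens4 f' h',
    forall i, smooth1 (f' i) & smooth1 h'].
  elim: l => [|k l [f' [h' [E sf' sh']]]]; first by exists f, h.
  rewrite /= E; case: k => [j|].
    exists (diff_at j f'), h'; split=> //; first exact: partial_tens4_Some.
    exact: smooth1_diff_at.
  exists f', (derive1 h'); split=> //; first exact: partial_tens4_None.
  exact: smooth1_derive1.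
split; first exact: tens4_continuous.
move=> [j|] z; first by have [] := is_derive_tens4_Some h' z j sf'.
by have [] := is_derive_tens4_None f' z sh'.
Qed.

Definition per1 h := smooth1 h /\ forall s, h (s + 1) = h s.

Lemma per1_int h : (forall s, h (s + 1) = h s) -> forall (k : int) s, h (s + k%:~R) = h s.
Proof.
move=> p1; have pn (n : nat) s : h (s + n%:R) = h s.
  by elim: n s => [|n IH] s; rewrite ?addr0 // -natr1 addrA p1.
move=> [n|n] s; first exact: pn.
by rewrite NegzE mulrNz; have := pn n.+1 (s - n.+1%:R); rewrite subrK => ->.
Qed.

Lemma tens_periodic f : (forall i, per1 (f i)) -> torus_periodic (tens f).
Proof.
move=> pf x k; rewrite /tens; apply: eq_bigr => i _.
have [_ /per1_int p] := pf i.
by elim/I3_cases: i p => p; rewrite /xcoord /= ?inordK //= p.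
Qed.

Lemma test_function_tens4 f h (a b : R) : (forall i, per1 (f i)) -> smooth1 h -> 0 < a ->
  (forall t, h t != 0 -> a <= t <= b) -> test_function (tens4 f h).
Proof.
move=> pf sh a0 hab; split.
- by apply: smooth_tens4 => // i; case: (pf i).
- by move=> t x k; rewrite /tens4 /= tens_periodic.
- by exists a, b; split=> // z; rewrite /tens4 mulf_eq0 negb_or => /andP[_ /hab].
Qed.

End Tensors.

(** * Calculus with sums of tensor products *)

Notation mspace3 R := (measurableTypeR R * measurableTypeR R * measurableTypeR R)%type.

Section RealIntegrals.
Context d (T : measurableType d) (R : realType) (mu : probability T R).
Implicit Types f g : T -> R.

Definition rintegrable f := mu.-integrable [set: T] (EFin \o f).

Lemma rintegrable_measurable f : rintegrable f -> measurable_fun [set: T] f.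
Proof. by move=> /integrableP[/measurable_EFinP]. Qed.

Lemma rintegrable_le f g : measurable_fun [set: T] f -> (forall x, `|f x| <= g x) ->
  rintegrable g -> rintegrable f.
Proof.
move=> mf fg ig; apply: le_integrable ig => //.
  exact/measurable_EFinP.
by move=> x _; rewrite /= lee_fin (le_trans (fg x))// ler_norm.
Qed.

Lemma rintegrable_cst (c : R) : rintegrable (fun _ => c).
Proof. exact: finite_measure_integrable_cst. Qed.

Lemma rintegrable_bounded f (M : R) : measurable_fun [set: T] f -> (forall x, `|f x| <= M) ->
  rintegrable f.
Proof. by move=> mf fM; apply: rintegrable_le (rintegrable_cst M). Qed.

Lemma rintegrableZ (c : R) f : rintegrable f -> rintegrable (fun x => c * f x).
Proof. by move=> sf; have := integrableZl measurableT c sf. Qed.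

Lemma rintegrableM f g (M : R) : rintegrable f -> measurable_fun [set: T] g ->
  (forall x, `|g x| <= M) -> rintegrable (fun x => f x * g x).
Proof.
move=> sf mg gM; have sn : rintegrable (fun x => `|f x|) by exact: integrable_norm.
apply: (@rintegrable_le _ (fun x => M * `|f x|)); last exact: rintegrableZ.
  by apply: measurable_funM => //; exact: rintegrable_measurable.
by move=> x; rewrite normrM mulrC ler_wpM2r.
Qed.

Lemma rintegrableD f g : rintegrable f -> rintegrable g -> rintegrable (fun x => f x + g x).
Proof. by move=> sf sg; have := integrableD measurableT sf sg. Qed.

Lemma rintegrableB f g : rintegrable f -> rintegrable g -> rintegrable (fun x => f x - g x).
Proof. by move=> sf sg; have := integrableB measurableT sf sg. Qed.

Lemma rintegrable_sum (I : Type) (s : seq I) (F : I -> T -> R) :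
  (forall i, rintegrable (F i)) -> rintegrable (fun x => \sum_(i <- s) F i x).
Proof.
move=> sF; elim: s => [|i s IH].
  by under eq_fun do rewrite big_nil; exact: rintegrable_cst.
by under eq_fun do rewrite big_cons; exact: rintegrableD.
Qed.

Lemma IntD f g : rintegrable f -> rintegrable g ->
  \int[mu]_x (f x + g x) = \int[mu]_x f x + \int[mu]_x g x.
Proof. by move=> sf sg; rewrite RintegralD. Qed.

Lemma IntB f g : rintegrable f -> rintegrable g ->
  \int[mu]_x (f x - g x) = \int[mu]_x f x - \int[mu]_x g x.
Proof. by move=> sf sg; rewrite RintegralB. Qed.

Lemma Int_cst (c : R) : \int[mu]_x c = c.
Proof. by rewrite Rintegral_cst//; have -> : fine _ = 1 := congr1 fine (probability_setT mu); rewrite mulr1. Qed.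

Lemma IntZ (c : R) f : rintegrable f -> \int[mu]_x (c * f x) = c * \int[mu]_x f x.
Proof. by move=> sf; rewrite RintegralZl. Qed.

Lemma IntZr (c : R) f : rintegrable f -> \int[mu]_x (f x * c) = (\int[mu]_x f x) * c.
Proof. by move=> sf; rewrite RintegralZr. Qed.

Lemma Int_sum (I : Type) (s : seq I) (F : I -> T -> R) : (forall i, rintegrable (F i)) ->
  \int[mu]_x (\sum_(i <- s) F i x) = \sum_(i <- s) \int[mu]_x F i x.
Proof.
move=> sF; elim: s => [|i s IH].
  rewrite big_nil; under eq_Rintegral do rewrite big_nil.
  by rewrite Rintegral_cst// mul0r.
rewrite big_cons -IH -IntD //; last exact: rintegrable_sum.
by apply: eq_Rintegral => x _; rewrite big_cons.
Qed.

Lemma Int_le f g : rintegrable f -> rintegrable g -> (forall x, f x <= g x) ->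
  \int[mu]_x f x <= \int[mu]_x g x.
Proof. by move=> sf sg fg; apply: le_Rintegral. Qed.

Lemma norm_Int f : rintegrable f -> `|\int[mu]_x f x| <= \int[mu]_x `|f x|.
Proof. by move=> sf; apply: le_normr_Rintegral. Qed.

Lemma EFin_Int f : rintegrable f -> (\int[mu]_x f x)%:E = (\int[mu]_x (f x)%:E)%E.
Proof. by move=> sf; rewrite /Rintegral fineK // integrable_fin_num. Qed.

End RealIntegrals.

Section ProductIntegrals.
Context d1 d2 (T1 : measurableType d1) (T2 : measurableType d2) (R : realType)
  (m1 : {sigma_finite_measure set T1 -> \bar R}) (m2 : {sigma_finite_measure set T2 -> \bar R}).

Lemma Int_prod (f : T1 -> R) (g : T2 -> R) :
  m1.-integrable [set: T1] (EFin \o f) -> m2.-integrable [set: T2] (EFin \o g) ->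
  (m1 \x m2)%E.-integrable [set: T1 * T2] (EFin \o (fun z => f z.1 * g z.2)) ->
  \int[(m1 \x m2)%E]_z (f z.1 * g z.2) = (\int[m1]_x f x) * (\int[m2]_y g y).
Proof.
move=> sf sg sfg.
rewrite /Rintegral -(integral12_prod_meas1 sfg) /fubini_F /=.
under eq_integral => x _.
  have -> : (\int[m2]_y (f x * g y)%:E)%E = (f x * \int[m2]_y g y)%:E.
    by rewrite -RintegralZl // /Rintegral fineK// integrable_fin_num//; have := integrableZl measurableT (f x) sg.
  over.
rewrite -RintegralZr //.
Qed.

End ProductIntegrals.

Section Circle.
Variable R : realType.
Implicit Types h : R -> R.

Lemma per1_bounded h : per1 h -> exists2 M : R, 0 <= M & forall s, `|h s| <= M.
Proof.
move=> [sh p1].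
have [M [_ hM]] : bounded_set (h @` (`[0, 1]%classic : set R)).
  apply: compact_bounded; apply: continuous_compact; last exact: segment_compact.
  by apply: continuous_subspaceT; exact: smooth1_continuous.
exists (`|M| + 1) => [|s]; first by rewrite addr_ge0.
have := per1_int p1 (- Num.floor s) s => <-.
apply: (hM (`|M| + 1)); first by rewrite (le_lt_trans (ler_norm M))// ltrDl.
exists (s + (- Num.floor s)%:~R) => //=; rewrite in_itv /= rmorphN /= subr_ge0 lerBlDr.
rewrite ge_floor /= addrC; apply: ltW; have := Num.Theory.floorD1_gt s; rewrite intrD//.
Qed.

Lemma per1_measurable h : per1 h -> measurable_fun [set: measurableTypeR R] h.
Proof.
by move=> [sh _]; apply: measurable_realfun.continuous_measurable_fun; exact: smooth1_continuous.
Qed.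

Lemma per1_rintegrable h : per1 h -> rintegrable (circle_measure R) h.
Proof.
by move=> ph; have [M _ hM] := per1_bounded ph; apply: (@rintegrable_bounded _ _ _ (circle_measure R : probability _ R) _ M) => //; exact: per1_measurable.
Qed.

(** The circle is the half-open unit interval, whereas the fundamental theorem
    of calculus concerns the closed one. *)
Lemma circle_integral h : per1 h ->
  (\int[circle_measure R]_s (h s)%:E = \int[@lebesgue_measure R]_(s in `[0%R, 1%R]) (h s)%:E)%E.
Proof.
move=> ph; have mh := per1_measurable ph.
pose D := `[0%R : R, 1%R[%classic : set (measurableTypeR R).
have mD : measurable D by exact: measurable_itv.
have mDC : measurable (~` D) by exact: measurableC.
rewrite -integral_itv_bndo_bndc; last by apply/measurable_EFinP; exact: measurable_funTS.
rewrite -(@eq_measure_integral _ _ _ D _ (circle_measure R)); last first.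
  move=> A mA AD; rewrite -[LHS]/(lebesgue_measure (A `&` D)) setIidl//.
have D0 : circle_measure R (~` D) = 0%E.
  by rewrite -[LHS]/(lebesgue_measure (~` D `&` D)) setICl measure0.
rewrite (_ : D = setT `\` ~` D); last by rewrite setTD setCK.
by apply: negligible_integral => //; exact: per1_rintegrable.
Qed.

Lemma per1_derive1 h : per1 h -> per1 (derive1 h).
Proof.
move=> [sh p1]; split; first exact: smooth1_derive1.
move=> s; have := derive1_affine 1 1 sh.
under eq_fun do rewrite mul1r p1.
by move=> /(congr1 (fun F => F s)) /=; rewrite !mul1r => <-.
Qed.

Lemma circle_derive1 h : per1 h -> \int[circle_measure R]_s (derive1 h s) = 0.
Proof.
move=> ph; have [sh p1] := ph.
rewrite /Rintegral circle_integral; last exact: per1_derive1.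
rewrite (@continuous_FTC2 R _ h 0 1) //.
- by rewrite -{1}[1]add0r p1 -EFinB subrr.
- by apply: continuous_subspaceT; apply: smooth1_continuous; exact: smooth1_derive1.
- split=> [x _||]; first exact: smooth1_derivable.
    by apply: cvg_at_right_filter; exact: smooth1_continuous.
  by apply: cvg_at_left_filter; exact: smooth1_continuous.
Qed.

Lemma per1_cst (c : R) : per1 (fun _ => c).
Proof. by split=> //; exact: smooth1_cst. Qed.

Lemma per1M h k : per1 h -> per1 k -> per1 (fun s => h s * k s).
Proof. by move=> [sh ph] [sk pk]; split=> [|s]; [exact: smooth1M | rewrite ph pk]. Qed.

End Circle.

Section Nice.
Variable R : realType.
Local Notation mu := (torus_measure R).
Implicit Types (f : 'I_3 -> R -> R) (F G : space3 R -> R) (x y : space3 R) (i j : 'I_3).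

Lemma per1_diff_at j f : (forall i, per1 (f i)) -> forall i, per1 (diff_at j f i).
Proof. by move=> pf i; rewrite /diff_at; case: ifP => // _; exact: per1_derive1. Qed.

Lemma tens_ord f x : tens f x = f ord0 x.1.1 * f (inord 1) x.1.2 * f (inord 2) x.2.
Proof.
rewrite /tens !big_ord_recl big_ord0 mulr1 mulrA.
have -> : lift ord0 ord0 = inord 1 :> 'I_3 by apply: val_inj; rewrite /= inordK.
have -> : lift ord0 (lift ord0 ord0) = inord 2 :> 'I_3 by apply: val_inj; rewrite /= inordK.
by rewrite /xcoord /= inordK //= inordK.
Qed.

Lemma tens_bounded f : (forall i, per1 (f i)) -> exists2 M : R, 0 <= M & forall x, `|tens f x| <= M.
Proof.
move=> pf.
have [M0 M00 h0] := per1_bounded (pf ord0).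
have [M1 M10 h1] := per1_bounded (pf (inord 1)).
have [M2 M20 h2] := per1_bounded (pf (inord 2)).
exists (M0 * M1 * M2) => [|x]; first by rewrite !mulr_ge0.
by rewrite tens_ord !normrM !ler_pM ?mulr_ge0.
Qed.

Lemma tens_measurable f : (forall i, per1 (f i)) -> measurable_fun [set: mspace3 R] (tens f).
Proof.
move=> pf; have m i := per1_measurable (pf i).
rewrite (_ : tens f = fun x => f ord0 x.1.1 * f (inord 1) x.1.2 * f (inord 2) x.2); last by apply/funext => x; rewrite tens_ord.
apply: measurable_funM; last exact: (measurableT_comp (m _) measurable_snd).
have mf : measurable_fun [set: mspace3 R] (fst : mspace3 R -> _) by exact: measurable_fst.
apply: measurable_funM; first exact: (measurableT_comp (m _) (measurableT_comp measurable_fst mf)).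
exact: (measurableT_comp (m _) (measurableT_comp measurable_snd mf)).
Qed.

Lemma tens_rintegrable f : (forall i, per1 (f i)) -> rintegrable mu (tens f).
Proof.
move=> pf; have [M _ hM] := tens_bounded pf.
by apply: (@rintegrable_bounded _ _ _ (mu : probability _ R) _ M) => //; exact: tens_measurable.
Qed.

Lemma Int_tens f : (forall i, per1 (f i)) ->
  \int[mu]_x tens f x = \prod_(i < 3) \int[circle_measure R]_s f i s.
Proof.
move=> pf; under eq_Rintegral do rewrite tens_ord.
have m i := per1_measurable (pf i).
have [M0 M00 h0] := per1_bounded (pf ord0).
have [M1 M10 h1] := per1_bounded (pf (inord 1)).
have [M2 M20 h2] := per1_bounded (pf (inord 2)).
have sc i : (circle_measure R).-integrable setT (EFin \o f i) by exact: per1_rintegrable.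
have s2 : (circle_measure R \x circle_measure R)%E.-integrable setT
    (EFin \o (fun z => f ord0 z.1 * f (inord 1) z.2)).
  apply: (@rintegrable_bounded _ _ _ ((circle_measure R \x circle_measure R)%E : probability _ R) _ (M0 * M1)).
    apply: measurable_funM; first exact: (measurableT_comp (m _) measurable_fst).
    exact: (measurableT_comp (m _) measurable_snd).
  by move=> x; rewrite normrM ler_pM.
have s3 : (circle_measure R \x circle_measure R \x circle_measure R)%E.-integrable setT
    (EFin \o (fun x => f ord0 x.1.1 * f (inord 1) x.1.2 * f (inord 2) x.2)).
  have := tens_rintegrable pf; rewrite /rintegrable.
  by under [EFin \o tens f]eq_fun do rewrite /= tens_ord.
have E2 := @Int_prod _ _ _ _ _ (circle_measure R : {sigma_finite_measure set _ -> \bar R})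
  (circle_measure R : {sigma_finite_measure set _ -> \bar R}) (f ord0) (f (inord 1)) (sc _) (sc _) s2.
have E3 := @Int_prod _ _ _ _ _ (((circle_measure R \x circle_measure R)%E : probability _ R) : {sigma_finite_measure set _ -> \bar R})
  (circle_measure R : {sigma_finite_measure set _ -> \bar R})
  (fun z => f ord0 z.1 * f (inord 1) z.2) (f (inord 2)) s2 (sc _) s3.
rewrite [LHS]E3 [X in X * _]E2.
rewrite !big_ord_recl big_ord0 mulr1 mulrA.
have -> : lift ord0 ord0 = inord 1 :> 'I_3 by apply: val_inj; rewrite /= inordK.
by have -> : lift ord0 (lift ord0 ord0) = inord 2 :> 'I_3 by apply: val_inj; rewrite /= inordK.
Qed.

(** A class of smooth periodic fields that contains every regularized field
    and is stable under products and derivatives, while integrals and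
    integrations by parts reduce to one variable. *)
Inductive tensor_sum : (space3 R -> R) -> Prop :=
| tensor_sum_tens f : (forall i, per1 (f i)) -> tensor_sum (tens f)
| tensor_sum_add F G : tensor_sum F -> tensor_sum G -> tensor_sum (fun x => F x + G x).

Lemma tensor_sumE F G : F = G -> tensor_sum F -> tensor_sum G. Proof. by move=> ->. Qed.

Lemma tensor_sum_scale (c : R) F : tensor_sum F -> tensor_sum (fun x => c * F x).
Proof.
elim=> [f pf|{}F G _ IF _ IG]; last first.
  by apply: tensor_sumE (tensor_sum_add IF IG); apply/funext => x; rewrite mulrDr.
pose f' i s := (if i == ord0 then c else 1) * f i s.
have -> : (fun x => c * tens f x) = tens f'.
  by apply/funext => x; rewrite !tens_ord /f' eqxx -!val_eqE /= !inordK//= !mul1r !mulrA.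
by apply: tensor_sum_tens => i; apply: per1M => //; exact: per1_cst.
Qed.

Lemma tensor_sum_cst (c : R) : tensor_sum (fun _ => c).
Proof.
have : tensor_sum (tens (fun _ _ => 1)) by apply: tensor_sum_tens => i; exact: per1_cst.
by move=> /(tensor_sum_scale c); apply: tensor_sumE; apply/funext => x; rewrite tens_ord !mulr1.
Qed.

Lemma tensor_sum_sum (I : Type) (s : seq I) (F : I -> space3 R -> R) : (forall a, tensor_sum (F a)) ->
  tensor_sum (fun x => \sum_(i <- s) F i x).
Proof.
move=> nF; elim: s => [|a s IH].
  by under eq_fun do rewrite big_nil; exact: tensor_sum_cst.
by under eq_fun do rewrite big_cons; exact: tensor_sum_add.
Qed.

Lemma tensor_sum_sub F G : tensor_sum F -> tensor_sum G -> tensor_sum (fun x => F x - G x).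
Proof.
move=> nF nG; apply: tensor_sumE (tensor_sum_add nF (tensor_sum_scale (-1) nG)).
by apply/funext => x; rewrite mulN1r.
Qed.

Lemma tensor_sum_mul F G : tensor_sum F -> tensor_sum G -> tensor_sum (fun x => F x * G x).
Proof.
move=> nF; elim: nF G => [f pf|{}F F' _ IF _ IF'] G nG; last first.
  by apply: tensor_sumE (tensor_sum_add (IF _ nG) (IF' _ nG)); apply/funext => x; rewrite mulrDl.
elim: nG => [g pg|{}G G' _ IG _ IG']; last first.
  by apply: tensor_sumE (tensor_sum_add IG IG'); apply/funext => x; rewrite mulrDr.
have -> : (fun x => tens f x * tens g x) = tens (fun i s => f i s * g i s).
  by apply/funext => x; rewrite /tens -big_split.
by apply: tensor_sum_tens => i; exact: per1M.
Qed.

Lemma tensor_sum_bounded F : tensor_sum F -> exists2 M : R, 0 <= M & forall x, `|F x| <= M.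
Proof.
elim=> [f pf|{}F G _ [M M0 FM] _ [N N0 GN]]; last first.
  exists (M + N) => [|x]; first exact: addr_ge0.
  by rewrite (le_trans (ler_normD _ _))// lerD.
exact: tens_bounded.
Qed.

Lemma tensor_sum_measurable F : tensor_sum F -> measurable_fun [set: mspace3 R] F.
Proof.
elim=> [f pf|{}F G _ IF _ IG]; last exact: measurable_funD.
exact: tens_measurable.
Qed.

Lemma tensor_sum_rintegrable F : tensor_sum F -> rintegrable mu F.
Proof.
by move=> nF; have [M _ FM] := tensor_sum_bounded nF; apply: (@rintegrable_bounded _ _ _ (mu : probability _ R) _ M) => //; exact: tensor_sum_measurable.
Qed.

Lemma rintegrable_tensor_sum F G : rintegrable mu F -> tensor_sum G -> rintegrable mu (fun x => F x * G x).
Proof.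
by move=> sF nG; have [M _ GM] := tensor_sum_bounded nG; apply: (@rintegrableM _ _ _ (mu : probability _ R) _ _ M) => //; exact: tensor_sum_measurable.
Qed.

Definition pd j F : space3 R -> R := fun x => 'D_(unit_dir R j) F x.

Lemma tensor_sum_derivable F : tensor_sum F -> forall j x, derivable F x (unit_dir R j).
Proof.
elim=> [f pf|{}F G _ IF _ IG] j x.
  by have [] := @is_derive_tens _ f x j (fun i => proj1 (pf i)).
exact: derivableD.
Qed.

Lemma pd_tens f j : (forall i, per1 (f i)) -> pd j (tens f) = tens (diff_at j f).
Proof.
move=> pf; apply/funext => x; rewrite /pd.
by have H := @is_derive_tens _ f x j (fun i => proj1 (pf i)); rewrite derive_val.
Qed.

Lemma pdD j F G : tensor_sum F -> tensor_sum G -> pd j (fun x => F x + G x) = (fun x => pd j F x + pd j G x).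
Proof.
move=> nF nG; apply/funext => x; rewrite /pd -deriveD //; exact: tensor_sum_derivable.
Qed.

Lemma pd_cst j (c : R) : pd j (fun _ => c) = (fun _ => 0).
Proof. by apply/funext => x; rewrite /pd derive_cst. Qed.

Lemma pdM j F G : tensor_sum F -> tensor_sum G ->
  pd j (fun x => F x * G x) = (fun x => pd j F x * G x + F x * pd j G x).
Proof.
move=> nF nG; apply/funext => x; rewrite /pd.
have -> : (fun x => F x * G x) = F * G by apply/funext.
rewrite deriveM; [|exact: tensor_sum_derivable|exact: tensor_sum_derivable].
by rewrite addrC -[_ *: _]/(_ * _) -[F x *: _]/(_ * _) [G x * _]mulrC.
Qed.

Lemma pdZ j (c : R) F : tensor_sum F -> pd j (fun x => c * F x) = (fun x => c * pd j F x).
Proof.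
move=> nF; rewrite (pdM j (tensor_sum_cst c) nF) pd_cst; apply/funext => x.
by rewrite mul0r add0r.
Qed.

Lemma pdB j F G : tensor_sum F -> tensor_sum G -> pd j (fun x => F x - G x) = (fun x => pd j F x - pd j G x).
Proof.
move=> nF nG; under eq_fun do rewrite -mulN1r.
rewrite pdD//; last exact: tensor_sum_scale.
by rewrite pdZ//; apply/funext => x; rewrite mulN1r.
Qed.

Lemma pd_sum j (I : Type) (s : seq I) (F : I -> space3 R -> R) : (forall a, tensor_sum (F a)) ->
  pd j (fun x => \sum_(i <- s) F i x) = (fun x => \sum_(i <- s) pd j (F i) x).
Proof.
move=> nF; elim: s => [|a s IH].
  by under eq_fun do rewrite big_nil; rewrite pd_cst; apply/funext => x; rewrite big_nil.
under eq_fun do rewrite big_cons; rewrite pdD ?IH//; last exact: tensor_sum_sum.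
by apply/funext => x; rewrite big_cons.
Qed.

Lemma tensor_sum_pd j F : tensor_sum F -> tensor_sum (pd j F).
Proof.
elim=> [f pf|{}F G nF IF nG IG]; last by rewrite pdD//; exact: tensor_sum_add.
by rewrite pd_tens//; apply: tensor_sum_tens; exact: per1_diff_at.
Qed.

Lemma pdC j k F : tensor_sum F -> pd j (pd k F) = pd k (pd j F).
Proof.
elim=> [f pf|{}F G nF IF nG IG].
  rewrite (pd_tens k pf) (pd_tens j pf) (pd_tens j (per1_diff_at k pf)).
  by rewrite (pd_tens k (per1_diff_at j pf)) diff_atC.
rewrite (pdD k nF nG) (pdD j nF nG) (pdD _ (tensor_sum_pd k nF) (tensor_sum_pd k nG)).
by rewrite (pdD _ (tensor_sum_pd j nF) (tensor_sum_pd j nG)) IF IG.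
Qed.

Lemma Int_pd j F : tensor_sum F -> \int[mu]_x pd j F x = 0.
Proof.
elim=> [f pf|{}F G nF IF nG IG].
  rewrite pd_tens// Int_tens; last exact: per1_diff_at.
  rewrite (bigD1 j) //= /diff_at eqxx circle_derive1 ?mul0r//.
rewrite pdD// IntD ?IF ?IG ?addr0//; apply: tensor_sum_rintegrable; exact: tensor_sum_pd.
Qed.

Lemma Int_parts j F G : tensor_sum F -> tensor_sum G ->
  \int[mu]_x (pd j F x * G x) = - \int[mu]_x (F x * pd j G x).
Proof.
move=> nF nG; apply/eqP; rewrite -subr_eq0 opprK; apply/eqP.
rewrite -IntD; last 2 first.
- by apply: tensor_sum_rintegrable; apply: tensor_sum_mul => //; exact: tensor_sum_pd.
- by apply: tensor_sum_rintegrable; apply: tensor_sum_mul => //; exact: tensor_sum_pd.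
by rewrite -(Int_pd j (tensor_sum_mul nF nG)) pdM.
Qed.

End Nice.

(** * The one-dimensional kernel *)

Section Kernel1.
Variable R : realType.
Implicit Types (n m : nat) (s x y : R).

(** The mean of [cos^(2n)] over a period, by [Int_cosX]. *)
Definition wallis n : R := \prod_(k < n) ((k.*2.+1)%:R / (k.*2.+2)%:R).

Lemma wallisS n : wallis n.+1 = wallis n * ((n.*2.+1)%:R / (n.*2.+2)%:R).
Proof. by rewrite /wallis big_ord_recr. Qed.

Lemma wallis_gt0 n : 0 < wallis n.
Proof. by apply: prodr_gt0 => k _; rewrite divr_gt0. Qed.

Lemma per1_cosX_sinX a b : ~~ odd (a + b) ->
  per1 (fun s : R => cos (pi * s) ^+ a * sin (pi * s) ^+ b).
Proof.
move=> ab; split.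
  by apply: smooth1M; apply: smooth1_exp; [exact: smooth1_cospi | exact: smooth1_sinpi].
move=> s; rewrite mulrDr mulr1 cosDpi sinDpi.
rewrite -[- cos _]mulN1r -[- sin _]mulN1r !exprMn mulrACA -exprD.
by rewrite -signr_odd (negbTE ab) mul1r.
Qed.

Lemma derive1_exp (f : R -> R) n : smooth1 f ->
  derive1 (fun s => f s ^+ n.+1) = (fun s => n.+1%:R * f s ^+ n * derive1 f s).
Proof.
move=> sf; elim: n => [|n IH].
  by under eq_fun do rewrite expr1; apply/funext => s; rewrite expr0 mulr1 mul1r.
under eq_fun do rewrite exprS.
rewrite derive1M ?IH//; last exact: smooth1_exp.
by apply/funext => s; rewrite -[n.+2%:R]natr1 !exprS; ring.
Qed.

(** The derivative of [cos^(2n+1) sin] is a combination of [cos^(2n+2)] and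
    [cos^(2n)], and its mean vanishes: this is the recursion for [wallis]. *)
Lemma Int_cosX n y :
  \int[circle_measure R]_s (cos (pi * (s - y)) ^+ n.*2) = wallis n.
Proof.
have pc a : ~~ odd a -> per1 (fun s : R => cos (pi * (s - y)) ^+ a).
  move=> ha; have [sc pc] : per1 (fun s : R => cos (pi * s) ^+ a * sin (pi * s) ^+ 0).
    by apply: per1_cosX_sinX; rewrite addn0.
  have E : (fun s : R => cos (pi * (s - y)) ^+ a) =
    (fun s => (fun s : R => cos (pi * s) ^+ a * sin (pi * s) ^+ 0) (1 * s + (- y))).
    by apply/funext => s; rewrite mul1r expr0 mulr1.
  split; first by rewrite E; exact: (smooth1_affine 1 (- y) sc).
  by move=> s; rewrite /= -addrA (addrC 1) addrA mulrDr mulr1 cosDpi -mulN1r exprMn -signr_odd (negbTE ha) mul1r.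
elim: n => [|n IH].
  by under eq_Rintegral do rewrite expr0; rewrite (@Int_cst _ _ _ (circle_measure R : probability _ R)) /wallis big_ord0.
pose h s := cos (pi * s) ^+ n.*2.+1 * sin (pi * s) ^+ 1.
have [sh ph] : per1 h by apply: per1_cosX_sinX; rewrite addn1 /= negbK odd_double.
pose H s := h (1 * s + (- y)).
have pH : per1 H.
  split; first exact: smooth1_affine.
  by move=> s; rewrite /H !mul1r addrAC ph.
have dh : derive1 h = (fun s => pi * ((n.*2.+2)%:R * cos (pi * s) ^+ (n.+1).*2 - (n.*2.+1)%:R * cos (pi * s) ^+ n.*2)).
  rewrite /h derive1M; [|exact/smooth1_exp/smooth1_cospi|exact/smooth1_exp/smooth1_sinpi].
  rewrite derive1_exp; last exact: smooth1_cospi.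
  rewrite derive1_cospi; under [X in derive1 X]eq_fun do rewrite expr1.
  rewrite derive1_sinpi; apply/funext => s; rewrite expr1 doubleS -[n.*2.+2%:R]natr1.
  rewrite ![cos (pi * s) ^+ _.+1]exprS.
  have := sin2cos2 (pi * s); rewrite !expr2 => E.
  transitivity (pi * (cos (pi * s) ^+ n.*2 * (cos (pi * s) * cos (pi * s)) - (n.*2.+1)%:R * cos (pi * s) ^+ n.*2 * (sin (pi * s) * sin (pi * s)))); first ring.
  by rewrite E; ring.
have := circle_derive1 pH; rewrite /H derive1_affine// dh.
under eq_Rintegral do rewrite !mul1r.
rewrite IntZ; last first.
  by apply: rintegrableB; apply: rintegrableZ; apply: per1_rintegrable; apply: pc; rewrite odd_double.
rewrite IntB; last 2 first.
- by apply: rintegrableZ; apply: per1_rintegrable; apply: pc; rewrite odd_double.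
- by apply: rintegrableZ; apply: per1_rintegrable; apply: pc; rewrite odd_double.
rewrite !IntZ; last 2 first.
- by apply: per1_rintegrable; apply: pc; rewrite odd_double.
- by apply: per1_rintegrable; apply: pc; rewrite odd_double.
rewrite IH => /eqP; rewrite mulf_eq0 gt_eqF ?pi_gt0//= subr_eq0 => /eqP E.
apply: (@mulfI _ (n.*2.+2)%:R); first by rewrite pnatr_eq0.
rewrite E wallisS mulrA mulrCA -mulrA; congr (_ * _).
by rewrite mulrCA divff ?mulr1// pnatr_eq0.
Qed.

(** An even power of the cosine concentrates at the integers at scale
    [n^(-1/2)], and the addition formula separates [x] from [y] in
    [ker1 n (x - y)]. *)
Definition ker1 n s : R := cos (pi * s) ^+ n.*2 / wallis n.

(** The square root shares each binomial coefficient equally between the two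
    variables in [ker1B]. *)
Definition phi n k s : R :=
  Num.sqrt ('C(n.*2, k)%:R / wallis n) * (cos (pi * s) ^+ (n.*2 - k) * sin (pi * s) ^+ k).

Lemma per1_phi n (k : 'I_(n.*2).+1) : per1 (phi n k).
Proof.
apply: per1M; first exact: per1_cst.
by apply: per1_cosX_sinX; rewrite subnK ?odd_double// -ltnS.
Qed.

Lemma per1_ker1 n : per1 (ker1 n).
Proof.
have -> : ker1 n = (fun s => (wallis n)^-1 * (cos (pi * s) ^+ n.*2 * sin (pi * s) ^+ 0)).
  by apply/funext => s; rewrite /ker1 expr0 mulr1 mulrC.
by apply: per1M; [exact: per1_cst | apply: per1_cosX_sinX; rewrite addn0 odd_double].
Qed.

Lemma ker1_ge0 n s : 0 <= ker1 n s.
Proof. by rewrite divr_ge0 ?(ltW (wallis_gt0 n))// -mul2n exprM exprn_ge0// sqr_ge0. Qed.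

Lemma ker1N n s : ker1 n (- s) = ker1 n s.
Proof. by rewrite /ker1 mulrN cosN. Qed.

(** Binomial expansion of the power of [cos x cos y + sin x sin y]. *)
Lemma ker1B n x y : ker1 n (x - y) = \sum_(k < (n.*2).+1) phi n k x * phi n k y.
Proof.
rewrite /ker1 mulrBr cosB exprDn mulr_suml; apply: eq_bigr => k _.
rewrite /phi mulrACA -expr2 sqr_sqrtr; last by rewrite divr_ge0 ?ler0n// ltW// wallis_gt0.
by rewrite !exprMn -mulr_natr; ring.
Qed.

Lemma Int_ker1 n y : \int[circle_measure R]_s ker1 n (s - y) = 1.
Proof.
rewrite /ker1; under eq_Rintegral do rewrite mulrC.
rewrite IntZ ?Int_cosX ?mulVf ?gt_eqF ?wallis_gt0//.
have [sk pk] := per1_ker1 n.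
have : per1 (fun s => wallis n * ker1 n (1 * s + (- y))).
  split; first by apply: smooth1Z; exact: smooth1_affine.
  by move=> s; rewrite !mul1r addrAC pk.
move/per1_rintegrable; congr (rintegrable _ _); apply/funext => s.
by rewrite /ker1 mul1r mulrC divfK// gt_eqF// wallis_gt0.
Qed.

Lemma derive1_sum (I : Type) (r : seq I) (f : I -> R -> R) : (forall i, smooth1 (f i)) ->
  smooth1 (fun s => \sum_(i <- r) f i s) /\
  derive1 (fun s => \sum_(i <- r) f i s) = (fun s => \sum_(i <- r) derive1 (f i) s).
Proof.
move=> sf; elim: r => [|i r [IHs IHd]].
  under eq_fun do rewrite big_nil; split; first exact: smooth1_cst.
  by rewrite derive1_cst_fun; apply/funext => s; rewrite big_nil.
under eq_fun do rewrite big_cons; split; first exact: smooth1D.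
have [_ ->] := @is_derive1_derive1 _ (fun s => f i s + \sum_(j <- r) f j s)
  (fun s => derive1 (f i) s + derive1 (fun s => \sum_(j <- r) f j s) s)
  (fun s => is_deriveD (smooth1_is_derive (sf i) s) (smooth1_is_derive IHs s)).
by rewrite IHd; apply/funext => s; rewrite big_cons.
Qed.

Lemma derive1Zl (c : R) (f : R -> R) : smooth1 f -> derive1 (fun s => f s * c) = (fun s => derive1 f s * c).
Proof.
move=> sf; rewrite derive1M//; last exact: smooth1_cst.
by rewrite derive1_cst_fun; apply/funext => s; rewrite mulr0 addr0.
Qed.

Lemma ker1_dl n x y :
  \sum_(k < (n.*2).+1) derive1 (phi n k) x * phi n k y = derive1 (ker1 n) (x - y).
Proof.
have sp (k : 'I_(n.*2).+1) : smooth1 (fun s => phi n k s * phi n k y).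
  by apply: smooth1M; [case: (per1_phi k) | exact: smooth1_cst].
have [_ E] := derive1_sum (index_enum 'I_(n.*2).+1) sp.
have := @derive1_affine _ (ker1 n) 1 (- y) (proj1 (per1_ker1 n)).
under eq_fun do rewrite mul1r ker1B.
rewrite E => /(congr1 (fun F => F x)) /=; rewrite !mul1r => <-.
by apply: eq_bigr => k _; rewrite derive1Zl//; case: (per1_phi k).
Qed.

Lemma derive1_ker1 n : derive1 (ker1 n) =
  (fun s => - (pi * (n.*2)%:R * (cos (pi * s) ^+ (n.*2).-1 * sin (pi * s)) / wallis n)).
Proof.
rewrite /ker1; case: n => [|n].
  rewrite (_ : (fun _ => _) = (fun _ => (wallis 0)^-1)); last by apply/funext => s; rewrite expr0 mul1r.
  by rewrite derive1_cst_fun; apply/funext => s; rewrite mulr0 !mul0r oppr0.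
rewrite derive1Zl; last by apply: smooth1_exp; exact: smooth1_cospi.
rewrite doubleS derive1_exp; last exact: smooth1_cospi.
by rewrite derive1_cospi; apply/funext => s /=; ring.
Qed.

Lemma ker1_dr n x y :
  \sum_(k < (n.*2).+1) phi n k x * derive1 (phi n k) y = - derive1 (ker1 n) (x - y).
Proof.
under eq_bigr do rewrite mulrC; rewrite ker1_dl -opprB derive1_ker1.
by rewrite mulrN cosN sinN; case: n => [|n]; rewrite ?double0 ?mulr0 ?mul0r ?oppr0//; ring.
Qed.

(** The sequence [4 n wallis(n)^2] is equal to 1 at [n = 1] and increases. *)
Lemma wallis_lb n : (2 * Num.sqrt n.+1%:R)^-1 <= wallis n.
Proof.
have W : forall n, 1 <= 4 * n.+1%:R * wallis n.+1 ^+ 2.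
  elim=> [|k IH]; first by rewrite wallisS /wallis big_ord0 mul1r double0 expr_div_n; lra.
  rewrite wallisS exprMn; apply: (le_trans IH).
  rewrite [leRHS]mulrCA [leLHS]mulrC; apply: ler_wpM2l; first exact: sqr_ge0.
  rewrite expr_div_n mulrA ler_pdivlMr ?exprn_gt0//.
  have -> : (k.+1.*2.+2)%:R = 2 * k%:R + 4 :> R by rewrite -natrM -natrD; congr (_%:R); lia.
  have -> : (k.+1.*2.+1)%:R = 2 * k%:R + 3 :> R by rewrite -natrM -natrD; congr (_%:R); lia.
  rewrite -[k.+2%:R]natr1 -[k.+1%:R]natr1.
  have : 0 <= k%:R :> R by exact: ler0n. nra.
have s0 : 0 < Num.sqrt (n.+1%:R : R) by rewrite sqrtr_gt0.
have ss : Num.sqrt (n.+1%:R : R) ^+ 2 = n.+1%:R by rewrite sqr_sqrtr.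
rewrite -[leRHS]ger0_norm ?(ltW (wallis_gt0 n))// -[leLHS]ger0_norm ?invr_ge0 ?mulr_ge0//.
rewrite -ler_sqr ?nnegrE// !real_normK ?num_real// exprVn exprMn ss.
case: n s0 ss => [|n] s0 ss; first by rewrite /wallis big_ord0; lra.
have := W n => h.
have p0 : 0 < 2 ^+ 2 * n.+2%:R :> R by rewrite mulr_gt0// exprn_gt0.
rewrite -[leLHS]mul1r ler_pdivrMr//; apply: (le_trans h).
rewrite mulrC; apply: ler_wpM2l; first exact: sqr_ge0.
by rewrite -[n.+2%:R]natr1; lra.
Qed.

(** The ratio is a product of [n] factors that are at least [1 - 1/(2n+2)],
    hence by Bernoulli it is at least [1 - n/(2n+2)]. *)
Lemma wallis_double n : wallis n <= 2 * wallis n.*2.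
Proof.
have E : wallis n.*2 = wallis n * \prod_(k < n) (((n + k).*2.+1)%:R / ((n + k).*2.+2)%:R).
  by rewrite /wallis -addnn big_split_ord.
rewrite E mulrCA ler_peMr ?(ltW (wallis_gt0 n))//.
have B : forall j, (j <= n)%N -> 1 - j%:R / (n.*2.+2)%:R <=
    \prod_(k < j) (((n + k).*2.+1)%:R / ((n + k).*2.+2)%:R) :> R.
  elim=> [|j IH] jn; first by rewrite big_ord0 mul0r subr0.
  rewrite big_ord_recr /=; apply: le_trans (ler_wpM2r _ (IH (ltnW jn))); last by rewrite divr_ge0.
  have h1 : 1 - (n.*2.+2)%:R^-1 <= ((n + j).*2.+1)%:R / ((n + j).*2.+2)%:R :> R.
    rewrite lerBlDr -[X in X <= _](@divff _ ((n + j).*2.+2)%:R) ?pnatr_eq0//.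
    rewrite -{1}[((n + j).*2.+2)%:R]natr1 mulrDl lerD2l mul1r lef_pV2 ?posrE//.
    by rewrite ler_nat !ltnS leq_double leq_addr.
  have h0 : 0 <= 1 - j%:R / (n.*2.+2)%:R :> R.
    rewrite subr_ge0 ler_pdivrMr// mul1r ler_nat (leq_trans (ltnW jn))// -addnn.
    by rewrite (leq_trans (leq_addr n n))// (leq_trans (leqnSn _)).
  apply: le_trans (ler_wpM2l h0 h1).
  rewrite -natr1 mulrDl mul1r; set a := j%:R / _; set b := _^-1.
  have a0 : 0 <= a by rewrite divr_ge0. have b0 : 0 <= b by rewrite invr_ge0.
  nra.
have := B n (leqnn n); set p := \prod_(_ < _) _ => h.
have : n%:R / (n.*2.+2)%:R <= 2^-1 :> R.
  rewrite ler_pdivrMr// -[n.*2.+2]/((n.+1).*2) -muln2 natrM mulrC mulfK// ler_nat//.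
by move: h; generalize (n%:R / (n.*2.+2)%:R : R); clearbody p => a; lra.
Qed.

Lemma cosX_le1 a s : `|cos (pi * s)| ^+ a <= 1 :> R.
Proof. by rewrite exprn_ile1// cos_max. Qed.

(** The additional factor [cos^(2n)] is at most 1, and the normalizations are
    compared in [wallis_double]. *)
Lemma ker1_double_le n s : ker1 n.*2 s <= 2 * ker1 n s.
Proof.
rewrite /ker1 ler_pdivrMr ?wallis_gt0//.
have -> : n.*2.*2 = (n.*2 + n.*2)%N by rewrite addnn.
rewrite exprD.
have c0 : 0 <= cos (pi * s) ^+ n.*2 :> R by rewrite -mul2n exprM exprn_ge0// sqr_ge0.
have c1 : cos (pi * s) ^+ n.*2 <= 1 :> R by rewrite -[leLHS]ger0_norm// normrX cosX_le1.
apply: (le_trans (y := cos (pi * s) ^+ n.*2)); first by rewrite ler_piMr.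
rewrite (_ : 2 * _ * _ = cos (pi * s) ^+ n.*2 * (2 * wallis n.*2 / wallis n)); last by ring.
by rewrite ler_peMr// ler_pdivlMr ?wallis_gt0// mul1r wallis_double.
Qed.

(** With [c] and [t] the cosine and the sine, [c^(2k) (1 + k t^2) <= 1] by
    induction; [k = 2n - 1] bounds the square of the left-hand side. *)
Lemma sin_cosX_le n s : n%:R * `|sin (pi * s)| * `|cos (pi * s)| ^+ (n.*2).-1 <= Num.sqrt n%:R :> R.
Proof.
case: n => [|n]; first by rewrite !mul0r sqrtr_ge0.
have := cos2sin2 (pi * s).
rewrite -[cos _ ^+ 2]real_normK ?num_real// -[sin _ ^+ 2]real_normK ?num_real//.
set c := `|cos _|; set t := `|sin _| => E.
have c0 : 0 <= c by exact: normr_ge0. have t0 : 0 <= t by exact: normr_ge0.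
have B k : c ^+ 2 ^+ k * (1 + k%:R * t ^+ 2) <= 1.
  elim: k => [|k IH]; first by rewrite mul0r addr0 mulr1.
  apply: le_trans IH; rewrite exprSr -mulrA ler_wpM2l ?exprn_ge0//.
  rewrite E -natr1; have := sqr_ge0 t; have : 0 <= k%:R :> R by [].
  set u := t ^+ 2 => k0 u0; have -> : (1 - u) * (1 + (k%:R + 1) * u) = (1 + k%:R * u) - (k%:R + 1) * u ^+ 2 by ring.
  by rewrite gerBl mulr_ge0 ?sqr_ge0// addr_ge0.
rewrite -(@ler_sqr R) ?nnegrE ?mulr_ge0 ?exprn_ge0 ?sqrtr_ge0//.
rewrite sqr_sqrtr// !exprMn -exprM mulnC exprM doubleS /=.
have := B n.*2.+1; set X := c ^+ 2 ^+ _ => h.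
have X0 : 0 <= X by rewrite !exprn_ge0.
rewrite -[n.*2.+1%:R]natr1 -muln2 natrM in h.
rewrite expr2 -!mulrA ler_piMr// mulrA.
move: h X0; rewrite -natr1; set u := t ^+ 2; have : 0 <= u by exact: sqr_ge0.
have : 0 <= n%:R :> R by exact: ler0n.
move=> n0 u0 h X0.
have -> : n.+1%:R * t * (t * X) = X * ((n%:R + 1) * u) by rewrite -natr1 /u; ring.
apply: le_trans h; apply: ler_wpM2l => //.
by have := mulr_ge0 n0 u0; lra.
Qed.

(** The derivative of [cos^(4n)] contains [n sin cos^(4n-1)]. Half of the
    cosines are kept as the kernel of index [n], and the other half absorb
    [n sin] up to [sqrt n]. This is why the regularization of index [2n] is
    estimated by means over the kernel of index [n]. *)
Lemma derive1_ker1_le n s : `|derive1 (ker1 n.*2) s| <= 8 * pi * Num.sqrt n.+1%:R * ker1 n s.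
Proof.
rewrite derive1_ker1 normrN normrM normfV (gtr0_norm (wallis_gt0 _)).
rewrite ler_pdivrMr ?wallis_gt0//.
rewrite !normrM normrX (ger0_norm (pi_ge0 R)) normr_nat.
case: n => [|n].
  rewrite !double0 mulr0 mul0r; have := ker1_ge0 0 s; have := wallis_gt0 0.
  by move=> /ltW w0 k0; rewrite mulr_ge0// mulr_ge0// mulr_ge0 ?sqrtr_ge0// mulr_ge0// pi_ge0.
have -> : (n.+1.*2.*2).-1 = (n.+1.*2 + n.+1.*2.-1)%N by rewrite !doubleS -[in LHS]addnn /= -!addnn /=; lia.
rewrite exprD; set c := `|cos _|; set t := `|sin _|.
have c0 : 0 <= c ^+ n.+1.*2 by rewrite exprn_ge0// /c normr_ge0.
have Ec : c ^+ n.+1.*2 = ker1 n.+1 s * wallis n.+1.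
  rewrite /ker1 divfK ?gt_eqF ?wallis_gt0// /c -!mul2n !exprM real_normK ?num_real//.
have h : n.+1%:R * t * c ^+ n.+1.*2.-1 <= Num.sqrt n.+2%:R.
  by apply: (le_trans (sin_cosX_le n.+1 s)); rewrite ler_sqrt// ler_nat.
rewrite -[(n.+1.*2.*2)%:R](_ : 4 * n.+1%:R = _); last by rewrite -natrM; congr (_%:R); lia.
have -> : pi * (4 * n.+1%:R) * (c ^+ n.+1.*2 * c ^+ n.+1.*2.-1 * t) =
  4 * pi * (c ^+ n.+1.*2 * (n.+1%:R * t * c ^+ n.+1.*2.-1)) :> R by ring.
rewrite Ec; have k0 := ker1_ge0 n.+1 s; have w0 := wallis_gt0 n.+1.
apply: (le_trans (y := 4 * pi * (ker1 n.+1 s * wallis n.+1 * Num.sqrt n.+2%:R))).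
  apply: ler_wpM2l; first by rewrite mulr_ge0 ?pi_ge0.
  by apply: ler_wpM2l => //; rewrite mulr_ge0// ltW.
have := wallis_double n.+1 => wd.
have -> : 8 * pi * Num.sqrt n.+2%:R * ker1 n.+1 s * wallis n.+1.*2 =
  4 * pi * (ker1 n.+1 s * (2 * wallis n.+1.*2) * Num.sqrt n.+2%:R) :> R by ring.
apply: ler_wpM2l; first by rewrite mulr_ge0 ?pi_ge0.
apply: ler_wpM2r; first by rewrite sqrtr_ge0.
by apply: ler_wpM2l.
Qed.

End Kernel1.

(** * The three-dimensional kernel *)

Section Kernel3.
Variable R : realType.
Local Notation mu := (torus_measure R).
Implicit Types (n m : nat) (s : R) (x y : space3 R) (j : 'I_3).

Definition idx n := {ffun 'I_3 -> 'I_(n.*2).+1}.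

Definition bas n (k : idx n) : space3 R -> R := tens (fun i => phi n (k i)).

Definition Ker n x y : R := \prod_(i < 3) ker1 n (xcoord x i - xcoord y i).

Definition dKer j n x y : R :=
  \prod_(i < 3) (if i == j then derive1 (ker1 n) else ker1 n) (xcoord x i - xcoord y i).

Lemma per1_bas n (k : idx n) : forall i, per1 (phi n (k i) : R -> R).
Proof. by move=> i; exact: per1_phi. Qed.

Lemma tensor_sum_bas n (k : idx n) : tensor_sum (bas k).
Proof. by apply: tensor_sum_tens; exact: per1_bas. Qed.

(** The kernel has finite rank: expand the product of the three sums of
    [ker1B]. *)
Lemma KerE n x y : Ker n x y = \sum_(k : idx n) bas k x * bas k y.
Proof.
rewrite /Ker; under eq_bigr do rewrite ker1B.
by rewrite bigA_distr_bigA; apply: eq_bigr => k _; rewrite -big_split.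
Qed.

Lemma Ker_ge0 n x y : 0 <= Ker n x y.
Proof. by apply: prodr_ge0 => i _; exact: ker1_ge0. Qed.

Lemma Ker_dl j n x y : \sum_(k : idx n) pd j (bas k) x * bas k y = dKer j n x y.
Proof.
rewrite /dKer.
under [RHS]eq_bigr => i _.
  rewrite (_ : _ (_ - _) = \sum_(l < (n.*2).+1)
     (if i == j then derive1 (phi n l) else phi n l) (xcoord x i) * phi n l (xcoord y i)).
    over.
  by case: ifP => _; rewrite ?ker1_dl ?ker1B.
rewrite bigA_distr_bigA; apply: eq_bigr => k _.
by rewrite /bas (pd_tens j (per1_bas k)) -big_split.
Qed.

Lemma Ker_dr j n x y : \sum_(k : idx n) bas k x * pd j (bas k) y = - dKer j n x y.
Proof.
rewrite /dKer (bigD1 j)//= eqxx -mulNr.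
transitivity (\prod_(i < 3) ((if i == j then (fun s => - derive1 (ker1 n) s) else ker1 n) (xcoord x i - xcoord y i))).
  under [RHS]eq_bigr => i _.
    rewrite (_ : _ (_ - _) = \sum_(l < (n.*2).+1)
       phi n l (xcoord x i) * (if i == j then derive1 (phi n l) else phi n l) (xcoord y i)).
      over.
    by case: ifP => _; rewrite ?ker1_dr ?ker1B.
  rewrite bigA_distr_bigA; apply: eq_bigr => k _.
  by rewrite /bas (pd_tens j (per1_bas k)) -big_split.
rewrite (bigD1 j)//= eqxx; congr (_ * _).
by apply: eq_bigr => i /negbTE ->.
Qed.

Lemma tensor_sum_Ker n x : tensor_sum (Ker n x).
Proof.
rewrite (_ : Ker n x = fun y => \sum_(k : idx n) bas k x * bas k y); last by apply/funext => y; rewrite KerE.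
by apply: tensor_sum_sum => k; apply: tensor_sum_scale; exact: tensor_sum_bas.
Qed.

Lemma tensor_sum_dKer j n x : tensor_sum (dKer j n x).
Proof.
rewrite (_ : dKer j n x = fun y => \sum_(k : idx n) pd j (bas k) x * bas k y); last by apply/funext => y; rewrite Ker_dl.
by apply: tensor_sum_sum => k; apply: tensor_sum_scale; exact: tensor_sum_bas.
Qed.

Lemma Int_Ker n x : \int[mu]_y Ker n x y = 1.
Proof.
have E : Ker n x = tens (fun i s => ker1 n (s - xcoord x i)).
  by apply/funext => y; apply: eq_bigr => i _; rewrite -ker1N opprB.
have pE : forall i, per1 (fun s => ker1 n (s - xcoord x i)).
  move=> i; have [sk pk] := @per1_ker1 R n; split.
    by have := smooth1_affine 1 (- xcoord x i) sk; under eq_fun do rewrite mul1r.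
  by move=> s; rewrite addrAC pk.
by rewrite E (Int_tens pE) big1// => i _; rewrite Int_ker1.
Qed.

Lemma Int_dKer j n x : \int[mu]_y dKer j n x y = 0.
Proof.
have E y : dKer j n x y = \sum_(k : idx n) (- bas k x) * pd j (bas k) y.
  by under eq_bigr do rewrite mulNr; rewrite sumrN Ker_dr opprK.
under eq_Rintegral do rewrite E.
have sk (k : idx n) : rintegrable mu (pd j (bas k)).
  by apply: tensor_sum_rintegrable; apply: tensor_sum_pd; exact: tensor_sum_bas.
rewrite (@Int_sum _ _ _ (mu : probability _ R)); last by move=> k; exact: rintegrableZ.
rewrite big1// => k _; rewrite (@IntZ _ _ _ (mu : probability _ R))//.
by rewrite Int_pd ?mulr0//; exact: tensor_sum_bas.
Qed.

Lemma Ker_double_le n x y : Ker n.*2 x y <= 8 * Ker n x y.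
Proof.
rewrite /Ker (_ : 8 * _ = \prod_(i < 3) (2 * ker1 n (xcoord x i - xcoord y i))); last first.
  by rewrite !big_ord_recl !big_ord0; ring.
by apply: ler_prod => i _; rewrite ker1_ge0 ker1_double_le.
Qed.

Lemma dKer_le j n x y : `|dKer j n.*2 x y| <= 32 * pi * Num.sqrt n.+1%:R * Ker n x y.
Proof.
rewrite /dKer normr_prod (bigD1 j)//= eqxx /Ker [in leRHS](bigD1 j)//=.
have -> : 32 * pi * Num.sqrt n.+1%:R * (ker1 n (xcoord x j - xcoord y j) *
    \prod_(i < 3 | i != j) ker1 n (xcoord x i - xcoord y i)) =
  (8 * pi * Num.sqrt n.+1%:R * ker1 n (xcoord x j - xcoord y j)) *
    \prod_(i < 3 | i != j) (2 * ker1 n (xcoord x i - xcoord y i)) :> R.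
  have -> : \prod_(i < 3 | i != j) (2 * ker1 n (xcoord x i - xcoord y i)) =
      4 * \prod_(i < 3 | i != j) ker1 n (xcoord x i - xcoord y i).
    rewrite !(big_mkcond (fun i => i != j)) !big_ord_recl !big_ord0 /=.
    by elim/I3_cases: j; rewrite -?val_eqE /= ?inordK//=; ring.
  ring.
apply: ler_pM => //; first exact: prodr_ge0.
  exact: derive1_ker1_le.
by apply: ler_prod => i /negbTE ->; rewrite normr_ge0 ger0_norm ?ker1_ge0 ?ker1_double_le.
Qed.

Lemma per1_shift (h : R -> R) c : per1 h -> per1 (fun s => h (s - c)).
Proof.
move=> [sh ph]; split; first by have := smooth1_affine 1 (- c) sh; under eq_fun do rewrite mul1r.
by move=> s; rewrite addrAC ph.
Qed.

(** A smooth periodic substitute for the squared distance, with which the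
    moments of the kernel can be computed; [torus_dist_le_rho] and
    [rho_le_torus_dist] compare it with the torus. *)
Definition rho2 x y : R := \sum_(i < 3) sin (pi * (xcoord x i - xcoord y i)) ^+ 2.
Definition rho x y : R := Num.sqrt (rho2 x y).

(** The scale at which the kernel of index [n] concentrates. *)
Definition width n : R := (Num.sqrt n.+1%:R)^-1.

Lemma width_gt0 n : 0 < width n.
Proof. by rewrite invr_gt0 sqrtr_gt0. Qed.

Lemma width_sqr n : n.+1%:R * width n ^+ 2 = 1.
Proof. by rewrite /width exprVn sqr_sqrtr// divff. Qed.

Lemma rho2_ge0 x y : 0 <= rho2 x y.
Proof. by apply: sumr_ge0 => i _; exact: sqr_ge0. Qed.

Lemma rho_ge0 x y : 0 <= rho x y. Proof. exact: sqrtr_ge0. Qed.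

Lemma powR_le1D (t s : R) : 0 <= t -> 0 <= s <= 2 -> t `^ s <= 1 + t ^+ 2.
Proof.
move=> t0 /andP[s0 s2]; have [t1|t1] := leP t 1.
  apply: (@le_trans _ _ (1 `^ s)); first by rewrite ge0_ler_powR ?nnegrE.
  by rewrite powR1 lerDl sqr_ge0.
apply: (@le_trans _ _ (t `^ 2)); first by rewrite ler_powR// ltW.
by rewrite powR_mulrn// lerDr.
Qed.

(** For [s <= 2] the power [s] of [rho / width] is at most one plus its
    square, and the mean of the square is computable. *)
Lemma rho_powR n x y s : 0 <= s <= 2 ->
  rho x y `^ s <= width n `^ s * (1 + n.+1%:R * rho2 x y).
Proof.
move=> hs; have d0 := width_gt0 n.
have -> : rho x y = width n * (rho x y / width n) by rewrite mulrCA divff ?mulr1// gt_eqF.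
have t0 : 0 <= rho x y / width n by rewrite divr_ge0 ?rho_ge0// ltW.
rewrite powRM ?(ltW d0)//; apply: ler_wpM2l; first exact: powR_ge0.
apply: (le_trans (powR_le1D t0 hs)); rewrite lerD2l.
by rewrite expr_div_n /rho sqr_sqrtr ?rho2_ge0// /width exprVn sqr_sqrtr// invrK mulrC.
Qed.

Lemma tensor_sum_rho2 x : tensor_sum (rho2 x).
Proof.
apply: tensor_sum_sum => j.
pose f (i : 'I_3) (s : R) := if i == j then cos (pi * (s - xcoord x j)) ^+ 0 * sin (pi * (s - xcoord x j)) ^+ 2 else 1.
have -> : (fun y => sin (pi * (xcoord x j - xcoord y j)) ^+ 2) = tens f.
  apply/funext => y; rewrite /tens (bigD1 j)//= /f eqxx expr0 mul1r big1 ?mulr1.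
    by rewrite -opprB mulrN sinN sqrrN.
  by move=> i /negbTE ->.
apply: tensor_sum_tens => i; rewrite /f; case: (i == j); last exact: per1_cst.
have [sh ph] := @per1_cosX_sinX R 0 2 isT.
split; first by have := smooth1_affine 1 (- xcoord x j) sh; under eq_fun do rewrite mul1r.
by move=> s; rewrite addrAC ph.
Qed.

Lemma measurable_rho x s : measurable_fun [set: mspace3 R] (fun y => rho x y `^ s).
Proof.
apply: (measurableT_comp (measurable_powR s)).
have -> : rho x = (fun y => rho2 x y `^ 2^-1) by apply/funext => y; rewrite powR12_sqrt ?rho2_ge0.
exact: (measurableT_comp (measurable_powR _) (tensor_sum_measurable (tensor_sum_rho2 x))).
Qed.

(** Writing [sin^2] as [1 - cos^2] turns the second moment into a difference
    of kernels of consecutive indices, that is a ratio of values of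
    [wallis]. *)
Lemma Int_Ker_rho2 n x : \int[mu]_y (Ker n x y * (1 + n.+1%:R * rho2 x y)) <= 5 / 2.
Proof.
have nK := tensor_sum_rintegrable (tensor_sum_Ker n x).
have nr := tensor_sum_mul (tensor_sum_Ker n x) (tensor_sum_rho2 x).
have -> : (fun y => Ker n x y * (1 + n.+1%:R * rho2 x y)) =
  (fun y => Ker n x y + n.+1%:R * (Ker n x y * rho2 x y)) by apply/funext => y; ring.
rewrite (@IntD _ _ _ (mu : probability _ R)) //; last by apply: rintegrableZ; exact: tensor_sum_rintegrable.
rewrite Int_Ker (@IntZ _ _ _ (mu : probability _ R)); last exact: tensor_sum_rintegrable.
suff -> : \int[mu]_y (Ker n x y * rho2 x y) = 3 * (1 - wallis R n.+1 / wallis R n).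
  rewrite wallisS [wallis R n * _]mulrC mulfK ?gt_eqF ?wallis_gt0//.
  have -> : 1 - (n.*2.+1)%:R / (n.*2.+2)%:R = (2 * n.+1%:R)^-1 :> R.
    rewrite -natrM (_ : (2 * n.+1)%N = n.*2.+2); last lia.
    by rewrite -{1}(@divff _ (n.*2.+2)%:R)// -mulrBl -{1}[n.*2.+2%:R]natr1 addrAC subrr add0r mul1r.
  rewrite invfM mulrCA mulrA -[n.+1%:R^-1]div1r.
  rewrite (_ : _ * (2^-1 * (1 / n.+1%:R)) = 3 / 2 * (n.+1%:R / n.+1%:R)); last by ring.
  by rewrite divff//; lra.
pose f (j i : 'I_3) s := if i == j then ker1 n.+1 (s - xcoord x i) * (wallis R n.+1 / wallis R n)
  else ker1 n (s - xcoord x i).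
have pf j i : per1 (f j i).
  rewrite /f; case: (i == j); last exact: (@per1_shift (ker1 n) _ (@per1_ker1 R n)).
  by apply: per1M; [exact: (@per1_shift (ker1 n.+1) _ (@per1_ker1 R n.+1)) | exact: per1_cst].
have E y : Ker n x y * rho2 x y = \sum_(j < 3) (Ker n x y - tens (f j) y).
  rewrite /rho2 mulr_sumr; apply: eq_bigr => j _.
  rewrite sin2cos2 mulrBr mulr1; congr (_ - _).
  rewrite /Ker (bigD1 j)//= /tens [in RHS](bigD1 j)//= /f eqxx mulrAC; congr (_ * _).
    rewrite -ker1N opprB /ker1 -(opprB (xcoord y j)) mulrN cosN doubleS -[n.*2.+2]addn2 exprD.
    by field; rewrite !gt_eqF// wallis_gt0.
  by apply: eq_bigr => i /negbTE ->; rewrite -ker1N opprB.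
under eq_Rintegral do rewrite E.
rewrite (@Int_sum _ _ _ (mu : probability _ R)); last first.
  by move=> j; apply: rintegrableB => //; exact: tens_rintegrable (pf j).
under eq_bigr => j _.
  rewrite (@IntB _ _ _ (mu : probability _ R))//; last exact: tens_rintegrable (pf j).
  rewrite Int_Ker (Int_tens (pf j)) (bigD1 j)//= {1}/f eqxx.
  rewrite (@IntZr _ _ _ (circle_measure R : probability _ R)); last exact: (per1_rintegrable (@per1_shift (ker1 n.+1) _ (@per1_ker1 R n.+1))).
  rewrite Int_ker1 mul1r big1 ?mulr1; last by move=> i /negbTE ij; rewrite /f ij Int_ker1.
  over.
by rewrite /= !big_ord_recl big_ord0; ring.
Qed.

(** The kernel has height [width^-3] and decays like a Gaussian, since
    [cos^(2n) <= e exp(-(n+1) sin^2)]; the exponential absorbs the power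
    [s + 3] of [rho / width]. *)
Lemma Ker_sup n x y s : 0 <= s <= 2 ->
  Ker n x y * (rho x y `^ s * rho x y ^+ 3) <= 80 * expR 3 * width n `^ s.
Proof.
move=> hs; have d0 := width_gt0 n.
set N := n.+1%:R : R.
have N0 : 0 < N by [].
have kle i : ker1 n (xcoord x i - xcoord y i) <=
    2 * (width n)^-1 * (expR 1 * expR (- (N * sin (pi * (xcoord x i - xcoord y i)) ^+ 2))).
  set a := pi * _; rewrite /ker1 -/a -mul2n exprM cos2sin2.
  have s0 := sqr_ge0 (sin a).
  have s1 : sin a ^+ 2 <= 1 by rewrite sin2cos2 gerBl sqr_ge0.
  rewrite mulrC; apply: ler_pM.
  - by rewrite invr_ge0 ltW// wallis_gt0.
  - by rewrite exprn_ge0// subr_ge0.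
  - by rewrite /width invrK -[leRHS]invrK lef_pV2 ?wallis_lb ?posrE ?wallis_gt0 ?invr_gt0 ?mulr_gt0 ?sqrtr_gt0.
  rewrite -expRD; apply: (@le_trans _ _ (expR (- sin a ^+ 2) ^+ n)).
    by apply: lerXn2r; rewrite ?nnegrE ?expR_ge0 ?subr_ge0// expR_ge1Dx.
  by rewrite -expRM_natl ler_expR /N -natr1; lra.
have Kle : Ker n x y <= 8 * (width n)^-1 ^+ 3 * expR 3 * expR (- (N * rho2 x y)).
  apply: (@le_trans _ _ (\prod_(i < 3) (2 * (width n)^-1 * (expR 1 * expR (- (N * sin (pi * (xcoord x i - xcoord y i)) ^+ 2)))))).
    by apply: ler_prod => i _; rewrite ker1_ge0 kle.
  rewrite /rho2 !big_ord_recl !big_ord0 /= addr0 mulr1 !mulrDr !opprD !expRD.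
  by rewrite le_eqVlt; apply/orP; left; apply/eqP; ring.
set t := rho x y / width n.
have t0 : 0 <= t by rewrite divr_ge0 ?rho_ge0// ltW.
have rt : rho x y = width n * t by rewrite mulrCA divff ?mulr1// gt_eqF.
have tz : N * rho2 x y = t ^+ 2.
  by rewrite expr_div_n /rho sqr_sqrtr ?rho2_ge0// /width exprVn sqr_sqrtr// invrK mulrC.
rewrite tz in Kle.
have poly : t `^ s * t ^+ 3 <= 10 * expR (t ^+ 2).
  have ts := powR_le1D t0 hs.
  have t3 : t ^+ 3 <= 1 + t ^+ 4.
    have t4 : 0 <= t ^+ 4 by exact: exprn_ge0.
    have t3 : 0 <= t ^+ 3 by exact: exprn_ge0.
    have [t1|t1] := leP t 1; first by have : t ^+ 3 <= 1 by [rewrite exprn_ile1]; lra.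
    by have : t ^+ 3 <= t ^+ 4 by [rewrite [leRHS]exprS ler_peMl// ltW]; lra.
  apply: (@le_trans _ _ ((1 + t ^+ 2) * (1 + t ^+ 4))).
    by apply: ler_pM => //; [exact: powR_ge0 | exact: exprn_ge0].
  have := @expR_ge1Dxn R (t ^+ 2) 0 (sqr_ge0 t).
  have := @expR_ge1Dxn R (t ^+ 2) 1 (sqr_ge0 t).
  have := @expR_ge1Dxn R (t ^+ 2) 2 (sqr_ge0 t).
  rewrite -!exprM /= (_ : 3`! = 6)%N// (_ : 2`! = 2)%N// (_ : 1`! = 1)%N//.
  have : 0 <= t ^+ 2 by exact: sqr_ge0.
  have -> : (1 + t ^+ 2) * (1 + t ^+ 4) = 1 + t ^+ 2 + t ^+ 4 + t ^+ 6 by ring.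
  rewrite !mulnE /=; generalize (expR (t ^+ 2)) => e.
  by generalize (t ^+ 2) (t ^+ 4) (t ^+ 6) => a b c; lra.
rewrite rt powRM ?(ltW d0)// exprMn.
apply: (@le_trans _ _ (8 * (width n)^-1 ^+ 3 * expR 3 * expR (- t ^+ 2) * (width n `^ s * t `^ s * (width n ^+ 3 * t ^+ 3)))).
  apply: ler_wpM2r; last exact: Kle.
  have p1 := powR_ge0 (width n) s; have p2 := powR_ge0 t s.
  have q1 : 0 <= width n ^+ 3 by exact/exprn_ge0/ltW. have q2 : 0 <= t ^+ 3 by exact: exprn_ge0.
  exact: mulr_ge0 (mulr_ge0 p1 p2) (mulr_ge0 q1 q2).
have -> : 8 * (width n)^-1 ^+ 3 * expR 3 * expR (- t ^+ 2) * (width n `^ s * t `^ s * (width n ^+ 3 * t ^+ 3)) =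
  8 * expR 3 * width n `^ s * (t `^ s * t ^+ 3 * expR (- t ^+ 2)).
  by field; rewrite gt_eqF.
have -> : 80 * expR 3 * width n `^ s = 8 * expR 3 * width n `^ s * 10 :> R by ring.
apply: ler_wpM2l; first by apply: mulr_ge0; [rewrite mulr_ge0// expR_ge0 | exact: powR_ge0].
by rewrite expRN ler_pdivrMr ?expR_gt0.
Qed.

End Kernel3.
Arguments tensor_sum_bas {R n} k.

(** * Mollification in time *)

Section RealInequalities.
Variable R : realType.

Lemma norm_sub_itv01 (u v : R) : 0 <= u <= 1 -> 0 <= v <= 1 -> `|u - v| <= 1.
Proof. by move=> /andP[? ?] /andP[? ?]; rewrite ler_norml; apply/andP; split; lra. Qed.

Lemma enlarge_interval_le (A L h e eta : R) : 0 <= A -> 0 <= L -> 0 <= h -> 0 < e ->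
  e <= eta -> eta <= 1 ->
  (A + L * (h + 2 * e)) * (h + 2 * e) <= (A + L * h) * h + eta * (2 * A + 4 * L * h + 4 * L).
Proof.
move=> A0 L0 h0 e0 ee e1.
have -> : (A + L * (h + 2 * e)) * (h + 2 * e) = (A + L * h) * h + e * (2 * A + 4 * (L * h) + 4 * (L * e)) by ring.
rewrite lerD2l -[4 * L * h]mulrA; have Lh : 0 <= L * h by exact: mulr_ge0.
have Le : L * e <= L * 1 by rewrite ler_wpM2l// (le_trans ee).
have Le0 : 0 <= L * e by rewrite mulr_ge0// ltW.
by apply: ler_pM; rewrite ?(ltW e0)//; lra.
Qed.

Lemma norm_sub_perturb (a1 a2 m1 m2 X eta b : R) : `|a1 - m1| <= eta -> `|a2 - m2| <= eta ->
  `|X| <= b -> m1 - m2 = - X -> `|a2 - a1| <= b + 2 * eta.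
Proof.
rewrite !ler_norml => /andP[p1 p2] /andP[p3 p4] /andP[p5 p6] E.
by apply/andP; split; lra.
Qed.

Lemma sum_dist_endpoints (x s t e : R) : s < t -> 0 < e -> s - e <= x -> x <= t + e ->
  `|x - s| + `|x - t| <= t - s + 2 * e.
Proof. by move=> st e0 h1 h2; case: (ger0P (x - s)) => ?; case: (ger0P (x - t)) => ?; lra. Qed.

End RealInequalities.

Section TimeMollification.
Variable R : realType.
Local Notation leb := (@lebesgue_measure R).
Implicit Types (f g a b chi : R -> R) (s t e : R).

Local Notation step' := (derive1 (@smooth_step R)).

Lemma step'_bounded : exists2 B : R, 0 < B & forall s, `|step' s| <= B.
Proof.
have [M [_ hM]] : bounded_set (step' @` (`[-1, 1]%classic : set R)).
  apply: compact_bounded; apply: continuous_compact; last exact: segment_compact.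
  by apply: continuous_subspaceT; apply: smooth1_continuous; apply: smooth1_derive1; exact: smooth1_step.
exists (`|M| + 1) => [|s]; first by rewrite ltr_wpDl.
have [s1|s1] := leP `|s| 1; last by rewrite derive1_step_out// normr0 addr_ge0.
apply: (hM (`|M| + 1)); first by rewrite (le_lt_trans (ler_norm M))// ltrDl.
by exists s => //=; rewrite in_itv /= -ler_norml.
Qed.

Definition step_at t e : R -> R := fun x => smooth_step (e^-1 * x + - (e^-1 * t)).

(** The derivative of [step_at], so that a difference of two mollifiers is the
    derivative of a compactly supported function. *)
Definition mollifier t e : R -> R := fun x => e^-1 * step' (e^-1 * x + - (e^-1 * t)).

Lemma smooth1_step_at t e : smooth1 (step_at t e).
Proof. by apply: smooth1_affine; exact: smooth1_step. Qed.

Lemma derive1_step_at t e : derive1 (step_at t e) = mollifier t e.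
Proof. by rewrite /step_at derive1_affine//; exact: smooth1_step. Qed.

Lemma smooth1_mollifier t e : smooth1 (mollifier t e).
Proof. by rewrite -derive1_step_at; apply: smooth1_derive1; exact: smooth1_step_at. Qed.

Lemma mollifier_out t e x : 0 < e -> ~ (t - e <= x <= t + e) -> mollifier t e x = 0.
Proof.
move=> e0 h; rewrite /mollifier derive1_step_out ?mulr0// ltNge; apply/negP => h1; apply: h.
move: h1; rewrite -mulrBr normrM gtr0_norm ?invr_gt0// ler_pdivrMl// mulr1.
by rewrite ler_norml => /andP[h1 h2]; apply/andP; split; lra.
Qed.

Lemma step_at_le t e x : 0 < e -> x <= t - e -> step_at t e x = 0.
Proof.
by move=> e0 xt; rewrite /step_at smooth_step_le// -mulrBr ler_pdivrMl// mulrN1; lra.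
Qed.

Lemma step_at_ge t e x : 0 < e -> t + e <= x -> step_at t e x = 1.
Proof.
by move=> e0 xt; rewrite /step_at smooth_step_ge// -mulrBr ler_pdivlMl// mulr1; lra.
Qed.

Lemma mollifier_integral t e : 0 < e -> \int[leb]_(x in `[t - e, t + e]) mollifier t e x = 1.
Proof.
move=> e0; rewrite /Rintegral (@continuous_FTC2 R _ (step_at t e) (t - e) (t + e)).
- by rewrite (@step_at_ge t e (t + e))// (@step_at_le t e (t - e))// -EFinB subr0.
- by rewrite ltrD2l; lra.
- by apply: continuous_subspaceT; apply: smooth1_continuous; exact: smooth1_mollifier.
- have cs := smooth1_continuous (smooth1_step_at t e).
  split=> [x _||]; first exact: (smooth1_derivable (smooth1_step_at t e)).
    by apply: cvg_at_right_filter; exact: cs.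
  by apply: cvg_at_left_filter; exact: cs.
- by move=> x _; rewrite derive1_step_at.
Qed.

Lemma measurable_smooth1 f : smooth1 f -> measurable_fun [set: measurableTypeR R] f.
Proof. by move=> sf; apply: measurable_realfun.continuous_measurable_fun; exact: smooth1_continuous. Qed.

Lemma lint_bounded_support f g (c d M : R) : locally_integrable [set: R] f ->
  measurable_fun [set: measurableTypeR R] g -> (forall x, `|g x| <= M) ->
  (forall x, ~ (c <= x <= d) -> g x = 0) ->
  leb.-integrable [set: measurableTypeR R] (EFin \o (fun x => g x * f x)).
Proof.
move=> [mf _ lf] mg gM g0.
have mK : measurable (`[c, d]%classic : set (measurableTypeR R)) by exact: measurable_itv.
have ik : leb.-integrable (`[c, d]%classic : set (measurableTypeR R)) (EFin \o f).
  apply/integrableP; split; first by apply/measurable_EFinP; exact: measurable_funTS.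
  by apply: lf => //; exact: segment_compact.
have ik1 := (@integrable_mkcond _ _ _ (@lebesgue_measure R) _ (EFin \o f) mK).1 ik.
have ik2 := integrableZl measurableT M ik1.
apply: le_integrable ik2 => //.
  by apply/measurable_EFinP; apply: measurable_funM.
move=> x _; rewrite patchE; case: ifPn => [|xK] /=.
  by move=> _; rewrite lee_fin !normrM ler_wpM2r// (le_trans (gM x)) ?ler_norm.
rewrite mulr0 normr0 g0 ?mul0r ?normr0//.
by move=> h; move: xK; rewrite notin_setE /= in_itv /= h.
Qed.

Definition mollifier_limit f t := (fun e => \int[leb]_x (mollifier t e x * f x)) @ 0^'+ --> f t.

Lemma mollifier_bounded t e : exists M, forall x, `|mollifier t e x| <= M.
Proof.
have [B _ hB] := step'_bounded; exists (`|e^-1| * B) => x.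
by rewrite normrM ler_wpM2l.
Qed.

Lemma lint_mollifier f t e : 0 < e -> locally_integrable [set: R] f ->
  leb.-integrable [set: measurableTypeR R] (EFin \o (fun x => mollifier t e x * f x)).
Proof.
move=> e0 lf; have [M hM] := mollifier_bounded t e.
apply: (lint_bounded_support lf (measurable_smooth1 (smooth1_mollifier t e)) hM) => x.
exact: mollifier_out.
Qed.

(** The mollifier is bounded by [B / e] on an interval of length [2 e], so the
    error is at most a multiple of the mean of [|f - f t|] over that
    interval. *)
Lemma lebesgue_pt_mollifier_limit f t : locally_integrable [set: R] f ->
  lebesgue_pt f t -> mollifier_limit f t.
Proof.
move=> lf lt; have [B B0 hB] := step'_bounded.
apply/cvgrPdist_le => eta eta0.
pose K e : set (measurableTypeR R) := `[t - e, t + e]%classic.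
have mK e : measurable (K e) by exact: measurable_itv.
have main e : 0 < e -> (davg f t (2 * e) < (eta / (4 * B))%:E)%E ->
    `|f t - \int[leb]_x (mollifier t e x * f x)| <= eta.
  move=> e0 dav.
  have [mf _ lfK] := lf.
  have iK : leb.-integrable (K e) (EFin \o f).
    apply/integrableP; split; first by apply/measurable_EFinP; exact: measurable_funTS.
    by apply: lfK => //; exact: segment_compact.
  have icst (c : R) : leb.-integrable (K e) (EFin \o (fun=> c)).
    apply/integrableP; split; first by apply/measurable_EFinP.
    rewrite integral_cst// ltey_eq fin_numM// fin_num_abs gee0_abs ?measure_ge0//.
    by apply: compact_finite_measure; exact: segment_compact.
  have iKm : leb.-integrable (K e) (EFin \o (fun x => mollifier t e x * f x)).
    by apply: (@integrableS _ _ _ (@lebesgue_measure R) [set: measurableTypeR R]) => //; exact: lint_mollifier.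
  have lc : locally_integrable [set: R] (fun=> f t : R).
    split => //; first exact: openT.
    move=> C _ cC; rewrite integral_cst; last exact: compact_measurable.
    rewrite ltey_eq fin_numM// fin_num_abs gee0_abs ?measure_ge0//.
    exact: compact_finite_measure.
  have iKc : leb.-integrable (K e) (EFin \o (fun x => mollifier t e x * f t)).
    by apply: (@integrableS _ _ _ (@lebesgue_measure R) [set: measurableTypeR R]) => //; exact: lint_mollifier.
  have iKm1 : leb.-integrable (K e) (EFin \o mollifier t e).
    have lc1 : locally_integrable [set: R] (fun=> 1 : R).
      split => //; first exact: openT.
      move=> C _ cC; rewrite integral_cst; last exact: compact_measurable.
      rewrite ltey_eq fin_numM// fin_num_abs gee0_abs ?measure_ge0//.
      exact: compact_finite_measure.
    have : leb.-integrable (K e) (EFin \o (fun x => mollifier t e x * 1)).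
      by apply: (@integrableS _ _ _ (@lebesgue_measure R) [set: measurableTypeR R]) => //; exact: lint_mollifier.
    by under eq_fun do rewrite mulr1.
  have -> : \int[leb]_x (mollifier t e x * f x) = \int[leb]_(x in K e) (mollifier t e x * f x).
    rewrite [RHS]Rintegral_mkcond; apply: eq_Rintegral => x _.
    rewrite patchE; case: ifPn => // xK; rewrite mollifier_out ?mul0r// => h.
    by move: xK; rewrite notin_setE /K /= in_itv /= h.
  have -> : f t = \int[leb]_(x in K e) (mollifier t e x * f t).
    by rewrite RintegralZr// mollifier_integral// mul1r.
  rewrite -RintegralB//.
  have iD : leb.-integrable (K e) (EFin \o (fun x => f x - f t)).
    by have := integrableB (mK e) iK (icst (f t)).
  apply: (le_trans (le_normr_Rintegral _ _)) => //.
    by have := integrableB (mK e) iKc iKm.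
  apply: (@le_trans _ _ (\int[leb]_(x in K e) ((B / e) * `|f x - f t|))).
    apply: le_Rintegral => //.
    - by apply: integrable_norm => //; have := integrableB (mK e) iKc iKm.
    - by have := integrableZl (mK e) (B / e) (integrable_norm iD).
    - move=> x _; rewrite -mulrBr normrM distrC; apply: ler_wpM2r => //.
      rewrite /mollifier normrM gtr0_norm ?invr_gt0// mulrC ler_wpM2r// invr_ge0 ltW//.
  rewrite RintegralZl//; last exact: (integrable_norm iD).
  have JE : ((\int[leb]_(x in K e) `|f x - f t|)%:E <= \int[leb]_(y in ball t (2 * e)) `|(f y - f t)%:E|)%E.
    rewrite /Rintegral fineK; last exact: (integrable_fin_num (mK e) (integrable_norm iD)).
    apply: ge0_subset_integral => //.
    - exact: measurable_ball.
    - by apply/measurable_EFinP; apply: measurableT_comp => //; apply: measurable_funB => //; exact: measurable_funTS.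
    - move=> x; rewrite /K /= in_itv /= ball_itv /= in_itv /= => /andP[h1 h2].
      by apply/andP; split; lra.
  move: dav; rewrite /davg /iavg lebesgue_measure_ball; last by rewrite mulr_ge0// ltW.
  have e4 : (2 * e) *+ 2 = 4 * e by rewrite -mulr_natr; ring.
  rewrite e4 inver ifF; last by rewrite gt_eqF// mulr_gt0.
  move=> dav.
  have h : (((4 * e)^-1)%:E * (\int[leb]_(x in K e) `|f x - f t|)%:E < (eta / (4 * B))%:E)%E.
    by apply: le_lt_trans dav; apply: lee_wpmul2l JE; rewrite lee_fin invr_ge0 mulr_ge0// ltW.
  move: h; rewrite -EFinM lte_fin; set J := \int[leb]_(x in K e) _ => h.
  move: h; rewrite ltr_pdivlMr ?mulr_gt0// => h; apply/ltW.
  suff -> : B / e * J = (4 * e)^-1 * J * (4 * B) by [].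
  by field; rewrite gt_eqF.
have /fine_cvgP[fdav /cvgrPdist_lt cdav] := lt.
have h4 : 0 < eta / (4 * B) by rewrite divr_gt0// mulr_gt0.
have [d /= d0 hd] : \forall r \near 0^'+, (davg f t r < (eta / (4 * B))%:E)%E.
  near=> r.
  have fr : davg f t r \is a fin_num by near: r.
  rewrite -(fineK fr) lte_fin; apply: (le_lt_trans (ler_norm _)).
  rewrite -normrN -[- _]add0r; near: r; exact: cdav.
exists (d / 2) => /=; first by rewrite divr_gt0.
move=> e /=; rewrite sub0r normrN => ed e0; apply: main => //; apply: hd; last by rewrite mulr_gt0.
rewrite /= sub0r normrN normrM (ger0_norm (x := 2))//.
by rewrite -ltr_pdivlMl// mulrC.
Unshelve. all: by end_near. Qed.

Lemma mollifier_limit_sum (I : Type) (r : seq I) (F : I -> R -> R) t :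
  (forall i, mollifier_limit (F i) t) ->
  forall c : I -> R,
  (fun e => \sum_(i <- r) c i * \int[leb]_x (mollifier t e x * F i x)) @ 0^'+ --> \sum_(i <- r) c i * F i t.
Proof.
move=> mF c; elim: r => [|i r IH].
  by rewrite big_nil; under eq_fun do rewrite big_nil; exact: cvg_cst.
rewrite big_cons; under eq_fun do rewrite big_cons.
by apply: cvgD => //; exact: (cvgM (cvg_cst (c i)) (mF i)).
Qed.

Definition time_test chi := smooth1 chi /\ exists c d, 0 < c /\ forall x, chi x != 0 -> c <= x <= d.

Lemma time_test_bounded chi : time_test chi -> exists M, forall t, `|chi t| <= M.
Proof.
move=> [sc [a [b [a0 hab]]]].
have [M [_ hM]] : bounded_set (chi @` (`[a, b]%classic : set R)).
  apply: compact_bounded; apply: continuous_compact; last exact: segment_compact.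
  by apply: continuous_subspaceT; exact: smooth1_continuous.
exists (`|M| + 1) => t.
have [->|/hab tab] := eqVneq (chi t) 0; first by rewrite normr0 addr_ge0.
apply: (hM (`|M| + 1)); first by rewrite (le_lt_trans (ler_norm M))// ltrDl.
by exists t => //=; rewrite in_itv.
Qed.

Lemma time_test_mollifier t e : 0 < e -> e < t -> time_test (mollifier t e).
Proof.
move=> e0 et; split; first exact: smooth1_mollifier.
exists (t - e), (t + e); split; first by rewrite subr_gt0.
by move=> x; apply: contraNT => /negP h; rewrite mollifier_out.
Qed.

Lemma weak_zero f t : 0 < t -> mollifier_limit f t ->
  (forall chi, time_test chi -> \int[leb]_x (chi x * f x) = 0) -> f t = 0.
Proof.
move=> t0 mf f0; apply/eqP; rewrite -normr_le0; apply/ler_addgt0Pr => eta eta0.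
have [d /= d0 hd] := (@cvgrPdist_le _ _ _ _ _ _ _).1 mf _ eta0.
have [m0 [md mt]] : 0 < Num.min (d / 2) (t / 2) /\ (Num.min (d / 2) (t / 2) < d /\ Num.min (d / 2) (t / 2) < t).
  rewrite lt_min !divr_gt0//=; split=> //; split; rewrite gt_min; apply/orP; [left|right];
  by rewrite ltr_pdivrMr// ltr_pMr// ltr1n.
have := hd (Num.min (d / 2) (t / 2)); rewrite /= sub0r normrN gtr0_norm// => /(_ md m0).
by rewrite f0 ?subr0 ?add0r//; exact: time_test_mollifier.
Qed.

(** The test function is the difference of two smooth steps, whose derivative
    is the difference of the mollifiers at [s] and [t], and the width of the
    steps tends to 0. The bound on the flux is allowed to grow with the
    distance to [s] and [t] because it will be applied with weights [c] that
    are values at these two times. *)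
Lemma weak_mean_value (I : Type) (r : seq I) (F G : I -> R -> R) (c : I -> R) (A L s t : R) :
  0 <= A -> 0 <= L -> 0 < s -> s < t ->
  (forall i, locally_integrable [set: R] (F i)) ->
  (forall i, locally_integrable [set: R] (G i)) ->
  (forall i, mollifier_limit (F i) s) -> (forall i, mollifier_limit (F i) t) ->
  (forall i chi, time_test chi ->
     \int[leb]_x (derive1 chi x * F i x) = - \int[leb]_x (chi x * G i x)) ->
  {ae leb, forall x, 0 < x ->
    `|\sum_(i <- r) c i * G i x| <= A + L * (`|x - s| + `|x - t|)} ->
  `|\sum_(i <- r) c i * F i t - \sum_(i <- r) c i * F i s| <= (A + L * (t - s)) * (t - s).
Proof.
move=> A0 L0 s0 st lF lG ms mt wk hb.
have Fs := @mollifier_limit_sum I r F s ms c; have Ft := @mollifier_limit_sum I r F t mt c.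
apply/ler_addgt0Pr => eta0 eta00.
(* Widening the interval and replacing limits by values costs at most
   [eta * Q]. *)
pose Q := 2 + 2 * A + 4 * L * (t - s) + 4 * L.
have Q0 : 0 < Q by have := mulr_ge0 L0 (ltW (_ : 0 < t - s)); rewrite subr_gt0 => /(_ st); rewrite /Q; lra.
have [eta [eta_gt0 eta1 etaQ]] : exists eta, [/\ 0 < eta, eta <= 1 & eta * Q <= eta0].
  exists (Num.min 1 (eta0 / Q)); split; first by rewrite lt_min ltr01 divr_gt0.
    by rewrite ge_min lexx.
  by rewrite -ler_pdivlMr// ge_min lexx orbT.
have [d1 /= d10 hd1] := (@cvgrPdist_le _ _ _ _ _ _ _).1 Fs _ eta_gt0.
have [d2 /= d20 hd2] := (@cvgrPdist_le _ _ _ _ _ _ _).1 Ft _ eta_gt0.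
have [e [e0 ed1 ed2 es ee]] : exists e, [/\ 0 < e, e < d1, e < d2, e < s & e <= eta].
  exists (Num.min (Num.min (d1 / 2) (d2 / 2)) (Num.min (s / 2) eta)); split.
  - by rewrite !lt_min !divr_gt0//=.
  - by rewrite !gt_min ltr_pdivrMr// ltr_pMr// ltr1n.
  - by rewrite !gt_min [d2 / 2 < _]ltr_pdivrMr// ltr_pMr// ltr1n// orbT.
  - by rewrite !gt_min [s / 2 < _]ltr_pdivrMr// ltr_pMr// ltr1n// !orbT.
  - by rewrite !ge_min lexx !orbT.
have := hd1 e; rewrite /= sub0r normrN gtr0_norm// => /(_ ed1 e0) {}hd1.
have := hd2 e; rewrite /= sub0r normrN gtr0_norm// => /(_ ed2 e0) {}hd2.
pose chi x := step_at s e x + (-1) * step_at t e x.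
have chi0 x : chi x != 0 -> s - e <= x <= t + e.
  apply: contraNT; rewrite negb_and -!ltNge => /orP[xs|xt]; rewrite /chi.
    have xt : x <= t - e by rewrite (le_trans (ltW xs))// lerD2r ltW.
    by rewrite (step_at_le e0 (ltW xs)) (step_at_le e0 xt) mulr0 addr0.
  have xs : s + e <= x by rewrite (le_trans _ (ltW xt))// lerD2r ltW.
  by rewrite (step_at_ge e0 (ltW xt)) (step_at_ge e0 xs) mulN1r subrr.
have tchi : time_test chi.
  split; last by exists (s - e), (t + e); split=> //; rewrite subr_gt0.
  by apply: smooth1D; [|apply: smooth1Z]; exact: smooth1_step_at.
have dchi : derive1 chi = (fun x => mollifier s e x - mollifier t e x).
  have h1 x := smooth1_is_derive (smooth1_step_at s e) x.
  have h2 x := smooth1_is_derive (smooth1Z (-1) (smooth1_step_at t e)) x.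
  have [_ ->] := is_derive1_derive1 (fun x => is_deriveD (h1 x) (h2 x)).
  apply/funext => x; rewrite derive1_step_at; congr (_ + _).
  rewrite derive1M; [|exact: smooth1_cst|exact: smooth1_step_at].
  by rewrite derive1_cst_fun mul0r add0r derive1_step_at mulN1r.
have chi_le1 x : `|chi x| <= 1.
  by rewrite /chi mulN1r; apply: norm_sub_itv01; exact: smooth_step_itv.
have iG i : leb.-integrable [set: measurableTypeR R] (EFin \o (fun x => chi x * G i x)).
  apply: (lint_bounded_support (c := s - e) (d := t + e) (M := 1) (lG i)) => //.
    by apply: measurable_smooth1; case: tchi.
  by move=> x /negP h; apply/eqP; apply: contraNT h => /chi0.
have iS r' : leb.-integrable [set: measurableTypeR R] (EFin \o (fun x => chi x * \sum_(i <- r') c i * G i x)).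
  elim: r' => [|i r' IH].
    under [EFin \o _]eq_fun do rewrite /= big_nil mulr0; exact: integrable0.
  have h := integrableD measurableT (integrableZl measurableT (c i) (iG i)) IH.
  apply: eq_integrable h => // x _ /=; rewrite big_cons -EFinM -EFinD; congr (_%:E); ring.
have E : \sum_(i <- r) c i * \int[leb]_x (mollifier s e x * F i x) -
         \sum_(i <- r) c i * \int[leb]_x (mollifier t e x * F i x) =
    - \int[leb]_x (chi x * \sum_(i <- r) c i * G i x).
  have -> : \int[leb]_x (chi x * \sum_(i <- r) c i * G i x) =
      \sum_(i <- r) c i * \int[leb]_x (chi x * G i x).
    elim: (r) => [|i r' IH].
      rewrite big_nil; under eq_Rintegral do rewrite big_nil mulr0.
      by rewrite Rintegral_cst// mul0r.
    rewrite big_cons -IH -RintegralZl// -RintegralD//.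
    - by apply: eq_Rintegral => x _; rewrite big_cons; ring.
    - by have := integrableZl measurableT (c i) (iG i).
  rewrite -sumrB -sumrN; apply: eq_bigr => i _.
  rewrite -[RHS]mulrN -mulrBr -(wk i chi tchi); congr (_ * _).
  rewrite -RintegralB//; try exact: lint_mollifier.
  by apply: eq_Rintegral => x _; rewrite dchi; ring.
set S := fun x => \sum_(i <- r) c i * G i x.
have bound : `|\int[leb]_x (chi x * S x)| <= (A + L * (t - s + 2 * e)) * (t - s + 2 * e).
  set M := A + _.
  have M0 : 0 <= M by rewrite addr_ge0// mulr_ge0// addr_ge0 ?subr_ge0 ?(ltW st)// mulr_ge0// ltW.
  pose K : set (measurableTypeR R) := `[s - e, t + e]%classic.
  have mK : measurable K by exact: measurable_itv.
  apply: (le_trans (le_normr_Rintegral _ (iS r))) => //.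
  rewrite -lee_fin /Rintegral fineK; last exact: (integrable_fin_num measurableT (integrable_norm (iS r))).
  have -> : (M * (t - s + 2 * e))%:E = (\int[leb]_x ((cst M%:E) \_ K) x)%E.
    have EK : leb K = (t - s + 2 * e)%:E.
      rewrite /K lebesgue_measure_itv /= lte_fin ifT; last first.
        by rewrite (lt_trans (_ : _ < s))// ?ltrBlDr ?ltrDl// (lt_trans st)// ltrDl.
      by rewrite -EFinB; congr (_%:E); ring.
    by rewrite -integral_mkcond integral_cst// EFinM -EK.
  have mS : measurable_fun [set: measurableTypeR R] (fun x => `|chi x * S x|%:E).
    by have /integrableP[] := integrable_norm (iS r).
  apply: ae_ge0_le_integral => //.
  - by move=> x _; rewrite patchE; case: ifP.
  - by apply/(measurable_restrictT _ mK).
  - apply: (@filterS _ _ (ae_filter_ringOfSetsType leb) _ _ _ hb) => x hx _; rewrite patchE.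
    rewrite -/(S x); case: ifPn => [|xK].
      rewrite inE /K /= in_itv /= => /andP[x1 x2].
      rewrite lee_fin normrM; apply: (@le_trans _ _ (1 * `|S x|)); first exact: ler_wpM2r.
      rewrite mul1r; apply: (le_trans (hx _)); first by rewrite (lt_le_trans _ x1)// subr_gt0.
      by rewrite lerD2l ler_wpM2l// sum_dist_endpoints.
    rewrite (_ : chi x = 0) ?mul0r ?normr0//.
    apply/eqP; apply: contraNT xK => /chi0 h; rewrite inE /K /= in_itv /=; exact: h.
have h0 : 0 <= t - s by rewrite subr_ge0 ltW.
apply: (le_trans (norm_sub_perturb hd1 hd2 bound E)).
apply: (@le_trans _ _ ((A + L * (t - s)) * (t - s) + eta * (2 * A + 4 * L * (t - s) + 4 * L) + 2 * eta)).
  by rewrite lerD2r; exact: enlarge_interval_le.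
rewrite -addrA lerD2l; apply: le_trans etaQ.
by rewrite le_eqVlt /Q; apply/orP; left; apply/eqP; ring.
Qed.

End TimeMollification.

(** * Weighted bounds for means of increments *)

Section WeightedMoments.
Context d (T : measurableType d) (R : realType) (mu : probability T R).
Implicit Types (f g P Q L r : T -> R) (s t c A B : R).

Lemma Int_ae_eq f g : rintegrable mu f -> rintegrable mu g -> {ae mu, forall x, f x = g x} ->
  \int[mu]_x f x = \int[mu]_x g x.
Proof.
move=> iF ig fg; rewrite /Rintegral; congr fine; apply: ae_eq_integral => //.
- by have /integrableP[] := iF.
- by have /integrableP[] := ig.
- by apply: (@filterS _ _ (ae_filter_ringOfSetsType mu) _ _ _ fg) => x /= -> .
Qed.

(** The minimum of [f] and [g] is below [g] everywhere and equal to [f] almost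
    everywhere. *)
Lemma Int_le_ae f g : rintegrable mu f -> rintegrable mu g -> {ae mu, forall x, f x <= g x} ->
  \int[mu]_x f x <= \int[mu]_x g x.
Proof.
move=> iF ig fg.
have mm : measurable_fun [set: T] (fun x => Num.min (f x) (g x)).
  exact: (@measurable_minr _ _ _ _ f g (rintegrable_measurable iF) (rintegrable_measurable ig)).
have im : rintegrable mu (fun x => Num.min (f x) (g x)).
  apply: (@rintegrable_le _ _ _ mu _ (fun x => `|f x| + `|g x|)) => //.
    move=> x; rewrite /Num.min; case: ifP => _; first by rewrite lerDl.
    by rewrite lerDr.
  by apply: rintegrableD; exact: integrable_norm.
rewrite (Int_ae_eq iF im); first by apply: Int_le => // x; rewrite ge_min lexx orbT.
by apply: (@filterS _ _ (ae_filter_ringOfSetsType mu) _ _ _ fg) => x /= /min_idPl.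
Qed.

(** In the application [L] is the kernel, [r] the distance and [g] a Gagliardo
    density. The weight of [g] is bounded by the supremum of [L r^(s+3)],
    which leaves the integral of [g] alone; only the constant [c] needs the
    mean of [L r^s]. *)
Lemma weighted_increment_le L r s c A P g : 0 <= c -> (forall y, 0 <= L y) ->
  rintegrable mu (fun y => L y * r y `^ s) ->
  \int[mu]_y (L y * r y `^ s) <= A ->
  (forall y, L y * (r y `^ s * r y ^+ 3) <= A) ->
  rintegrable mu (fun y => L y * P y) ->
  rintegrable mu g -> (forall y, 0 <= g y) ->
  {ae mu, forall y, P y <= r y `^ s * (c + r y ^+ 3 * g y)} ->
  \int[mu]_y (L y * P y) <= A * (c + \int[mu]_y g y).
Proof.
move=> c0 L0 iL hA sA iP ig g0 hP.
have i2 : rintegrable mu (fun y => c * (L y * r y `^ s) + A * g y).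
  by apply: rintegrableD; exact: rintegrableZ.
apply: (@le_trans _ _ (\int[mu]_y (c * (L y * r y `^ s) + A * g y))).
  apply: Int_le_ae => //.
  apply: (@filterS _ _ (ae_filter_ringOfSetsType mu) _ _ _ hP) => y hy.
  apply: (le_trans (ler_wpM2l (L0 y) hy)).
  have -> : L y * (r y `^ s * (c + r y ^+ 3 * g y)) =
    c * (L y * r y `^ s) + L y * (r y `^ s * r y ^+ 3) * g y by ring.
  by rewrite lerD2l ler_wpM2r.
rewrite IntD; [|exact: rintegrableZ|exact: rintegrableZ].
by rewrite !IntZ// mulrDr lerD2r mulrC ler_wpM2r.
Qed.

(** The one-variable bound is applied in [y] for fixed [z], then in [z]. As
    [g1] and [g2] occur in a sum, each integration removes one of them, and no
    product of integrals of densities arises. *)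
Lemma weighted_increment_mul_le L r s t c A B P Q g1 g2 : 0 <= c -> 0 <= A -> (forall y, 0 <= L y) ->
  (forall y, 0 <= r y) ->
  rintegrable mu (fun y => L y * r y `^ s) -> rintegrable mu (fun y => L y * r y `^ t) ->
  \int[mu]_y (L y * r y `^ s) <= A -> \int[mu]_y (L y * r y `^ t) <= B ->
  (forall y, L y * (r y `^ s * r y ^+ 3) <= A) ->
  (forall y, L y * (r y `^ t * r y ^+ 3) <= B) ->
  rintegrable mu (fun y => L y * P y) -> rintegrable mu (fun y => L y * Q y) ->
  rintegrable mu g1 -> rintegrable mu g2 -> (forall y, 0 <= g1 y) -> (forall y, 0 <= g2 y) ->
  {ae mu, forall z, {ae mu, forall y,
     P y * Q z <= r y `^ s * r z `^ t * (c + r y ^+ 3 * g1 y + r z ^+ 3 * g2 z)}} ->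
  (\int[mu]_y (L y * P y)) * (\int[mu]_z (L z * Q z)) <=
    A * B * (c + \int[mu]_y g1 y + \int[mu]_z g2 z).
Proof.
move=> c0 A0 L0 r0 is_ it hA hB sA sB iP iQ ig1 ig2 g10 g20 h.
set I := \int[mu]_y (L y * P y); set G1 := \int[mu]_y g1 y.
have G10 : 0 <= G1 by apply: Rintegral_ge0.
have step z : {ae mu, forall y,
     P y * Q z <= r y `^ s * r z `^ t * (c + r y ^+ 3 * g1 y + r z ^+ 3 * g2 z)} ->
   I * Q z <= r z `^ t * (A * (c + G1) + r z ^+ 3 * (A * g2 z)).
  move=> hz.
  have -> : I * Q z = \int[mu]_y (L y * (P y * Q z)).
    by rewrite -IntZr//; apply: eq_Rintegral => y _; rewrite mulrA.
  apply: (@le_trans _ _ (A * (r z `^ t * (c + r z ^+ 3 * g2 z) + \int[mu]_y (r z `^ t * g1 y)))).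
    apply: (@weighted_increment_le L r s (r z `^ t * (c + r z ^+ 3 * g2 z)) A (fun y => P y * Q z) (fun y => r z `^ t * g1 y)) => //.
    - by rewrite mulr_ge0 ?powR_ge0// addr_ge0// mulr_ge0// exprn_ge0.
    - under [X in rintegrable _ X]eq_fun do rewrite mulrA mulrC; exact: rintegrableZ.
    - exact: rintegrableZ.
    - by move=> y; rewrite mulr_ge0// powR_ge0.
    - apply: (@filterS _ _ (ae_filter_ringOfSetsType mu) _ _ _ hz) => y hy.
      by apply: (le_trans hy); rewrite le_eqVlt; apply/orP; left; apply/eqP; ring.
  by rewrite IntZ// le_eqVlt; apply/orP; left; apply/eqP; rewrite /G1; ring.
have -> : I * \int[mu]_z (L z * Q z) = \int[mu]_z (L z * (I * Q z)).
  by rewrite -IntZ//; apply: eq_Rintegral => y _; rewrite mulrCA.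
apply: (@le_trans _ _ (B * (A * (c + G1) + \int[mu]_y (A * g2 y)))).
  apply: (@weighted_increment_le L r t (A * (c + G1)) B (fun z => I * Q z) (fun z => A * g2 z)) => //.
  - by rewrite mulr_ge0// addr_ge0.
  - under [X in rintegrable _ X]eq_fun do rewrite mulrCA; exact: rintegrableZ.
  - exact: rintegrableZ.
  - by move=> y; rewrite mulr_ge0.
  - by apply: (@filterS _ _ (ae_filter_ringOfSetsType mu) _ _ _ h) => z; exact: step.
by rewrite IntZ// le_eqVlt; apply/orP; left; apply/eqP; ring.
Qed.

End WeightedMoments.

(** * Regularization in space *)

Section Regularization.
Variable R : realType.
Local Notation mu := (torus_measure R).
Local Notation prb := (mu : probability (mspace3 R) R).
Implicit Types (f g : space3 R -> R) (x y : space3 R) (i j : 'I_3) (n : nat).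

Definition coef n f (k : idx n) : R := \int[mu]_y (f y * bas k y).

Definition reg n f x : R := \sum_(k : idx n) coef f k * bas k x.

Lemma tensor_sum_reg n f : tensor_sum (reg n f).
Proof. by apply: tensor_sum_sum => k; apply: tensor_sum_scale; exact: tensor_sum_bas. Qed.

Lemma coefB n f g (k : idx n) : rintegrable mu f -> rintegrable mu g ->
  coef (fun y => f y - g y) k = coef f k - coef g k.
Proof.
move=> sf sg; rewrite /coef -(@IntB _ _ _ prb).
- by apply: eq_Rintegral => y _; rewrite mulrBl.
- exact: rintegrable_tensor_sum (tensor_sum_bas k).
- exact: rintegrable_tensor_sum (tensor_sum_bas k).
Qed.

Lemma sum_Int_bas n f (c : idx n -> R) (F : idx n -> space3 R -> R) :
  rintegrable mu f -> (forall k, tensor_sum (F k)) ->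
  \sum_(k : idx n) c k * \int[mu]_y (f y * F k y) =
  \int[mu]_y (f y * \sum_(k : idx n) c k * F k y).
Proof.
move=> sf nF.
transitivity (\sum_(k : idx n) \int[mu]_y (c k * (f y * F k y))).
  apply: eq_bigr => k _; rewrite (@IntZ _ _ _ prb)//; exact: rintegrable_tensor_sum.
rewrite -(@Int_sum _ _ _ prb); last first.
  by move=> k; apply: (@rintegrableZ _ _ _ prb); exact: rintegrable_tensor_sum.
by apply: eq_Rintegral => y _; rewrite mulr_sumr; apply: eq_bigr => k _; rewrite mulrCA.
Qed.

Lemma regE n f x : rintegrable mu f -> reg n f x = \int[mu]_y (Ker n x y * f y).
Proof.
move=> sf; rewrite /reg; under eq_bigr do rewrite mulrC.
rewrite (sum_Int_bas _ sf (@tensor_sum_bas R n)); apply: eq_Rintegral => y _.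
by rewrite mulrC KerE.
Qed.

Lemma pd_reg j n f x : rintegrable mu f -> pd j (reg n f) x = \int[mu]_y (dKer j n x y * f y).
Proof.
move=> sf; rewrite /reg pd_sum; last by move=> k; apply: tensor_sum_scale; exact: tensor_sum_bas.
under eq_bigr do rewrite (pdZ _ _ (tensor_sum_bas _)) mulrC.
rewrite (sum_Int_bas _ sf (@tensor_sum_bas R n)); apply: eq_Rintegral => y _.
by rewrite mulrC -Ker_dl.
Qed.

(** The kernel depends on [x - y], so moving the derivative from one variable
    to the other changes the sign. *)
Lemma reg_weak_pd j n f x : rintegrable mu f ->
  \sum_(k : idx n) (\int[mu]_y (f y * pd j (bas k) y)) * bas k x = - pd j (reg n f) x.
Proof.
move=> sf; under eq_bigr do rewrite mulrC.
rewrite (sum_Int_bas _ sf (fun k => tensor_sum_pd j (tensor_sum_bas k))) pd_reg// -mulN1r -(@IntZ _ _ _ prb).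
  by apply: eq_Rintegral => y _; rewrite Ker_dr; ring.
under [X in rintegrable _ X]eq_fun do rewrite mulrC.
exact: rintegrable_tensor_sum (tensor_sum_dKer j n x).
Qed.

Lemma reg_pd j n f : tensor_sum f -> pd j (reg n f) = reg n (pd j f).
Proof.
move=> nf; apply/funext => x; have sf := tensor_sum_rintegrable nf.
apply/eqP; rewrite -[pd j _ x]opprK -(reg_weak_pd j n x sf) eqr_oppLR; apply/eqP.
rewrite /reg -sumrN; apply: eq_bigr => k _; rewrite -mulNr; congr (_ * _).
by rewrite /coef Int_parts ?opprK//; exact: tensor_sum_bas.
Qed.

Lemma Int_reg_mul n f g : rintegrable mu g ->
  \int[mu]_x (g x * reg n f x) = \sum_(k : idx n) coef f k * coef g k.
Proof.
by move=> sg; rewrite -(sum_Int_bas _ sg (@tensor_sum_bas R n)).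
Qed.

Lemma reg_selfadj n f g : rintegrable mu f -> rintegrable mu g ->
  \int[mu]_x (g x * reg n f x) = \int[mu]_x (f x * reg n g x).
Proof. by move=> sf sg; rewrite !Int_reg_mul//; apply: eq_bigr => k _; rewrite mulrC. Qed.

Lemma Int_reg n f : rintegrable mu f -> \int[mu]_x reg n f x = \int[mu]_x f x.
Proof.
move=> sf; have s1 : rintegrable mu (fun _ => 1) by exact: (@rintegrable_cst _ _ _ prb).
transitivity (\int[mu]_x (1 * reg n f x)); first by apply: eq_Rintegral => x _; rewrite mul1r.
rewrite reg_selfadj//; apply: eq_Rintegral => x _; rewrite regE//.
under eq_Rintegral do rewrite mulr1.
by rewrite Int_Ker mulr1.
Qed.

Lemma regB n f g x : rintegrable mu f -> rintegrable mu g ->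
  reg n (fun y => f y - g y) x = reg n f x - reg n g x.
Proof.
by move=> sf sg; rewrite /reg -sumrB; apply: eq_bigr => k _; rewrite coefB// mulrBl.
Qed.

End Regularization.

(** * Vector identities *)

Section VectorCalculus.
Variable R : realType.
Local Notation mu := (torus_measure R).
Local Notation prb := (mu : probability (mspace3 R) R).
Implicit Types (v w z : 'I_3 -> space3 R -> R) (x y : space3 R) (i j : 'I_3) (n : nat).

Lemma sum_I3 (V : nmodType) (F : 'I_3 -> V) : \sum_i F i = F 0 + F 1 + F 2.
Proof.
rewrite !big_ord_recl big_ord0 addr0 addrA; congr (F _ + F _ + F _); exact: val_inj.
Qed.

Lemma I3_addE : ((0 + 1)%R = 1 :> 'I_3) * ((0 + 2)%R = 2 :> 'I_3) * ((1 + 1)%R = 2 :> 'I_3) *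
  ((1 + 2)%R = 0 :> 'I_3) * ((2 + 1)%R = 0 :> 'I_3) * ((2 + 2)%R = 1 :> 'I_3).
Proof. by do 5?[split]; exact: val_inj. Qed.

(** Let [dV j i] stand for the derivative of [V_i] along [j]. By the product
    rule the left-hand side is the divergence of [V (V . W)] minus
    [W . (V . grad) V], and the latter is [W . grad |V|^2 / 2], since
    [(V . grad) V] differs from the gradient by the cross product of [W] and
    [V], orthogonal to [W]. *)
Lemma triadic_identity (V W : 'I_3 -> R) (dV dW : 'I_3 -> 'I_3 -> R) :
  (forall i, W i = dV (i + 1) (i + 2) - dV (i + 2) (i + 1)) ->
  \sum_i dV i i = 0 -> \sum_i dW i i = 0 ->
  \sum_i \sum_j V i * V j * dW j i =
  \sum_i (dV i i * (\sum_j V j * W j) + V i * (\sum_j (dV i j * W j + V j * dW i j)) -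
    2^-1 * (dW i i * (\sum_j V j * V j) + W i * \sum_j (dV i j * V j + V j * dV i j))).
Proof.
move=> hW; rewrite !sum_I3 (hW 0) (hW 1) (hW 2) !I3_addE => h1 h2.
have -> : dV 0 0 = - dV 1 1 - dV 2 2 by lra.
have -> : dW 0 0 = - dW 1 1 - dW 2 2 by lra.
by field.
Qed.

Lemma hessian_curl_trace (H : 'I_3 -> 'I_3 -> 'I_3 -> R) : (forall i j l, H i j l = H j i l) ->
  \sum_i (H i (i + 1) (i + 2) - H i (i + 2) (i + 1)) = 0.
Proof. by move=> h; rewrite !sum_I3 !I3_addE (h 0 1) (h 0 2) (h 1 2); ring. Qed.

Lemma cross_product_divergence (V Z : 'I_3 -> R) (dV dZ : 'I_3 -> 'I_3 -> R) :
  \sum_i Z i * (dV (i + 1) (i + 2) - dV (i + 2) (i + 1)) -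
  \sum_i V i * (dZ (i + 1) (i + 2) - dZ (i + 2) (i + 1)) =
  \sum_i (dV i (i + 1) * Z (i + 2) + V (i + 1) * dZ i (i + 2) -
     (dV i (i + 2) * Z (i + 1) + V (i + 2) * dZ i (i + 1))).
Proof. by rewrite !sum_I3 !I3_addE; ring. Qed.

Definition curl v i : space3 R -> R := fun x => pd (i + 1) (v (i + 2)) x - pd (i + 2) (v (i + 1)) x.

Lemma tensor_sum_curl v : (forall i, tensor_sum (v i)) -> forall i, tensor_sum (curl v i).
Proof. by move=> nv i; apply: tensor_sum_sub; exact: tensor_sum_pd. Qed.

Lemma pd_curl v i j : (forall i, tensor_sum (v i)) ->
  pd j (curl v i) = fun x => pd j (pd (i + 1) (v (i + 2))) x - pd j (pd (i + 2) (v (i + 1))) x.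
Proof. by move=> nv; rewrite /curl pdB//; exact: tensor_sum_pd. Qed.

Lemma div_curl v x : (forall i, tensor_sum (v i)) -> \sum_i pd i (curl v i) x = 0.
Proof.
move=> nv; under eq_bigr do rewrite pd_curl//.
by apply: (@hessian_curl_trace (fun i j l => pd i (pd j (v l)) x)) => i j l; rewrite pdC.
Qed.

Lemma Int_div v : (forall i, tensor_sum (v i)) -> \int[mu]_x (\sum_i pd i (v i) x) = 0.
Proof.
move=> nv; rewrite (@Int_sum _ _ _ prb); last by move=> i; exact: tensor_sum_rintegrable (tensor_sum_pd i (nv i)).
by apply: big1 => i _; exact: Int_pd.
Qed.

(** The difference of the two integrands is the divergence of the cross
    product of [v] and [z]. *)
Lemma curl_selfadj v z : (forall i, tensor_sum (v i)) -> (forall i, tensor_sum (z i)) ->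
  \int[mu]_x (\sum_i z i x * curl v i x) = \int[mu]_x (\sum_i v i x * curl z i x).
Proof.
move=> nv nz; apply/eqP; rewrite -subr_eq0 -(@IntB _ _ _ prb); last 2 first.
- apply: tensor_sum_rintegrable; apply: tensor_sum_sum => i; apply: tensor_sum_mul => //; exact: tensor_sum_curl.
- apply: tensor_sum_rintegrable; apply: tensor_sum_sum => i; apply: tensor_sum_mul => //; exact: tensor_sum_curl.
pose X i x := v (i + 1) x * z (i + 2) x - v (i + 2) x * z (i + 1) x.
have nX i : tensor_sum (X i) by apply: tensor_sum_sub; apply: tensor_sum_mul.
rewrite -[X in _ == X](Int_div nX); apply/eqP; apply: eq_Rintegral => x _.
have dX i : pd i (X i) x = pd i (v (i + 1)) x * z (i + 2) x + v (i + 1) x * pd i (z (i + 2)) x -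
   (pd i (v (i + 2)) x * z (i + 1) x + v (i + 2) x * pd i (z (i + 1)) x).
  by rewrite /X (pdB _ (tensor_sum_mul (nv _) (nz _)) (tensor_sum_mul (nv _) (nz _))) !pdM.
rewrite (eq_bigr _ (fun i _ => dX i)).
exact: (cross_product_divergence (fun i => v i x) (fun i => z i x) (fun j i => pd j (v i) x) (fun j i => pd j (z i) x)).
Qed.

Lemma Int_triadic v : (forall i, tensor_sum (v i)) -> (forall x, \sum_i pd i (v i) x = 0) ->
  \int[mu]_x (\sum_i \sum_j v i x * v j x * pd j (curl v i) x) = 0.
Proof.
move=> nv dv0.
have nw := tensor_sum_curl nv; have dw0 x := div_curl x nv.
(* Helicity density and twice the kinetic energy density. *)
pose e x := \sum_i v i x * curl v i x; pose k x := \sum_i v i x * v i x.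
have ne : tensor_sum e by apply: tensor_sum_sum => i; exact: tensor_sum_mul.
have nk : tensor_sum k by apply: tensor_sum_sum => i; exact: tensor_sum_mul.
have n1 i : tensor_sum (fun x => v i x * e x) by exact: tensor_sum_mul.
have n2 i : tensor_sum (fun x => 2^-1 * (curl v i x * k x)) by apply: tensor_sum_scale; exact: tensor_sum_mul.
have nX i : tensor_sum (fun x => v i x * e x - 2^-1 * (curl v i x * k x)) by exact: tensor_sum_sub.
rewrite -[RHS](Int_div nX); apply: eq_Rintegral => x _.
have de j : pd j e x = \sum_i (pd j (v i) x * curl v i x + v i x * pd j (curl v i) x).
  rewrite /e pd_sum; last by move=> i; exact: tensor_sum_mul.
  by apply: eq_bigr => i _; rewrite pdM.
have dk j : pd j k x = \sum_i (pd j (v i) x * v i x + v i x * pd j (v i) x).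
  rewrite /k pd_sum; last by move=> i; exact: tensor_sum_mul.
  by apply: eq_bigr => i _; rewrite pdM.
have dX i : pd i (fun x => v i x * e x - 2^-1 * (curl v i x * k x)) x =
   pd i (v i) x * e x + v i x * pd i e x - 2^-1 * (pd i (curl v i) x * k x + curl v i x * pd i k x).
  by rewrite (pdB _ (n1 i) (n2 i)) (pdM _ (nv i) ne) (pdZ _ _ (tensor_sum_mul (nw i) nk)) (pdM _ (nw i) nk).
rewrite (eq_bigr _ (fun i _ => dX i)).
under [RHS]eq_bigr do rewrite de dk.
exact: (triadic_identity (fun i => v i x) (fun i => erefl (curl v i x)) (dv0 x) (dw0 x)).
Qed.

End VectorCalculus.

(** * Kernel means of increments *)

Section IteratedBound.
Context d1 d2 (T1 : measurableType d1) (T2 : measurableType d2) (R : realType)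
  (m1 : probability T1 R) (m2 : probability T2 R).

(** By Fubini the extended integrals in [y] are finite for almost every [x].
    At the other points the real integral is 0, so the real iterated integral
    is still at most the extended one. *)
Lemma iterated_bound (g : T1 * T2 -> R) (M : R) : measurable_fun [set: T1 * T2] g ->
  (forall z, 0 <= g z) -> (\int[m1]_x \int[m2]_y (g (x, y))%:E <= M%:E)%E ->
  [/\ {ae m1, forall x, rintegrable m2 (fun y => g (x, y))},
      rintegrable m1 (fun x => \int[m2]_y g (x, y)) &
      \int[m1]_x \int[m2]_y g (x, y) <= M].
Proof.
move=> mg g0 hM.
have mf : measurable_fun [set: T1 * T2] (EFin \o g) by exact/measurable_EFinP.
have ig : (m1 \x m2)%E.-integrable [set: T1 * T2] (EFin \o g).
  apply/integrable12ltyP => //; apply: le_lt_trans (ltry M); apply: le_trans hM.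
  by under eq_integral do under eq_integral do rewrite /= ger0_norm//.
have iF := integrable_fubini_F ig.
have F0 x : (0 <= \int[m2]_y (g (x, y))%:E)%E by apply: integral_ge0 => y _; rewrite lee_fin.
have fineF x : ((\int[m2]_y g (x, y))%:E <= \int[m2]_y (g (x, y))%:E)%E.
  rewrite /Rintegral; move: (F0 x); case: (\int[m2]_y (g (x, y))%:E)%E => //= _; exact: leey.
have I0 x : 0 <= \int[m2]_y g (x, y) by apply: Rintegral_ge0.
have iR : rintegrable m1 (fun x => \int[m2]_y g (x, y)).
  apply: le_integrable iF => //.
    apply/measurable_EFinP; apply: (measurableT_comp (@fine_measurable R setT measurableT)).
    exact: measurable_fubini_F ig.
  move=> x _; rewrite [leLHS]gee0_abs ?lee_fin// gee0_abs; [exact: fineF|exact: F0].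
split=> //.
  by apply: (@filterS _ _ (ae_filter_ringOfSetsType m1) _ _ _ (ae_integrable1 ig)).
rewrite -lee_fin EFin_Int//; apply: le_trans hM.
apply: ge0_le_integral => //.
- by move=> x _; rewrite lee_fin.
- by have /integrableP[] := iR.
- exact: measurable_fubini_F ig.
Qed.

End IteratedBound.

Section KernelEstimates.
Variable R : realType.
Local Notation mu := (torus_measure R).
Local Notation prb := (mu : probability (mspace3 R) R).
Implicit Types (f g P Q : space3 R -> R) (x y : space3 R) (i j : 'I_3) (n m : nat) (s t c : R).

(** One constant for the moments ([Int_Ker_rho2]) and for the pointwise bound
    ([Ker_sup]). *)
Definition Ker_cst : R := 80 * expR 3.

Lemma Ker_cst_ge1 : 1 <= Ker_cst.
Proof. by rewrite /Ker_cst; have := expR_ge1Dx (3 : R); lra. Qed.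

Lemma rintegrable_Ker n x f : rintegrable mu f -> rintegrable mu (fun y => Ker n x y * f y).
Proof.
move=> sf; under [X in rintegrable _ X]eq_fun do rewrite mulrC.
exact: rintegrable_tensor_sum (tensor_sum_Ker n x).
Qed.

Lemma Ker_rho_bounded n x s : 0 <= s <= 2 ->
  rintegrable mu (fun y => Ker n x y * rho x y `^ s) /\
  \int[mu]_y (Ker n x y * rho x y `^ s) <= Ker_cst * width R n `^ s.
Proof.
move=> hs.
have nK : rintegrable mu (fun y => Ker n x y * (1 + n.+1%:R * rho2 x y)).
  by apply: tensor_sum_rintegrable; apply: (tensor_sum_mul (tensor_sum_Ker n x)); apply: (tensor_sum_add (tensor_sum_cst 1)); apply: tensor_sum_scale; exact: tensor_sum_rho2.
have le y : Ker n x y * rho x y `^ s <= width R n `^ s * (Ker n x y * (1 + n.+1%:R * rho2 x y)).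
  rewrite mulrCA ler_wpM2l ?Ker_ge0//; exact: rho_powR.
have i1 : rintegrable mu (fun y => width R n `^ s * (Ker n x y * (1 + n.+1%:R * rho2 x y))).
  exact: (@rintegrableZ _ _ _ prb).
have i2 : rintegrable mu (fun y => Ker n x y * rho x y `^ s).
  apply: (@rintegrable_le _ _ _ prb _ _ _ _ i1) => [|y]; last by rewrite ger0_norm ?mulr_ge0 ?Ker_ge0 ?powR_ge0.
  by apply: measurable_funM; [exact: tensor_sum_measurable (tensor_sum_Ker n x)|exact: measurable_rho].
split => //; apply: (le_trans (@Int_le _ _ _ prb _ _ i2 i1 le)).
rewrite (@IntZ _ _ _ prb)// mulrC ler_wpM2r ?powR_ge0//.
apply: (le_trans (Int_Ker_rho2 n x)); have := Ker_cst_ge1; rewrite /Ker_cst; have := expR_ge1Dx (3 : R); lra.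
Qed.

Lemma Ker_increment_le n x s c P g : 0 <= s <= 2 -> 0 <= c -> rintegrable mu P ->
  rintegrable mu g -> (forall y, 0 <= g y) ->
  {ae mu, forall y, P y <= rho x y `^ s * (c + rho x y ^+ 3 * g y)} ->
  \int[mu]_y (Ker n x y * P y) <= Ker_cst * width R n `^ s * (c + \int[mu]_y g y).
Proof.
move=> hs c0 iP ig g0 h; have [i1 b1] := Ker_rho_bounded n x hs.
apply: (@weighted_increment_le _ _ _ prb (Ker n x) (rho x) s c _ P g) => //.
- by move=> y; exact: Ker_ge0.
- by move=> y; exact: Ker_sup.
- exact: rintegrable_Ker.
Qed.

Lemma Ker_increment_mul_le n x s t c P Q g1 g2 : 0 <= s <= 2 -> 0 <= t <= 2 -> 0 <= c ->
  rintegrable mu P -> rintegrable mu Q ->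
  rintegrable mu g1 -> rintegrable mu g2 -> (forall y, 0 <= g1 y) -> (forall y, 0 <= g2 y) ->
  {ae mu, forall z, {ae mu, forall y,
     P y * Q z <= rho x y `^ s * rho x z `^ t * (c + rho x y ^+ 3 * g1 y + rho x z ^+ 3 * g2 z)}} ->
  (\int[mu]_y (Ker n x y * P y)) * (\int[mu]_z (Ker n x z * Q z)) <=
    Ker_cst ^+ 2 * width R n `^ (s + t) * (c + \int[mu]_y g1 y + \int[mu]_z g2 z).
Proof.
move=> hs ht c0 iP iQ ig1 ig2 g10 g20 h.
have [i1 b1] := Ker_rho_bounded n x hs; have [i2 b2] := Ker_rho_bounded n x ht.
have -> : Ker_cst ^+ 2 * width R n `^ (s + t) = (Ker_cst * width R n `^ s) * (Ker_cst * width R n `^ t).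
  rewrite powRD; last by rewrite (gt_eqF (width_gt0 R n)) implybT.
  by rewrite expr2 mulrACA.
apply: (@weighted_increment_mul_le _ _ _ prb (Ker n x) (rho x) s t c _ _ P Q g1 g2) => //.
- by rewrite mulr_ge0 ?powR_ge0// (le_trans ler01)// Ker_cst_ge1.
- by move=> y; exact: Ker_ge0.
- by move=> y; exact: rho_ge0.
- by move=> y; exact: Ker_sup.
- by move=> y; exact: Ker_sup.
- exact: rintegrable_Ker.
- exact: rintegrable_Ker.
Qed.

(** The kernel has mass one, so a covariance does not change when the
    constants [f x] and [g x] are subtracted from [f] and [g]. *)
Lemma reg_covariance n x f g : rintegrable mu f -> rintegrable mu g ->
  rintegrable mu (fun y => f y * g y) ->
  reg n (fun y => f y * g y) x - reg n f x * reg n g x =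
  \int[mu]_y (Ker n x y * ((f y - f x) * (g y - g x))) -
  (\int[mu]_y (Ker n x y * (f y - f x))) * (\int[mu]_y (Ker n x y * (g y - g x))).
Proof.
move=> sf sg sfg.
have cst c : rintegrable mu (fun _ => c) by exact: (@rintegrable_cst _ _ _ prb).
have K1 := Int_Ker n x; have iK := tensor_sum_rintegrable (tensor_sum_Ker n x).
have shift h c : rintegrable mu h -> \int[mu]_y (Ker n x y * (h y - c)) = reg n h x - c.
  move=> sh; under eq_Rintegral do rewrite mulrBr.
  rewrite (@IntB _ _ _ prb); [|exact: rintegrable_Ker|exact: rintegrable_Ker].
  by rewrite regE// (@IntZr _ _ _ prb)// K1 mul1r.
rewrite !shift// (regE n x sfg).
have -> : \int[mu]_y (Ker n x y * ((f y - f x) * (g y - g x))) =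
   \int[mu]_y (Ker n x y * (f y * g y) - (g x * (Ker n x y * (f y - f x)) + f x * (Ker n x y * g y))).
  by apply: eq_Rintegral => y _; ring.
have i1 : rintegrable mu (fun y => g x * (Ker n x y * (f y - f x))).
  by apply: (@rintegrableZ _ _ _ prb); apply: rintegrable_Ker; exact: (@rintegrableB _ _ _ prb).
have i2 : rintegrable mu (fun y => f x * (Ker n x y * g y)).
  by apply: (@rintegrableZ _ _ _ prb); exact: rintegrable_Ker.
rewrite (@IntB _ _ _ prb); [|exact: rintegrable_Ker|exact: (@rintegrableD _ _ _ prb)].
rewrite (@IntD _ _ _ prb)// !(@IntZ _ _ _ prb); [|exact: rintegrable_Ker|]; last first.
  by apply: rintegrable_Ker; exact: (@rintegrableB _ _ _ prb).
rewrite shift// -(regE n x sg); ring.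
Qed.

Lemma norm_Int_Ker n x f : rintegrable mu f ->
  `|\int[mu]_y (Ker n.*2 x y * f y)| <= 8 * \int[mu]_y (Ker n x y * `|f y|).
Proof.
move=> sf; have sn : rintegrable mu (fun y => `|f y|) by exact: integrable_norm.
apply: (le_trans (@norm_Int _ _ _ prb _ (rintegrable_Ker n.*2 x sf))).
rewrite -(@IntZ _ _ _ prb); last exact: rintegrable_Ker.
apply: (@Int_le _ _ _ prb).
- by apply: (@integrable_norm _ _ _ prb); exact: rintegrable_Ker.
- by apply: (@rintegrableZ _ _ _ prb); exact: rintegrable_Ker.
- move=> y; rewrite normrM ger0_norm ?Ker_ge0// mulrA ler_wpM2r//; exact: Ker_double_le.
Qed.

(** The derivative of the kernel has mean zero, so [f x] may be subtracted
    from [f]. *)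
Lemma norm_pd_reg n x j f : rintegrable mu f ->
  `|pd j (reg n.*2 f) x| <= 32 * pi * (width R n)^-1 * \int[mu]_y (Ker n x y * `|f y - f x|).
Proof.
move=> sf; have cst c : rintegrable mu (fun _ => c) by exact: (@rintegrable_cst _ _ _ prb).
have sd : rintegrable mu (fun y => f y - f x) by exact: (@rintegrableB _ _ _ prb).
have sn : rintegrable mu (fun y => `|f y - f x|) by exact: integrable_norm.
have idK h : rintegrable mu h -> rintegrable mu (fun y => dKer j n.*2 x y * h y).
  move=> sh; under [X in rintegrable _ X]eq_fun do rewrite mulrC.
  exact: rintegrable_tensor_sum (tensor_sum_dKer j n.*2 x).
have -> : pd j (reg n.*2 f) x = \int[mu]_y (dKer j n.*2 x y * (f y - f x)).
  rewrite pd_reg//; under [RHS]eq_Rintegral do rewrite mulrBr.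
  rewrite (@IntB _ _ _ prb); [|exact: idK|exact: idK].
  rewrite (@IntZr _ _ _ prb); last exact: tensor_sum_rintegrable (tensor_sum_dKer j n.*2 x).
  by rewrite Int_dKer mul0r subr0.
apply: (le_trans (@norm_Int _ _ _ prb _ (idK _ sd))).
rewrite -(@IntZ _ _ _ prb); last exact: rintegrable_Ker.
apply: (@Int_le _ _ _ prb).
- by apply: (@integrable_norm _ _ _ prb); exact: idK.
- by apply: (@rintegrableZ _ _ _ prb); exact: rintegrable_Ker.
- move=> y; rewrite normrM mulrA ler_wpM2r// /width invrK; exact: dKer_le.
Qed.

(** The mean of [(f - c)^2], with [c] the mean of [f], is nonnegative. *)
Lemma jensen_Ker n x f : rintegrable mu f -> rintegrable mu (fun y => f y ^+ 2) ->
  (\int[mu]_y (Ker n x y * f y)) ^+ 2 <= \int[mu]_y (Ker n x y * f y ^+ 2).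
Proof.
move=> sf sf2; set c := \int[mu]_y (Ker n x y * f y); rewrite -subr_ge0.
have -> : \int[mu]_y (Ker n x y * f y ^+ 2) - c ^+ 2 =
   \int[mu]_y (Ker n x y * f y ^+ 2 - ((2 * c) * (Ker n x y * f y) - c ^+ 2 * Ker n x y)).
  have iK := tensor_sum_rintegrable (tensor_sum_Ker n x).
  have i1 : rintegrable mu (fun y => 2 * c * (Ker n x y * f y)).
    by apply: (@rintegrableZ _ _ _ prb); exact: rintegrable_Ker.
  have i2 : rintegrable mu (fun y => c ^+ 2 * Ker n x y) by exact: (@rintegrableZ _ _ _ prb).
  rewrite (@IntB _ _ _ prb); [|exact: rintegrable_Ker|exact: (@rintegrableB _ _ _ prb)].
  rewrite (@IntB _ _ _ prb)// !(@IntZ _ _ _ prb)//; last exact: rintegrable_Ker.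
  rewrite Int_Ker -/c; ring.
apply: Rintegral_ge0 => y _.
have -> : Ker n x y * f y ^+ 2 - (2 * c * (Ker n x y * f y) - c ^+ 2 * Ker n x y) =
  Ker n x y * (f y - c) ^+ 2 by ring.
by rewrite mulr_ge0 ?Ker_ge0 ?sqr_ge0.
Qed.

End KernelEstimates.

(** * Regularization error and helicity flux of a time slice *)

(** The product of the means is bounded by half the sum of their squares. *)
Lemma covariance_arith (R : realFieldType) (X a b S Sa Sb : R) : `|X| <= 8 * S ->
  a ^+ 2 <= 8 * Sa -> b ^+ 2 <= 8 * Sb -> `|X - a * b| <= 8 * (S + 2^-1 * Sa + 2^-1 * Sb).
Proof.
rewrite !ler_norml => /andP[h1 h2] ha hb.
have p1 := sqr_ge0 (a - b); have p2 := sqr_ge0 (a + b).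
have E1 : (a - b) ^+ 2 = a ^+ 2 - 2 * (a * b) + b ^+ 2 by ring.
have E2 : (a + b) ^+ 2 = a ^+ 2 + 2 * (a * b) + b ^+ 2 by ring.
by apply/andP; split; lra.
Qed.

Lemma sum_cst_I3 (R : pzRingType) (b : R) : \sum_(i < 3) b = 3 * b.
Proof. by rewrite sumr_const card_ord mulr_natl. Qed.

Lemma addr_le2 (R : realFieldType) (c a b M : R) : a <= M -> b <= M -> c + a + b <= c + 2 * M.
Proof. by lra. Qed.

Section SliceEstimates.
Variable R : realType.
Local Notation mu := (torus_measure R).
Local Notation prb := (mu : probability (mspace3 R) R).
Implicit Types (u w : 'I_3 -> space3 R -> R) (x y z : space3 R) (i j l : 'I_3) (n m : nat).
Implicit Types (theta alpha c M : R) (g : mspace3 R * mspace3 R -> R).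

(** Young's inequality for difference quotients, multiplied by the powers of
    the distance that turn quotients into increments. *)
Definition increment_bound theta alpha c g1 g2 u w x y z :=
  forall i j l,
    `|u i y - u i x| * `|u j y - u j x| * `|w l z - w l x| <=
      rho x y `^ (2 * theta) * rho x z `^ alpha *
      (c + rho x y ^+ 3 * g1 (x, y) + rho x z ^+ 3 * g2 (x, z)) /\
    `|u i y - u i x| * `|w l z - w l x| <=
      rho x y `^ theta * rho x z `^ alpha *
      (c + rho x y ^+ 3 * g1 (x, y) + rho x z ^+ 3 * g2 (x, z)).

(** The form in which the Sobolev bounds of a time slice are used: [g1] and
    [g2] are multiples of the two Gagliardo densities, and the exponents of
    integrability no longer appear. *)
Definition slice_regular theta alpha c M u w := exists g1 g2,
  [/\ measurable_fun [set: mspace3 R * mspace3 R] g1 /\ measurable_fun [set: mspace3 R * mspace3 R] g2,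
      (forall p, 0 <= g1 p) /\ (forall p, 0 <= g2 p),
      (\int[mu]_x \int[mu]_y (g1 (x, y))%:E <= M%:E)%E /\
      (\int[mu]_x \int[mu]_y (g2 (x, y))%:E <= M%:E)%E &
      {ae mu, forall x, exists2 E : set (mspace3 R), {ae mu, forall y, E y} &
        forall y z, E y -> E z -> increment_bound theta alpha c g1 g2 u w x y z}].

Definition slice_integrable u w :=
  [/\ forall i, rintegrable mu (u i), forall i j, rintegrable mu (fun x => u i x * u j x),
      forall i, rintegrable mu (w i) & forall i, rintegrable mu (fun x => u i x * w i x)].

Variables (theta alpha c M : R) (u w : 'I_3 -> space3 R -> R).
Hypotheses (theta01 : 0 < theta < 1) (alpha01 : 0 < alpha < 1) (c0 : 0 <= c).
Hypotheses (siu : slice_integrable u w) (sru : slice_regular theta alpha c M u w).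

Let iu i : rintegrable mu (u i). Proof. by case: siu. Qed.
Let iuu i j : rintegrable mu (fun x => u i x * u j x). Proof. by case: siu. Qed.
Let iw i : rintegrable mu (w i). Proof. by case: siu. Qed.
Let iuw i : rintegrable mu (fun x => u i x * w i x). Proof. by case: siu. Qed.
Let cst b : rintegrable mu (fun _ => b). Proof. exact: (@rintegrable_cst _ _ _ prb). Qed.

Let du i x : rintegrable mu (fun y => u i y - u i x).
Proof. exact: (@rintegrableB _ _ _ prb). Qed.
Let dw i x : rintegrable mu (fun y => w i y - w i x).
Proof. exact: (@rintegrableB _ _ _ prb). Qed.
Let ndu i x : rintegrable mu (fun y => `|u i y - u i x|).
Proof. by apply: (@integrable_norm _ _ _ prb); exact: du. Qed.
Let ndw i x : rintegrable mu (fun y => `|w i y - w i x|).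
Proof. by apply: (@integrable_norm _ _ _ prb); exact: dw. Qed.

Let prod_increments (f g : space3 R -> R) (a b : R) : rintegrable mu f -> rintegrable mu g ->
  rintegrable mu (fun y => f y * g y) -> rintegrable mu (fun y => (f y - a) * (g y - b)).
Proof.
move=> sf sg sfg; rewrite (_ : (fun y => _) = fun y => f y * g y - (b * f y + (a * g y - a * b))).
  apply: (@rintegrableB _ _ _ prb) => //; apply: (@rintegrableD _ _ _ prb).
    exact: (@rintegrableZ _ _ _ prb).
  by apply: (@rintegrableB _ _ _ prb) => //; exact: (@rintegrableZ _ _ _ prb).
by apply/funext => y; ring.
Qed.

Let duu i j x : rintegrable mu (fun y => (u i y - u i x) * (u j y - u j x)).
Proof. exact: prod_increments. Qed.
Let nduu i j x : rintegrable mu (fun y => `|u i y - u i x| * `|u j y - u j x|).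
Proof. by under [X in rintegrable _ X]eq_fun do rewrite -normrM; apply: (@integrable_norm _ _ _ prb); exact: duu. Qed.
Let duw i x : rintegrable mu (fun y => (u i y - u i x) * (w i y - w i x)).
Proof. exact: prod_increments. Qed.
Let nduw i x : rintegrable mu (fun y => `|u i y - u i x| * `|w i y - w i x|).
Proof. by under [X in rintegrable _ X]eq_fun do rewrite -normrM; apply: (@integrable_norm _ _ _ prb); exact: duw. Qed.

Definition stress n i j x : R := reg n (fun y => u i y * u j y) x - reg n (u i) x * reg n (u j) x.

Let Int0 (f : space3 R -> R) : (forall y, 0 <= f y) -> 0 <= \int[mu]_y f y.
Proof. by move=> h; apply: Rintegral_ge0. Qed.

(** Jensen's inequality bounds the product of two means in the covariance by
    means of products, so that every term of the stress is a single mean of a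
    quadratic expression. *)
Lemma norm_stress m i j x :
  `|stress m.*2 i j x| <= 8 * (\int[mu]_y (Ker m x y * (`|u i y - u i x| * `|u j y - u j x|))
    + 2^-1 * \int[mu]_y (Ker m x y * (`|u i y - u i x| * `|u i y - u i x|))
    + 2^-1 * \int[mu]_y (Ker m x y * (`|u j y - u j x| * `|u j y - u j x|))).
Proof.
have sq k : (\int[mu]_y (Ker m.*2 x y * (u k y - u k x))) ^+ 2 <=
   8 * \int[mu]_y (Ker m x y * (`|u k y - u k x| * `|u k y - u k x|)).
  apply: le_trans (jensen_Ker _ _ _ _) _ => //; first by apply: duu.
  apply: le_trans (ler_norm _) _; apply: le_trans (norm_Int_Ker _ _ (duu _ _ _)) _.
  by rewrite ler_wpM2l//; under eq_Rintegral do rewrite normrM.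
rewrite /stress reg_covariance//.
have h1 : `|\int[mu]_y (Ker m.*2 x y * ((u i y - u i x) * (u j y - u j x)))| <=
  8 * \int[mu]_y (Ker m x y * (`|u i y - u i x| * `|u j y - u j x|)).
  apply: le_trans (norm_Int_Ker _ _ (duu _ _ _)) _.
  by rewrite ler_wpM2l//; under eq_Rintegral do rewrite normrM.
exact: covariance_arith.
Qed.

(** A field [w] need not have square integrable increments, so Jensen's
    inequality cannot be used as in [norm_stress] and the product of the two
    means is kept. *)
Lemma norm_helicity_defect m i x :
  `|reg m.*2 (fun y => u i y * w i y) x - reg m.*2 (u i) x * reg m.*2 (w i) x| <=
  8 * \int[mu]_y (Ker m x y * (`|u i y - u i x| * `|w i y - w i x|)) +
  64 * (\int[mu]_y (Ker m x y * `|u i y - u i x|) * \int[mu]_y (Ker m x y * `|w i y - w i x|)).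
Proof.
rewrite reg_covariance//; apply: (le_trans (ler_normB _ _)); apply: lerD.
  apply: (le_trans (norm_Int_Ker _ _ (duw _ _))).
  by rewrite ler_wpM2l//; under eq_Rintegral do rewrite normrM.
rewrite normrM; apply: (@le_trans _ _ ((8 * \int[mu]_y (Ker m x y * `|u i y - u i x|)) *
   (8 * \int[mu]_y (Ker m x y * `|w i y - w i x|)))).
  by apply: ler_pM => //; apply: norm_Int_Ker.
by rewrite le_eqVlt; apply/orP; left; apply/eqP; ring.
Qed.

Section AtPoint.
Variables (g1 g2 : mspace3 R * mspace3 R -> R) (x : space3 R) (E : set (mspace3 R)).
Hypotheses (g10 : forall p, 0 <= g1 p) (g20 : forall p, 0 <= g2 p).
Hypotheses (i1 : rintegrable mu (fun y => g1 (x, y))) (i2 : rintegrable mu (fun y => g2 (x, y))).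
Hypotheses (aeE : {ae mu, forall y, E y})
  (hE : forall y z, E y -> E z -> increment_bound theta alpha c g1 g2 u w x y z).
Let G := c + \int[mu]_y g1 (x, y) + \int[mu]_y g2 (x, y).

Let aeE2 (P : mspace3 R -> mspace3 R -> Prop) : (forall y z, E y -> E z -> P y z) ->
  {ae mu, forall z, {ae mu, forall y, P y z}}.
Proof.
move=> h; apply: (@filterS _ _ (ae_filter_ringOfSetsType mu) _ _ _ aeE) => z Ez.
by apply: (@filterS _ _ (ae_filter_ringOfSetsType mu) _ _ _ aeE) => y Ey; exact: h.
Qed.

Let th2 : 0 <= 2 * theta <= 2. Proof. by move: theta01 => /andP[? ?]; lra. Qed.
Let th1 : 0 <= theta <= 2. Proof. by move: theta01 => /andP[? ?]; lra. Qed.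
Let al1 : 0 <= alpha <= 2. Proof. by move: alpha01 => /andP[? ?]; lra. Qed.
Let ta1 : 0 <= theta + alpha <= 2.
Proof. by move: theta01 alpha01 => /andP[? ?] /andP[? ?]; lra. Qed.

Lemma stress_gradient_le m i j l :
  (\int[mu]_y (Ker m x y * (`|u i y - u i x| * `|u j y - u j x|))) *
   \int[mu]_y (Ker m x y * `|w l y - w l x|) <= Ker_cst R ^+ 2 * width R m `^ (2 * theta + alpha) * G.
Proof.
apply: Ker_increment_mul_le => //.
by apply: aeE2 => y z Ey Ez; have [] := hE Ey Ez i j l.
Qed.

Lemma increments_le m i l :
  (\int[mu]_y (Ker m x y * `|u i y - u i x|)) *
   \int[mu]_y (Ker m x y * `|w l y - w l x|) <= Ker_cst R ^+ 2 * width R m `^ (theta + alpha) * G.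
Proof.
apply: Ker_increment_mul_le => //.
by apply: aeE2 => y z Ey Ez; have [] := hE Ey Ez i i l.
Qed.

Lemma product_increments_le m i :
  \int[mu]_y (Ker m x y * (`|u i y - u i x| * `|w i y - w i x|)) <=
    Ker_cst R * width R m `^ (theta + alpha) * G.
Proof.
have -> : G = c + \int[mu]_y (g1 (x, y) + g2 (x, y)) by rewrite (@IntD _ _ _ prb)// addrA.
apply: Ker_increment_le => //.
- exact: (@rintegrableD _ _ _ prb).
- by move=> y; exact: addr_ge0.
apply: (@filterS _ _ (ae_filter_ringOfSetsType mu) _ _ _ aeE) => y Ey.
have [_] := hE Ey Ey i i i.
rewrite powRD; last first.
  by rewrite gt_eqF//; move: theta01 alpha01 => /andP[? ?] /andP[? ?]; lra.
by rewrite (mulrDr (rho x y ^+ 3)) addrA.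
Qed.

Lemma norm_helicity_defect_le m i :
  `|reg m.*2 (fun y => u i y * w i y) x - reg m.*2 (u i) x * reg m.*2 (w i) x| <=
  72 * Ker_cst R ^+ 2 * width R m `^ (theta + alpha) * G.
Proof.
apply: (le_trans (norm_helicity_defect m i x)).
have p1 := product_increments_le m i; have p2 := increments_le m i i.
apply: (@le_trans _ _ (8 * (Ker_cst R * width R m `^ (theta + alpha) * G) + 64 * (Ker_cst R ^+ 2 * width R m `^ (theta + alpha) * G))).
  by apply: lerD; rewrite ler_wpM2l.
have K1 := Ker_cst_ge1 R; have K0 : 0 <= Ker_cst R := le_trans ler01 K1.
have G0 : 0 <= G by rewrite !addr_ge0//; apply: Int0.
set X := width R m `^ (theta + alpha) * G.
have X0 : 0 <= X by rewrite mulr_ge0// powR_ge0.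
have -> : 8 * (Ker_cst R * width R m `^ (theta + alpha) * G) = 8 * (Ker_cst R * X) by rewrite -mulrA.
have -> : 64 * (Ker_cst R ^+ 2 * width R m `^ (theta + alpha) * G) = 64 * (Ker_cst R ^+ 2 * X) by rewrite -mulrA.
have -> : 72 * Ker_cst R ^+ 2 * width R m `^ (theta + alpha) * G = 8 * (Ker_cst R * (Ker_cst R * X)) + 64 * (Ker_cst R ^+ 2 * X) by rewrite /X; ring.
by rewrite lerD2r ler_wpM2l// ler_peMl// mulr_ge0.
Qed.

Lemma norm_stress_gradient_le m i j l k :
  `|stress m.*2 i j x * pd k (reg m.*2 (w l)) x| <=
  512 * pi * Ker_cst R ^+ 2 * width R m `^ (2 * theta + alpha - 1) * G.
Proof.
rewrite normrM; have h1 := norm_stress m i j x; have h2 := norm_pd_reg m x k (iw l).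
apply: (le_trans (ler_pM (normr_ge0 _) (normr_ge0 _) h1 h2)).
have p1 := stress_gradient_le m i j l; have p2 := stress_gradient_le m i i l.
have p3 := stress_gradient_le m j j l.
have dp : width R m `^ (2 * theta + alpha - 1) = (width R m)^-1 * width R m `^ (2 * theta + alpha).
  rewrite powRD; last by rewrite (gt_eqF (width_gt0 R m)) implybT.
  by rewrite powRN powRr1 ?ltW ?width_gt0// mulrC.
rewrite dp; move: p1 p2 p3.
set I := \int[mu]_y (Ker m x y * `|w l y - w l x|).
move: (\int[mu]_y _) => S; move: (\int[mu]_y _) => Si; move: (\int[mu]_y _) => Sj.
set B := Ker_cst R ^+ 2 * _ * G => p1 p2 p3.
have -> : 8 * (S + 2^-1 * Si + 2^-1 * Sj) * (32 * pi * (width R m)^-1 * I) =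
   (256 * pi * (width R m)^-1) * (S * I + 2^-1 * (Si * I) + 2^-1 * (Sj * I)) by ring.
have -> : 512 * pi * Ker_cst R ^+ 2 * ((width R m)^-1 * width R m `^ (2 * theta + alpha)) * G =
   (256 * pi * (width R m)^-1) * (B + 2^-1 * B + 2^-1 * B).
  by rewrite /B; field; rewrite gt_eqF// width_gt0.
have d0 : 0 <= (width R m)^-1 by rewrite invr_ge0 (ltW (width_gt0 R m)).
apply: (ler_wpM2l (mulr_ge0 (mulr_ge0 (ler0n R 256) (pi_ge0 R)) d0)).
have h0 : 0 <= 2^-1 :> R by rewrite invr_ge0 ler0n.
exact: lerD (lerD p1 (ler_wpM2l h0 p2)) (ler_wpM2l h0 p3).
Qed.

End AtPoint.

(** The density [G] is [c] plus the two functions [g1] and [g2] integrated in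
    their second variable; neither it nor the exceptional null set depends on
    the scale [m]. *)
Lemma slice_pointwise_bounds : exists2 G : space3 R -> R,
  rintegrable mu G /\ \int[mu]_x G x <= c + 2 * M &
  {ae mu, forall x : mspace3 R, forall m,
    (forall i, `|reg m.*2 (fun y => u i y * w i y) x - reg m.*2 (u i) x * reg m.*2 (w i) x| <=
       72 * Ker_cst R ^+ 2 * width R m `^ (theta + alpha) * G x) /\
    (forall i j l k, `|stress m.*2 i j x * pd k (reg m.*2 (w l)) x| <=
       512 * pi * Ker_cst R ^+ 2 * width R m `^ (2 * theta + alpha - 1) * G x)}.
Proof.
have [g1 [g2 [[mg1 mg2] [g10 g20] [h1 h2] hE]]] := sru.
have [a1 f1 b1] := iterated_bound (m1 := prb) (m2 := prb) mg1 g10 h1.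
have [a2 f2 b2] := iterated_bound (m1 := prb) (m2 := prb) mg2 g20 h2.
pose G1 x := \int[mu]_y g1 (x, y); pose G2 x := \int[mu]_y g2 (x, y).
rewrite -/G1 in f1 b1; rewrite -/G2 in f2 b2.
exists (fun x => c + G1 x + G2 x).
  have i1 : rintegrable mu (fun x => c + G1 x) := @rintegrableD _ _ _ prb (fun _ => c) G1 (cst c) f1.
  split; first exact: (@rintegrableD _ _ _ prb (fun x => c + G1 x) G2 i1 f2).
  rewrite (@IntD _ _ _ prb (fun x => c + G1 x) G2 i1 f2) (@IntD _ _ _ prb (fun _ => c) G1 (cst c) f1) (@Int_cst _ _ _ prb).
  exact: addr_le2.
have F := ae_filter_ringOfSetsType mu.
have := @filterI _ _ F _ _ a1 (@filterI _ _ F _ _ a2 hE).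
apply: (@filterS _ _ F) => x [i1 [i2 [E aeE hx]]] m; split.
  by move=> i; exact: (norm_helicity_defect_le g10 g20 i1 i2 aeE hx).
by move=> i j l k; exact: (norm_stress_gradient_le g10 g20 i1 i2 aeE hx).
Qed.

(** Regularization preserves integrals, so the integral of [u . w] may be
    replaced by that of its regularization; what remains is a covariance. *)
Lemma helicity_regularization_le m :
  `|\int[mu]_x (\sum_i u i x * w i x) - \int[mu]_x (\sum_i reg m.*2 (u i) x * reg m.*2 (w i) x)| <=
  216 * Ker_cst R ^+ 2 * (c + 2 * M) * width R m `^ (theta + alpha).
Proof.
have [G [iG bG] aeG] := slice_pointwise_bounds.
set A := 72 * Ker_cst R ^+ 2 * width R m `^ (theta + alpha).
have K0 : 0 <= Ker_cst R := le_trans ler01 (Ker_cst_ge1 R).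
have A0 : 0 <= A := mulr_ge0 (mulr_ge0 (ler0n R 72) (exprn_ge0 2 K0)) (powR_ge0 _ _).
have n1 i := tensor_sum_reg m.*2 (fun y => u i y * w i y).
have n2 i := tensor_sum_mul (tensor_sum_reg m.*2 (u i)) (tensor_sum_reg m.*2 (w i)).
have -> : \int[mu]_x (\sum_i u i x * w i x) - \int[mu]_x (\sum_i reg m.*2 (u i) x * reg m.*2 (w i) x) =
   \int[mu]_x (\sum_i (reg m.*2 (fun y => u i y * w i y) x - reg m.*2 (u i) x * reg m.*2 (w i) x)).
  rewrite !(@Int_sum _ _ _ prb).
  - rewrite -sumrB; apply: eq_bigr => i _; rewrite (@IntB _ _ _ prb).
    + by rewrite Int_reg.
    + exact: tensor_sum_rintegrable (n1 i).
    + exact: tensor_sum_rintegrable (n2 i).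
  - by move=> i; apply: tensor_sum_rintegrable; exact: tensor_sum_sub (n1 i) (n2 i).
  - by move=> i; exact: tensor_sum_rintegrable (n2 i).
  - by [].
have iS : rintegrable mu (fun x => \sum_i (reg m.*2 (fun y => u i y * w i y) x - reg m.*2 (u i) x * reg m.*2 (w i) x)).
  by apply: tensor_sum_rintegrable; apply: tensor_sum_sum => i; exact: tensor_sum_sub (n1 i) (n2 i).
apply: (le_trans (@norm_Int _ _ _ prb _ iS)).
apply: (@le_trans _ _ (\int[mu]_x (3 * A * G x))).
  apply: (@Int_le_ae _ _ _ prb).
  - exact: (@integrable_norm _ _ _ prb).
  - exact: (@rintegrableZ _ _ _ prb).
  - apply: (@filterS _ _ (ae_filter_ringOfSetsType mu) _ _ _ aeG) => x /(_ m) [h _].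
    apply: (le_trans (ler_norm_sum _ _ _)).
    apply: (le_trans (ler_sum _ (fun i _ => h i))).
    by rewrite sum_cst_I3 mulrA.
rewrite (@IntZ _ _ _ prb _ _ iG); apply: (@le_trans _ _ (3 * A * (c + 2 * M))).
  by apply: ler_wpM2l bG; apply: mulr_ge0 A0; exact: ler0n.
by rewrite le_eqVlt; apply/orP; left; apply/eqP; rewrite /A; ring.
Qed.

Lemma helicity_flux_le m :
  `|\int[mu]_x (\sum_i \sum_j stress m.*2 i j x * pd j (reg m.*2 (w i)) x)| <=
  4608 * pi * Ker_cst R ^+ 2 * (c + 2 * M) * width R m `^ (2 * theta + alpha - 1).
Proof.
have [G [iG bG] aeG] := slice_pointwise_bounds.
set A := 512 * pi * Ker_cst R ^+ 2 * width R m `^ (2 * theta + alpha - 1).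
have K0 : 0 <= Ker_cst R := le_trans ler01 (Ker_cst_ge1 R).
have A0 : 0 <= A := mulr_ge0 (mulr_ge0 (mulr_ge0 (ler0n R 512) (pi_ge0 R)) (exprn_ge0 2 K0)) (powR_ge0 _ _).
have iS : rintegrable mu (fun x => \sum_i \sum_j stress m.*2 i j x * pd j (reg m.*2 (w i)) x).
  apply: tensor_sum_rintegrable; apply: tensor_sum_sum => i; apply: tensor_sum_sum => j.
  apply: (tensor_sum_mul _ (tensor_sum_pd j (tensor_sum_reg m.*2 (w i)))).
  apply: (tensor_sum_sub (tensor_sum_reg _ _)); exact: tensor_sum_mul (tensor_sum_reg _ _) (tensor_sum_reg _ _).
apply: (le_trans (@norm_Int _ _ _ prb _ iS)).
apply: (@le_trans _ _ (\int[mu]_x (9 * A * G x))).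
  apply: (@Int_le_ae _ _ _ prb).
  - exact: (@integrable_norm _ _ _ prb).
  - exact: (@rintegrableZ _ _ _ prb).
  - apply: (@filterS _ _ (ae_filter_ringOfSetsType mu) _ _ _ aeG) => x /(_ m) [_ h].
    apply: (le_trans (ler_norm_sum _ _ _)).
    apply: (@le_trans _ _ (\sum_(i < 3) \sum_(j < 3) A * G x)).
      apply: ler_sum => i _; apply: (le_trans (ler_norm_sum _ _ _)).
      by apply: ler_sum => j _; exact: h.
    by rewrite !sum_cst_I3 !mulrA -natrM.
rewrite (@IntZ _ _ _ prb _ _ iG); apply: (@le_trans _ _ (9 * A * (c + 2 * M))).
  by apply: ler_wpM2l bG; apply: mulr_ge0 A0; exact: ler0n.
by rewrite le_eqVlt; apply/orP; left; apply/eqP; rewrite /A; ring.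
Qed.

End SliceEstimates.

(** * Time derivative of the regularized helicity *)

Lemma sub_eq_opp (V : zmodType) (a b c d : V) : a = - d -> b = - c -> a - b = c - d.
Proof. by move=> -> ->; rewrite opprK addrC. Qed.

Lemma sub_cross (V : zmodType) (a b c d S S' : V) : S = a + b -> S' = c + d -> b = c ->
  a - d = S - S'.
Proof. by move=> -> -> ->; rewrite addrKA. Qed.

Section HelicityFlux.
Variable R : realType.
Local Notation mu := (torus_measure R).
Local Notation prb := (mu : probability (mspace3 R) R).
Implicit Types (u w : 'I_3 -> space3 R -> R) (x y : space3 R) (i j l : 'I_3) (n m : nat).

(** The equations [w = curl u] and [div u = 0] tested with the finitely many
    basis functions of index [n], which determine the regularized fields. *)
Definition curl_div n u w :=
  (forall i (k : idx n), coef (w i) k =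
     \int[mu]_y (u (i + 1) y * pd (i + 2) (bas k) y) - \int[mu]_y (u (i + 2) y * pd (i + 1) (bas k) y)) /\
  (forall k : idx n, \sum_i \int[mu]_y (u i y * pd i (bas k) y) = 0).

(** The time derivative of the coefficient of the vorticity [l] at [k] that
    the Euler equations predict: the tensor [u_i u_j] tested with the gradient
    of a curl. *)
Definition vorticity_flux n u l (k : idx n) : R :=
  \sum_j (\int[mu]_y (u (l + 1) y * u j y * pd j (pd (l + 2) (bas k)) y) -
          \int[mu]_y (u (l + 2) y * u j y * pd j (pd (l + 1) (bas k)) y)).

(** Half of the time derivative of the regularized helicity, when [w] is the
    vorticity of [u]. *)
Definition helicity_flux n u w : R :=
  \int[mu]_x (\sum_i \sum_j reg n (fun y => u i y * u j y) x * pd j (reg n (w i)) x).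

Section OneSlice.
Variables (n : nat) (u w : 'I_3 -> space3 R -> R).
Hypotheses (siu : slice_integrable u w) (cd : curl_div n u w).
Let iu i : rintegrable mu (u i). Proof. by case: siu. Qed.
Let iuu i j : rintegrable mu (fun x => u i x * u j x). Proof. by case: siu. Qed.
Let iw i : rintegrable mu (w i). Proof. by case: siu. Qed.
Let v i := reg n (u i).
Let nv i : tensor_sum (v i). Proof. exact: tensor_sum_reg. Qed.

Lemma reg_curl i : reg n (w i) = curl v i.
Proof.
apply/funext => x; rewrite /reg; under eq_bigr do rewrite (proj1 cd) mulrBl.
rewrite sumrB.
exact: sub_eq_opp (reg_weak_pd (i + 2) n x (iu (i + 1))) (reg_weak_pd (i + 1) n x (iu (i + 2))).
Qed.

Lemma reg_div x : \sum_i pd i (v i) x = 0.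
Proof.
rewrite -[LHS]opprK -sumrN; under eq_bigr do rewrite -reg_weak_pd//.
rewrite exchange_big big1 ?oppr0//= => k _.
by rewrite -mulr_suml (proj2 cd) mul0r.
Qed.

(** The two integrals differ by the cubic term of [Int_triadic]. *)
Lemma helicity_flux_stress : helicity_flux n u w = \int[mu]_x (\sum_i \sum_j stress u n i j x * pd j (reg n (w i)) x).
Proof.
have nw i j : tensor_sum (pd j (reg n (w i))) by apply: tensor_sum_pd; exact: tensor_sum_reg.
transitivity (helicity_flux n u w - \int[mu]_x (\sum_i \sum_j v i x * v j x * pd j (curl v i) x)).
  by rewrite (Int_triadic nv reg_div) subr0.
rewrite -(@IntB _ _ _ prb).
- apply: eq_Rintegral => x _; rewrite -sumrB; apply: eq_bigr => i _; rewrite -sumrB.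
  by apply: eq_bigr => j _; rewrite -reg_curl mulrBl.
- by apply: tensor_sum_rintegrable; apply: tensor_sum_sum => i; apply: tensor_sum_sum => j; exact: tensor_sum_mul (tensor_sum_reg _ _) (nw i j).
- apply: tensor_sum_rintegrable; apply: tensor_sum_sum => i; apply: tensor_sum_sum => j.
  by apply: tensor_sum_mul (tensor_sum_mul (nv i) (nv j)) _; rewrite -reg_curl.
Qed.

End OneSlice.

Lemma sum_coef_Int n (f h : space3 R -> R) (D : (space3 R -> R) -> space3 R -> R) :
  rintegrable mu h -> (forall k : idx n, tensor_sum (D (bas k))) ->
  (forall x, D (reg n f) x = \sum_(k : idx n) coef f k * D (bas k) x) ->
  \sum_(k : idx n) coef f k * \int[mu]_y (h y * D (bas k) y) = \int[mu]_y (h y * D (reg n f) y).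
Proof.
move=> ih nD ED; rewrite (sum_Int_bas _ ih nD).
by apply: eq_Rintegral => y _; rewrite ED.
Qed.

Lemma pd2_reg n f i j x :
  pd j (pd i (reg n f)) x = \sum_(k : idx n) coef f k * pd j (pd i (bas k)) x.
Proof.
have nb (k : idx n) : tensor_sum (bas k) := tensor_sum_bas k.
rewrite /reg (pd_sum i); last by move=> k; exact: tensor_sum_scale.
rewrite (_ : (fun x => _) = (fun x => \sum_(k : idx n) coef f k * pd i (bas k) x)); last first.
  by apply/funext => y; apply: eq_bigr => k _; rewrite pdZ.
rewrite pd_sum; last by move=> k; apply: tensor_sum_scale; exact: tensor_sum_pd.
by apply: eq_bigr => k _; rewrite pdZ//; exact: tensor_sum_pd.
Qed.

Lemma curl_flux_reindex (T : 'I_3 -> 'I_3 -> R) (H : 'I_3 -> 'I_3 -> 'I_3 -> R) :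
  \sum_l \sum_j (T (l + 1) j * H j (l + 2) l - T (l + 2) j * H j (l + 1) l) =
  \sum_i \sum_j T i j * (H j (i + 1) (i + 2) - H j (i + 2) (i + 1)).
Proof. by rewrite !sum_I3 !I3_addE; ring. Qed.

(** The sum over [k] tests [u_i u_j] with the gradient of the curl of a field
    regularized twice. That curl is [w] regularized twice, and
    self-adjointness moves one regularization onto [u_i u_j]. *)
Lemma helicity_flux_coef n u w u' w' : slice_integrable u w -> slice_integrable u' w' ->
  curl_div n u' w' ->
  \sum_l \sum_(k : idx n) vorticity_flux u l k * coef (reg n (u' l)) k = helicity_flux n u w'.
Proof.
move=> siu siu' cd'; have [_ iuu _ _] := siu; have [iu' _ iw' _] := siu'.
pose V l := reg n (reg n (u' l)).
have nV l : tensor_sum (V l) by exact: tensor_sum_reg.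
have nrw i : tensor_sum (reg n (w' i)) := tensor_sum_reg n (w' i).
have EV i : curl V i = reg n (reg n (w' i)).
  apply/funext => x; have nru l : tensor_sum (reg n (u' l)) := tensor_sum_reg n (u' l).
  rewrite (reg_curl siu' cd') /curl /V (reg_pd (i + 1) n (nru (i + 2))) (reg_pd (i + 2) n (nru (i + 1))).
  have n1 : tensor_sum (pd (i + 1) (reg n (u' (i + 2)))) by apply: tensor_sum_pd; exact: tensor_sum_reg.
  have n2 : tensor_sum (pd (i + 2) (reg n (u' (i + 1)))) by apply: tensor_sum_pd; exact: tensor_sum_reg.
  exact: esym (regB n x (tensor_sum_rintegrable n1) (tensor_sum_rintegrable n2)).
have i2 i j (F : space3 R -> R) : tensor_sum F -> rintegrable mu (fun y => u i y * u j y * F y).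
  exact: rintegrable_tensor_sum.
transitivity (\sum_l \sum_j (\int[mu]_y (u (l + 1) y * u j y * pd j (pd (l + 2) (V l)) y) -
          \int[mu]_y (u (l + 2) y * u j y * pd j (pd (l + 1) (V l)) y))).
  apply: eq_bigr => l _; rewrite /vorticity_flux.
  under eq_bigr do rewrite mulr_suml.
  rewrite exchange_big; apply: eq_bigr => j _ /=.
  pose I1 (k : idx n) := \int[mu]_y (u (l + 1) y * u j y * pd j (pd (l + 2) (bas k)) y).
  pose I2 (k : idx n) := \int[mu]_y (u (l + 2) y * u j y * pd j (pd (l + 1) (bas k)) y).
  transitivity (\sum_(k : idx n) (coef (reg n (u' l)) k * I1 k - coef (reg n (u' l)) k * I2 k)).
    by apply: eq_bigr => k _; rewrite -mulrBr; exact: mulrC.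
  rewrite sumrB; congr (_ - _).
    rewrite (@sum_coef_Int n _ (fun y => u (l + 1) y * u j y) (fun F => pd j (pd (l + 2) F)))//.
    - by move=> k; do 2 apply: tensor_sum_pd; exact: tensor_sum_bas.
    - by move=> x; exact: pd2_reg.
  rewrite (@sum_coef_Int n _ (fun y => u (l + 2) y * u j y) (fun F => pd j (pd (l + 1) F)))//.
  - by move=> k; do 2 apply: tensor_sum_pd; exact: tensor_sum_bas.
  - by move=> x; exact: pd2_reg.
transitivity (\sum_i \sum_j \int[mu]_y (u i y * u j y * pd j (curl V i) y)).
  have n2 i j l : tensor_sum (pd j (pd i (V l))) by do 2 apply: tensor_sum_pd.
  transitivity (\int[mu]_y (\sum_l \sum_j (u (l + 1) y * u j y * pd j (pd (l + 2) (V l)) y -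
       u (l + 2) y * u j y * pd j (pd (l + 1) (V l)) y))).
    rewrite (@Int_sum _ _ _ prb); last first.
      move=> l; apply: (@rintegrable_sum _ _ _ prb) => j.
      by apply: (@rintegrableB _ _ _ prb); apply: i2.
    apply: eq_bigr => l _; rewrite (@Int_sum _ _ _ prb); last first.
      by move=> j; apply: (@rintegrableB _ _ _ prb); apply: i2.
    by apply: eq_bigr => j _; rewrite (@IntB _ _ _ prb)//; apply: i2.
  transitivity (\int[mu]_y (\sum_i \sum_j (u i y * u j y * pd j (curl V i) y))).
    apply: eq_Rintegral => y _.
    rewrite (curl_flux_reindex (fun i j => u i y * u j y) (fun j i l => pd j (pd i (V l)) y)).
    by apply: eq_bigr => i _; apply: eq_bigr => j _; rewrite pd_curl.
  have nc i j : tensor_sum (pd j (curl V i)) by apply: tensor_sum_pd; exact: tensor_sum_curl.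
  rewrite (@Int_sum _ _ _ prb); last first.
    by move=> l; apply: (@rintegrable_sum _ _ _ prb) => j; apply: i2.
  by apply: eq_bigr => l _; rewrite (@Int_sum _ _ _ prb)// => j; apply: i2.
rewrite /helicity_flux (@Int_sum _ _ _ prb); last first.
  move=> i; apply: tensor_sum_rintegrable; apply: tensor_sum_sum => j.
  exact: tensor_sum_mul (tensor_sum_reg _ _) (tensor_sum_pd j (nrw i)).
apply: eq_bigr => i _; rewrite (@Int_sum _ _ _ prb); last first.
  by move=> j; apply: tensor_sum_rintegrable; exact: tensor_sum_mul (tensor_sum_reg _ _) (tensor_sum_pd j (nrw i)).
apply: eq_bigr => j _; rewrite EV (reg_pd j n (nrw i)).
have np := tensor_sum_rintegrable (tensor_sum_pd j (nrw i)).
apply: etrans (reg_selfadj n np (iuu i j)) _.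
by apply: eq_Rintegral => x _; exact: mulrC.
Qed.

Definition reg_helicity n u w : R := \int[mu]_x (\sum_i reg n (u i) x * reg n (w i) x).

Lemma reg_helicity_coef n u w : reg_helicity n u w = \sum_l \sum_(k : idx n) coef (w l) k * coef (reg n (u l)) k.
Proof.
rewrite /reg_helicity (@Int_sum _ _ _ prb); last first.
  by move=> i; apply: tensor_sum_rintegrable; exact: tensor_sum_mul (tensor_sum_reg _ _) (tensor_sum_reg _ _).
by apply: eq_bigr => l _; rewrite Int_reg_mul//; exact: tensor_sum_rintegrable (tensor_sum_reg _ _).
Qed.

(** Self-adjointness of the curl makes the regularized helicity a symmetric
    bilinear form. *)
Lemma reg_helicity_sym n u w u' w' : slice_integrable u w -> slice_integrable u' w' ->
  curl_div n u w -> curl_div n u' w' -> reg_helicity n u w' = reg_helicity n u' w.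
Proof.
move=> si si' cd cd'; rewrite /reg_helicity.
transitivity (\int[mu]_x (\sum_i reg n (u i) x * curl (fun j => reg n (u' j)) i x)).
  by apply: eq_Rintegral => x _; apply: eq_bigr => i _; rewrite (reg_curl si' cd').
rewrite curl_selfadj; [|by move=> i; exact: tensor_sum_reg|by move=> i; exact: tensor_sum_reg].
by apply: eq_Rintegral => x _; apply: eq_bigr => i _; rewrite (reg_curl si cd).
Qed.

(** A symmetric form takes the difference of two vectors, paired with their
    sum, to the difference of its two values; hence only the increment of the
    vorticity is needed. *)
Lemma reg_helicityB n u w u' w' : slice_integrable u w -> slice_integrable u' w' ->
  curl_div n u w -> curl_div n u' w' -> reg_helicity n u' w' - reg_helicity n u w =
  \sum_l \sum_(k : idx n) (coef (reg n (u' l)) k + coef (reg n (u l)) k) * coef (w' l) k -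
  \sum_l \sum_(k : idx n) (coef (reg n (u' l)) k + coef (reg n (u l)) k) * coef (w l) k.
Proof.
move=> si si' cd cd'; have := reg_helicity_sym si si' cd cd'; rewrite !reg_helicity_coef => E.
have split2 z : \sum_l \sum_(k : idx n) (coef (reg n (u' l)) k + coef (reg n (u l)) k) * coef (z l) k =
   \sum_l \sum_(k : idx n) coef (z l) k * coef (reg n (u' l)) k +
   \sum_l \sum_(k : idx n) coef (z l) k * coef (reg n (u l)) k.
  rewrite -big_split; apply: eq_bigr => l _; rewrite -big_split; apply: eq_bigr => k _ /=.
  by rewrite mulrDl; congr (_ + _); exact: mulrC.
exact: sub_cross (split2 w') (split2 w) E.
Qed.

Lemma norm_Int_tensor_sum_le f F (B : R) : rintegrable mu f -> tensor_sum F -> (forall x, `|F x| <= B) ->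
  `|\int[mu]_x (f x * F x)| <= B * \int[mu]_x `|f x|.
Proof.
move=> sf nF FB; apply: (le_trans (@norm_Int _ _ _ prb _ (rintegrable_tensor_sum sf nF))).
rewrite -(@IntZ _ _ _ prb); last exact: integrable_norm.
apply: (@Int_le _ _ _ prb).
- by apply: (@integrable_norm _ _ _ prb); exact: rintegrable_tensor_sum.
- by apply: (@rintegrableZ _ _ _ prb); exact: integrable_norm.
- by move=> x; rewrite normrM mulrC ler_wpM2r.
Qed.

Lemma helicity_fluxB n u w w' : (forall i, rintegrable mu (w i)) -> (forall i, rintegrable mu (w' i)) ->
  (forall i j, rintegrable mu (fun x => u i x * u j x)) ->
  helicity_flux n u w' - helicity_flux n u w =
  \sum_i \sum_(k : idx n) (coef (w' i) k - coef (w i) k) *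
    \sum_j \int[mu]_y (u i y * u j y * reg n (pd j (bas k)) y).
Proof.
move=> iw iw' iuu.
have E z : helicity_flux n u z = \sum_i \sum_(k : idx n) coef (z i) k *
    \sum_j \int[mu]_y (u i y * u j y * reg n (pd j (bas k)) y).
  rewrite /helicity_flux (@Int_sum _ _ _ prb); last first.
    move=> i; apply: tensor_sum_rintegrable; apply: tensor_sum_sum => j.
    exact: tensor_sum_mul (tensor_sum_reg _ _) (tensor_sum_pd j (tensor_sum_reg _ _)).
  apply: eq_bigr => i _; rewrite (@Int_sum _ _ _ prb); last first.
    by move=> j; apply: tensor_sum_rintegrable; exact: tensor_sum_mul (tensor_sum_reg _ _) (tensor_sum_pd j (tensor_sum_reg _ _)).
  under [RHS]eq_bigr do rewrite mulr_sumr.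
  rewrite [RHS]exchange_big; apply: eq_bigr => j _ /=.
  have nb (k : idx n) : tensor_sum (pd j (bas k : space3 R -> R)) := tensor_sum_pd j (tensor_sum_bas k).
  have -> : \int[mu]_x (reg n (fun y => u i y * u j y) x * pd j (reg n (z i)) x) =
     \int[mu]_x (reg n (fun y => u i y * u j y) x * \sum_(k : idx n) coef (z i) k * pd j (bas k) x).
    apply: eq_Rintegral => x _; congr (_ * _).
    rewrite /reg pd_sum; last by move=> k; apply: tensor_sum_scale; exact: tensor_sum_bas.
    by apply: eq_bigr => k _; rewrite pdZ//; exact: tensor_sum_bas.
  rewrite -(sum_Int_bas _ (tensor_sum_rintegrable (tensor_sum_reg _ _)) nb).
  apply: eq_bigr => k _; congr (_ * _).
  rewrite reg_selfadj//; last exact: tensor_sum_rintegrable.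
  by apply: eq_Rintegral => x _; rewrite mulrC.
rewrite !E -sumrB; apply: eq_bigr => i _; rewrite -sumrB; apply: eq_bigr => k _.
by rewrite mulrBl.
Qed.

Lemma tensor_sum_family_bounded (I : finType) (F : I -> space3 R -> R) : (forall a, tensor_sum (F a)) ->
  exists2 B : R, 0 <= B & forall a x, `|F a x| <= B.
Proof.
move=> nF.
have /choice[b hb] : forall a, exists B : R, 0 <= B /\ forall x, `|F a x| <= B.
  by move=> a; have [B B0 hB] := tensor_sum_bounded (nF a); exists B.
exists (\sum_a b a) => [|a x]; first by apply: sumr_ge0 => a _; case: (hb a).
apply: (le_trans (proj2 (hb a) x)); rewrite (bigD1 a)//= lerDl.
by apply: sumr_ge0 => a' _; case: (hb a').
Qed.

Lemma vorticity_flux_bounded n : exists2 B : R, 0 <= B & forall u (m2 : R) l (k : idx n),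
  (forall i j, rintegrable mu (fun x => u i x * u j x)) ->
  (forall i j, \int[mu]_x `|u i x * u j x| <= m2) -> `|vorticity_flux u l k| <= B * m2.
Proof.
have [B B0 hB] := @tensor_sum_family_bounded ('I_3 * 'I_3 * idx n)%type
  (fun a => pd a.1.1 (pd a.1.2 (bas a.2))) (fun a => tensor_sum_pd _ (tensor_sum_pd _ (tensor_sum_bas _))).
exists (3 * (B + B)) => [|u m2 l k iuu hm]; first by rewrite mulr_ge0// addr_ge0.
have h i j i' : `|\int[mu]_y (u i y * u j y * pd j (pd i' (bas k)) y)| <= B * m2.
  apply: le_trans (norm_Int_tensor_sum_le (iuu i j) (tensor_sum_pd j (tensor_sum_pd i' (tensor_sum_bas k))) (hB (j, i', k))) _.
  exact: ler_wpM2l.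
apply: (le_trans (ler_norm_sum _ _ _)).
apply: (@le_trans _ _ (\sum_(j < 3) (B + B) * m2)).
  by apply: ler_sum => j _; rewrite mulrDl; apply: (le_trans (ler_normB _ _)); apply: lerD.
by rewrite sum_cst_I3 mulrA.
Qed.

(** The constant depends on [n], but it only enters the part of the increment
    that is quadratic in time, which [linear_of_quadratic] removes. *)
Lemma helicity_flux_lipschitz n : exists2 B : R, 0 <= B & forall u w w' (m2 : R),
  (forall i, rintegrable mu (w i)) -> (forall i, rintegrable mu (w' i)) ->
  (forall i j, rintegrable mu (fun x => u i x * u j x)) ->
  (forall i j, \int[mu]_x `|u i x * u j x| <= m2) ->
  `|helicity_flux n u w' - helicity_flux n u w| <= B * m2 * \sum_i \sum_(k : idx n) `|coef (w' i) k - coef (w i) k|.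
Proof.
have [B B0 hB] := @tensor_sum_family_bounded ('I_3 * idx n)%type
  (fun a => reg n (pd a.1 (bas a.2))) (fun a => tensor_sum_reg _ _).
exists (3 * B) => [|u w w' m2 iw iw' iuu hm]; first by rewrite mulr_ge0.
have h i j (k : idx n) : `|\int[mu]_y (u i y * u j y * reg n (pd j (bas k)) y)| <= B * m2.
  apply: le_trans (norm_Int_tensor_sum_le (iuu i j) (tensor_sum_reg n (pd j (bas k))) (hB (j, k))) _.
  exact: ler_wpM2l.
rewrite helicity_fluxB// mulr_sumr; apply: (le_trans (ler_norm_sum _ _ _)); apply: ler_sum => i _.
rewrite mulr_sumr; apply: (le_trans (ler_norm_sum _ _ _)); apply: ler_sum => k _.
rewrite normrM mulrC ler_wpM2r//; apply: (le_trans (ler_norm_sum _ _ _)).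
apply: (@le_trans _ _ (\sum_(j < 3) B * m2)); first by apply: ler_sum => j _; exact: h.
by rewrite sum_cst_I3 mulrA.
Qed.

(** The kernel of index 0 is constant, so every regularized field is constant
    and its curl vanishes. *)
Lemma reg_helicity0 u w : slice_integrable u w -> curl_div 0 u w -> reg_helicity 0 u w = 0.
Proof.
move=> si cd; have [iu _ _ _] := si.
have pd0 i j x : pd j (reg 0 (u i)) x = 0.
  rewrite pd_reg//; have E y : dKer j 0 x y * u i y = 0.
    rewrite /dKer (bigD1 j)//= eqxx (_ : derive1 (@ker1 R 0) = fun=> 0) ?mul0r//.
    rewrite -(derive1_cst_fun (@wallis R 0)^-1); congr derive1; apply/funext => s.
    by rewrite /ker1 expr0 mul1r.
  by under eq_Rintegral do rewrite E; rewrite (@Int_cst _ _ _ prb).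
have w0 i x : reg 0 (w i) x = 0 by rewrite (reg_curl si cd) /curl !pd0 subr0.
rewrite /reg_helicity; under eq_Rintegral => x _.
  under eq_bigr do rewrite w0 mulr0.
  rewrite big1//; over.
by rewrite (@Int_cst _ _ _ prb).
Qed.

End HelicityFlux.

(** * Chordal distance and torus distance *)

Section ChordalDistance.
Variable R : realType.
Implicit Types (x y : space3 R) (s : R) (k : int * int * int) (i : 'I_3).

Lemma sin_mean_value s : 0 <= s -> exists2 c, 0 <= c <= s & sin s = cos c * s.
Proof.
move=> s0; have [c hc] := @MVT_segment R sin cos 0 s s0 (fun t _ => is_derive_sin t)
  (continuous_subspaceT (@continuous_sin R)).
rewrite sin0 !subr0 => E; exists c => //.
Qed.

Lemma norm_sin_le s : `|sin s| <= `|s|.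
Proof.
have h (t : R) : 0 <= t -> `|sin t| <= `|t|.
  move=> t0; have [c _ ->] := sin_mean_value t0.
  by rewrite normrM ler_piMl// cos_max.
have [s0|s0] := leP 0 s; first exact: h.
by have := h (- s); rewrite sinN !normrN; apply; rewrite oppr_ge0 ltW.
Qed.

(** Jordan's inequality by the half angle: [sin (2 y) = 2 cos y sin y] with
    [y <= pi / 4], where [2 cos^2 y >= 1]. *)
Lemma jordan_sin s : `|s| <= 2^-1 -> s ^+ 2 <= sin (pi * s) ^+ 2.
Proof.
have p2 := pi_ge2 R.
have h (t : R) : 0 <= t <= 2^-1 -> t ^+ 2 <= sin (pi * t) ^+ 2.
  move=> /andP[t0 t2]; set y := pi * t / 2.
  have y0 : 0 <= y by rewrite /y; have := mulr_ge0 (pi_ge0 R) t0; lra.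
  have [c /andP[c0 cy] Es] := sin_mean_value y0.
  have yp : 2 * y <= pi / 2 by rewrite /y; have := ler_wpM2l (pi_ge0 R) t2; lra.
  have cc : cos y <= cos c.
    move: cy; rewrite le_eqVlt => /orP[/eqP->//|cy].
    by apply: ltW; rewrite ltr_cos// in_itv /= ?c0 ?y0/=; lra.
  have cy0 : 0 <= cos y by apply: cos_ge0_pihalf; lra.
  have cy2 : 1 <= 2 * cos y ^+ 2.
    have : 0 <= cos (y *+ 2) by apply: cos_ge0_pihalf; rewrite -mulr_natl; lra.
    by rewrite cos_mulr2n -mulr_natl; lra.
  have E : sin (pi * t) = 2 * cos y * (cos c * y).
    have -> : pi * t = y *+ 2 by rewrite -mulr_natl /y; lra.
    by rewrite sin_mulr2n -mulr_natl Es mulrA.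
  have ty : t <= y by rewrite /y; have := ler_wpM2r t0 p2; lra.
  have le1 : t <= sin (pi * t).
    rewrite E; apply: (le_trans ty).
    have -> : 2 * cos y * (cos c * y) = (2 * (cos y * cos c)) * y by ring.
    rewrite ler_peMl// (le_trans cy2)// ler_wpM2l// expr2 ler_wpM2l//.
  by rewrite ler_sqr ?nnegrE// (le_trans t0).
move=> hs; have [s0|s0] := leP 0 s.
  by apply: h; rewrite s0 -(ger0_norm s0).
have := h (- s); rewrite mulrN sinN !sqrrN; apply.
by rewrite oppr_ge0 (ltW s0) /= -(ler0_norm (ltW s0)).
Qed.

Definition zcoord k i : int :=
  if i == 0 :> nat then k.1.1 else if i == 1%N :> nat then k.1.2 else k.2.

Lemma xcoord_shift x y k i :
  xcoord (x - y + lattice R k) i = xcoord x i - xcoord y i + (zcoord k i)%:~R.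
Proof. by case: i => [[|[|[|//]]] ?]; rewrite /xcoord /zcoord /=. Qed.

Lemma space_normE x : space_norm x = Num.sqrt (\sum_i xcoord x i ^+ 2).
Proof. by rewrite sum_I3 /space_norm /xcoord /=. Qed.

Lemma sin2_pi_int s (z : int) : sin (pi * (s + z%:~R)) ^+ 2 = sin (pi * s) ^+ 2 :> R.
Proof.
have [_ h] := @per1_cosX_sinX R 0 2 isT.
by have := per1_int h z s; rewrite /= !mul1r.
Qed.

Lemma rho2_shift x y k : rho2 x y = \sum_i sin (pi * xcoord (x - y + lattice R k) i) ^+ 2.
Proof. by apply: eq_bigr => i _; rewrite xcoord_shift sin2_pi_int. Qed.

Lemma rho_le_norm x y k : rho x y <= pi * space_norm (x - y + lattice R k).
Proof.
rewrite /rho (rho2_shift x y k) space_normE -[pi in leRHS]ger0_norm ?pi_ge0//.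
rewrite -sqrtr_sqr -sqrtrM ?sqr_ge0// ler_sqrt; last first.
  by rewrite mulr_ge0 ?sqr_ge0//; apply: sumr_ge0 => i _; exact: sqr_ge0.
rewrite mulr_sumr; apply: ler_sum => i _; rewrite -exprMn.
by rewrite -(real_normK (num_real (sin _))) -[leRHS](real_normK (num_real (pi * _))) lerXn2r ?nnegrE// norm_sin_le.
Qed.

Lemma torus_dist_le x y k : torus_dist x y <= space_norm (x - y + lattice R k).
Proof. by apply: ge_inf; [exists 0 => _ [l _ <-]; exact: sqrtr_ge0|exists k]. Qed.

Lemma rho_le_torus_dist x y : rho x y <= pi * torus_dist x y.
Proof.
rewrite -ler_pdivrMl ?pi_gt0//; apply: lb_le_inf; first by exists (space_norm (x - y + lattice R 0)), 0.
by move=> _ [k _ <-]; rewrite ler_pdivrMl ?pi_gt0// rho_le_norm.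
Qed.

Lemma nearest_lattice x y : exists k, forall i, `|xcoord (x - y + lattice R k) i| <= 2^-1.
Proof.
pose f (s : R) : int := - Num.floor (s + 2^-1).
exists (f (x.1.1 - y.1.1), f (x.1.2 - y.1.2), f (x.2 - y.2)) => i; rewrite xcoord_shift.
have -> : zcoord (f (x.1.1 - y.1.1), f (x.1.2 - y.1.2), f (x.2 - y.2)) i = f (xcoord x i - xcoord y i).
  by rewrite /zcoord /xcoord; case: ifP => _ //; case: ifP.
set s := _ - _; rewrite /f rmorphN /=.
have h1 := floor_le_tmp (s + 2^-1); have h2 := floorD1_gt (s + 2^-1).
by rewrite ler_norml; rewrite rmorphD /= in h2; apply/andP; split; lra.
Qed.

Lemma torus_dist_le_rho x y : torus_dist x y <= rho x y.
Proof.
have [k hk] := nearest_lattice x y; apply: (le_trans (torus_dist_le x y k)).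
rewrite /rho (rho2_shift x y k) space_normE ler_wsqrtr//.
by apply: ler_sum => i _; exact: jordan_sin.
Qed.

Lemma torus_dist_ge0 x y : 0 <= torus_dist x y.
Proof. by rewrite -(pmulr_rge0 _ (pi_gt0 R)) (le_trans (rho_ge0 x y))// rho_le_torus_dist. Qed.

Lemma torus_dist_gt0 x y : 0 < rho x y -> 0 < torus_dist x y.
Proof. by move=> r0; rewrite -(pmulr_rgt0 _ (pi_gt0 R)) (lt_le_trans r0)// rho_le_torus_dist. Qed.

(** On the diagonal of the torus a difference quotient is 0 / 0; periodicity
    gives the vanishing of the increment. *)
Lemma rho_eq0_periodic (T : Type) (f : space3 R -> T) x y : torus_periodic f ->
  rho x y = 0 -> f x = f y.
Proof.
move=> pf r0; have [k hk] := nearest_lattice x y.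
have s0 i : xcoord (x - y + lattice R k) i = 0.
  apply/eqP; rewrite -sqrf_eq0 eq_le sqr_ge0 andbT.
  have /eqP := r0; rewrite /rho sqrtr_eq0 (rho2_shift x y k) => h.
  apply: (le_trans (jordan_sin (hk i))).
  apply: le_trans h; rewrite (bigD1 i)//= lerDl.
  by apply: sumr_ge0 => j _; exact: sqr_ge0.
have E : x + lattice R k = y.
  have z : x - y + lattice R k = 0.
    move: s0; case: (x - y + lattice R k) => -[a b] c s0.
    by have := (s0 0, s0 1, s0 2); rewrite /xcoord /= => -[[-> ->] ->].
  by apply/eqP; rewrite -subr_eq0 addrAC z.
by rewrite -E pf.
Qed.

End ChordalDistance.

(** * Young-type bounds for difference quotients *)

Section NonmeasurableComparison.
Context d (T : measurableType d) (R : realType) (mu : probability T R).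

(** The integral of a nonnegative function is a supremum over the simple
    functions below it, hence monotone for arbitrary integrands. It is applied
    to integrands in [torus_dist], an infimum over the lattice. *)
Lemma ge0_le_integral_nonmeas (f g : T -> \bar R) : (forall x, 0 <= f x)%E ->
  (forall x, f x <= g x)%E -> (\int[mu]_x f x <= \int[mu]_x g x)%E.
Proof.
move=> f0 fg; have g0 x : (0 <= g x)%E by exact: le_trans (fg x).
rewrite !ge0_integralTE//; apply: ereal_sup_le => _ [h /= hf <-].
by exists h => // x; exact: le_trans (hf x) (fg x).
Qed.

Lemma rintegrable_le_ae (f g : T -> R) : measurable_fun [set: T] f ->
  {ae mu, forall x, `|f x| <= g x} -> rintegrable mu g -> rintegrable mu f.
Proof.
move=> mf fg ig; apply/integrableP; split; first exact/measurable_EFinP.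
have mg := rintegrable_measurable ig.
apply: (@le_lt_trans _ _ (\int[mu]_x (`|g x|%:E))%E); last by have /integrableP[] := ig.
apply: ae_ge0_le_integral => //.
- by apply/measurable_EFinP; exact: measurableT_comp.
- by apply/measurable_EFinP; exact: measurableT_comp.
apply: (@filterS _ _ (ae_filter_ringOfSetsType mu) _ _ _ fg) => x h _ /=.
by rewrite lee_fin (le_trans h)// ler_norm.
Qed.

Lemma rintegrable_ge0 (g : T -> R) (M : R) : measurable_fun [set: T] g -> (forall x, 0 <= g x) ->
  (\int[mu]_x (g x)%:E <= M%:E)%E -> rintegrable mu g /\ \int[mu]_x g x <= M.
Proof.
move=> mg g0 hM; have ig : rintegrable mu g.
  apply/integrableP; split; first exact/measurable_EFinP.
  apply: le_lt_trans (ltry M); apply: le_trans hM.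
  by under eq_integral do rewrite /= ger0_norm//.
by split=> //; rewrite -lee_fin EFin_Int.
Qed.

End NonmeasurableComparison.

Section SobolevClass.
Variable R : realType.
Local Notation mu := (torus_measure R).
Local Notation prb := (mu : probability (mspace3 R) R).
Implicit Types (f : space3 R -> 'rV[R]_3) (x y : space3 R) (theta m M N s : R) (Phi Psi : R -> R) (A B : R -> Prop).

Definition diff_quot theta f x y : R := euclid (f x - f y) / rho x y `^ theta.

(** A common form for all exponents. For a finite exponent, [Phi] is the power
    and [A] is trivial; for an infinite one, [Phi] is zero and [A] is a
    uniform bound. *)
Definition sobolev_class theta M Phi A f :=
  [/\ (\int[mu]_x (Phi (euclid (f x)))%:E <= M%:E)%E,
      (\int[mu]_x \int[mu]_y (Phi (diff_quot theta f x y) / rho x y ^+ 3)%:E <= M%:E)%E &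
      exists2 E : set (mspace3 R), {ae mu, forall x, E x} &
        forall x y, E x -> E y -> A (euclid (f x)) /\ A (diff_quot theta f x y)].

Lemma euclid_ge0 (v : 'rV[R]_3) : 0 <= euclid v. Proof. exact: sqrtr_ge0. Qed.

Lemma diff_quot_ge0 theta f x y : 0 <= diff_quot theta f x y.
Proof. by rewrite divr_ge0 ?euclid_ge0 ?powR_ge0. Qed.

Lemma poweR_inv_le (I : \bar R) m N : 0 < m -> 0 <= N -> (0 <= I)%E ->
  (I `^ m^-1 <= N%:E)%E -> (I <= (N `^ m)%:E)%E.
Proof.
move=> m0 N0 I0 h; rewrite -[I](@poweRe1 R)// -(mulVf (lt0r_neq0 m0)) poweRrM -poweR_EFin.
by apply: gt0_ler_poweR h; rewrite ?(ltW m0) ?in_itv /= ?poweR_ge0 ?lee_fin ?N0 ?leey.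
Qed.

Lemma sobolev_class_fin theta m N f : 0 < theta -> 1 <= m -> 0 <= N ->
  (sobolev_norm theta m%:E f <= N%:E)%E ->
  sobolev_class theta (N `^ m) (fun s => s `^ m) (fun _ => True) f.
Proof.
move=> th0 m1 N0; have m0 : 0 < m by exact: lt_le_trans m1.
rewrite /sobolev_norm => hN.
have g0 : (0 <= gagliardo theta m f)%E by exact: poweR_ge0.
have hL : (Lnorm (torus_measure R) m%:E (fun x => (euclid (f x))%:E) <= N%:E)%E.
  by apply: le_trans hN; rewrite leeDl.
have hG : (gagliardo theta m f <= N%:E)%E by apply: le_trans hN; rewrite leeDr// Lnorm_ge0.
split; last by exists setT => //; apply: (@filterE _ _ (ae_filter_ringOfSetsType mu)).
- have := poweR_inv_le m0 N0 _ _; move: hL; rewrite unlock /Lnorm => hL /(_ _ _ hL).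
  move=> H; apply: le_trans (H _ ); last by apply: integral_ge0 => x _; rewrite poweR_ge0.
  apply: ge0_le_integral_nonmeas => x; first by rewrite lee_fin powR_ge0.
  by rewrite /= ger0_norm ?euclid_ge0// poweR_EFin.
- apply: le_trans (poweR_inv_le m0 N0 _ hG); last first.
    by apply: integral_ge0 => x _; apply: integral_ge0 => y _; rewrite lee_fin divr_ge0 ?powR_ge0.
  apply: ge0_le_integral_nonmeas => x.
    by apply: integral_ge0 => y _; rewrite lee_fin divr_ge0 ?powR_ge0// exprn_ge0// rho_ge0.
  apply: ge0_le_integral_nonmeas => y.
    by rewrite lee_fin divr_ge0 ?powR_ge0// exprn_ge0// rho_ge0.
  rewrite lee_fin; have := rho_ge0 x y; rewrite le_eqVlt => /orP[/eqP r0|r0].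
    by rewrite -r0 expr0n /= invr0 mulr0 divr_ge0 ?powR_ge0.
  have t0 := torus_dist_gt0 r0.
  rewrite /diff_quot powRM ?euclid_ge0 ?invr_ge0 ?powR_ge0// -powR_inv1 ?powR_ge0// -!powRrM.
  rewrite -mulrA ler_wpM2l ?powR_ge0//.
  have -> : rho x y `^ (theta * (-1 * m)) / rho x y ^+ 3 = (rho x y `^ (theta * m + 3))^-1.
    rewrite powRD; last by rewrite (gt_eqF r0) implybT.
    by rewrite (powR_mulrn 3 (ltW r0)) [RHS]invfM mulN1r mulrN powRN.
  rewrite lef_pV2 ?posrE ?powR_gt0//.
  apply: ge0_ler_powR; rewrite ?nnegrE ?(ltW t0) ?(ltW r0) ?torus_dist_le_rho//.
  by apply: ltW; rewrite addr_gt0// mulr_gt0.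
Qed.

(** The infimum over Hoelder representatives need not be attained; the margin
    1 yields one below [N + 1]. *)
Lemma sobolev_class_inf theta N f : 0 < theta -> 0 <= N ->
  (sobolev_norm theta +oo%E f <= N%:E)%E ->
  sobolev_class theta 0 (fun _ => 0) (fun s => s <= N + 1) f.
Proof.
move=> th0 N0 hN.
have : (sobolev_norm theta +oo%E f < (N + 1)%:E)%E.
  by apply: le_lt_trans hN _; rewrite lte_fin ltrDl.
move=> /ereal_inf_lt[_ [g [pg ae_g] <-]] hg; split.
- by rewrite integral0.
- by under eq_integral do under eq_integral do rewrite mul0r; rewrite integral0_eq// => x _; rewrite integral0.
pose S1 := ereal_sup (range (fun x => (euclid (g x))%:E)).
pose S2 := ereal_sup (range (fun xy : space3 R * space3 R =>
     (euclid (g xy.1 - g xy.2) / torus_dist xy.1 xy.2 `^ theta)%:E)).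
have h1 x : ((euclid (g x))%:E <= S1)%E by apply: ereal_sup_ubound; exists x.
have h2 x y : ((euclid (g x - g y) / torus_dist x y `^ theta)%:E <= S2)%E.
  by apply: ereal_sup_ubound; exists (x, y).
have s1 : (0 <= S1)%E by apply: le_trans (h1 0); rewrite lee_fin euclid_ge0.
have s2 : (0 <= S2)%E by apply: le_trans (h2 0 0); rewrite lee_fin divr_ge0 ?euclid_ge0 ?powR_ge0.
have hs : (S1 + S2 < (N + 1)%:E)%E by exact: hg.
exists [set x | g x = f x] => // x y /= ex ey; split.
  rewrite -ex -lee_fin; apply: le_trans (h1 x) _; apply: le_trans _ (ltW hs).
  by rewrite leeDl.
rewrite /diff_quot -ex -ey; have := rho_ge0 x y; rewrite le_eqVlt => /orP[/eqP r0|r0].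
  by rewrite -r0 powR0 ?gt_eqF// invr0 mulr0 addr_ge0.
apply: (@le_trans _ _ (euclid (g x - g y) / torus_dist x y `^ theta)).
  rewrite ler_wpM2l ?euclid_ge0// lef_pV2 ?posrE ?powR_gt0 ?torus_dist_gt0//.
  by apply: ge0_ler_powR; rewrite ?nnegrE ?torus_dist_ge0 ?(ltW th0) ?(ltW r0)// torus_dist_le_rho.
by rewrite -lee_fin; apply: le_trans (h2 x y) _; apply: le_trans _ (ltW hs); rewrite leeDr.
Qed.

End SobolevClass.

Lemma mulr_regroup (R : comPzRingType) (a b U W : R) :
  (a * U) * (a * U) * (b * W) = a * a * b * (U ^+ 2 * W).
Proof. ring. Qed.

Section YoungSlices.
Variable R : realType.
Local Notation mu := (torus_measure R).
Local Notation prb := (mu : probability (mspace3 R) R).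
Implicit Types (f : space3 R -> 'rV[R]_3) (x y : space3 R) (i j : 'I_3).

(** The first product is the one of the flux, the second one that of the
    regularization error; the last two bounds give integrability of a
    slice. *)
Definition young (c kappa : R) (Phi Psi : R -> R) (A B : R -> Prop) :=
  forall U W, 0 <= U -> 0 <= W -> A U -> B W ->
  [/\ U ^+ 2 * W <= c + kappa * (Phi U + Psi W), U * W <= c + kappa * (Phi U + Psi W),
      U ^+ 2 <= c + kappa * Phi U & W <= c + kappa * Psi W].

Definition vcomp f i : space3 R -> R := fun x => f x ord0 i.

Lemma norm_vcomp_le f i x : `|vcomp f i x| <= euclid (f x).
Proof.
rewrite /euclid -sqrtr_sqr ler_wsqrtr// /dotv (bigD1 i)//= expr2 lerDl.
by apply: sumr_ge0 => j _; rewrite -expr2 sqr_ge0.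
Qed.

Lemma norm_vcomp_sub_le f i x y : `|vcomp f i y - vcomp f i x| <= euclid (f x - f y).
Proof.
have := norm_vcomp_le (fun z => f x - f y) i x.
by rewrite /vcomp !mxE distrC.
Qed.

Lemma measurable_sqrtr d (T : measurableType d) (h : T -> R) : measurable_fun [set: T] h ->
  (forall z, 0 <= h z) -> measurable_fun [set: T] (fun z => Num.sqrt (h z)).
Proof.
move=> mh h0; have -> : (fun z => Num.sqrt (h z)) = (fun z => h z `^ 2^-1).
  by apply/funext => z; rewrite powR12_sqrt.
exact: (measurableT_comp (measurable_powR _)).
Qed.

Lemma measurable_euclid d (T : measurableType d) (F : T -> 'rV[R]_3) :
  (forall i, measurable_fun [set: T] (fun z => F z ord0 i)) ->
  measurable_fun [set: T] (fun z => euclid (F z)).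
Proof.
move=> mF; apply: measurable_sqrtr => [|z]; last by apply: sumr_ge0 => i _; rewrite -expr2 sqr_ge0.
by apply: measurable_sum => i; exact: measurable_funM.
Qed.

Lemma measurable_xcoord i : measurable_fun [set: mspace3 R] (fun x => xcoord x i).
Proof.
case: i => [[|[|[|//]]] ?].
- exact: (measurableT_comp measurable_fst measurable_fst).
- exact: (measurableT_comp measurable_snd measurable_fst).
- exact: measurable_snd.
Qed.

Lemma measurable_rho2 : measurable_fun [set: mspace3 R * mspace3 R] (fun z => rho z.1 z.2).
Proof.
apply: measurable_sqrtr => [|z]; last exact: rho2_ge0.
apply: measurable_sum => i; apply: measurable_funX.
apply: (measurableT_comp (measurable_realfun.continuous_measurable_fun (@continuous_sin R))).
apply: measurable_funM => //; apply: measurable_funB.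
  exact: (measurableT_comp (measurable_xcoord i) measurable_fst).
exact: (measurableT_comp (measurable_xcoord i) measurable_snd).
Qed.

Lemma measurable_diff_quot theta f : (forall i, measurable_fun [set: mspace3 R] (vcomp f i)) ->
  measurable_fun [set: mspace3 R * mspace3 R] (fun z => diff_quot theta f z.1 z.2).
Proof.
move=> mf; apply: measurable_funM.
  apply: measurable_euclid => i; under eq_fun do rewrite !mxE.
  apply: measurable_funB; first exact: (measurableT_comp (mf i) measurable_fst).
  exact: (measurableT_comp (mf i) measurable_snd).
under eq_fun do rewrite -powRN.
exact: (measurableT_comp (measurable_powR _) measurable_rho2).
Qed.

Lemma vcomp_increment theta f i x y : 0 < theta -> torus_periodic f ->
  `|vcomp f i y - vcomp f i x| <= rho x y `^ theta * diff_quot theta f x y.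
Proof.
move=> th0 pf; have := rho_ge0 x y; rewrite le_eqVlt => /orP[/eqP r0|r0].
  rewrite /vcomp (rho_eq0_periodic pf (esym r0)) subrr normr0.
  by rewrite mulr_ge0 ?powR_ge0 ?diff_quot_ge0.
rewrite /diff_quot mulrCA mulfV ?mulr1; first exact: norm_vcomp_sub_le.
by rewrite gt_eqF// powR_gt0.
Qed.

Variables (theta alpha c kappa M : R) (Phi Psi : R -> R) (A B : R -> Prop) (u w : space3 R -> 'rV[R]_3).
Hypotheses (theta0 : 0 < theta) (alpha0 : 0 < alpha) (c0 : 0 <= c) (kappa0 : 0 <= kappa).
Hypotheses (mPhi : measurable_fun [set: measurableTypeR R] Phi) (mPsi : measurable_fun [set: measurableTypeR R] Psi).
Hypotheses (Phi0 : forall s, 0 <= Phi s) (Psi0 : forall s, 0 <= Psi s).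
Hypotheses (meas_u : forall i, measurable_fun [set: mspace3 R] (vcomp u i)) (mw : forall i, measurable_fun [set: mspace3 R] (vcomp w i)).
Hypotheses (pu : torus_periodic u) (pw : torus_periodic w).
Hypotheses (cu : sobolev_class theta M Phi A u) (cw : sobolev_class alpha M Psi B w).
Hypothesis yg : young c kappa Phi Psi A B.

Let ae_filter := ae_filter_ringOfSetsType mu.

Lemma young_slice_regular : slice_regular theta alpha c (kappa * M) (vcomp u) (vcomp w).
Proof.
have [_ hu [Eu aeu hEu]] := cu; have [_ hw [Ew aew hEw]] := cw.
pose g (P : R -> R) s (f : space3 R -> 'rV[R]_3) (z : mspace3 R * mspace3 R) := kappa * (P (diff_quot s f z.1 z.2) / rho z.1 z.2 ^+ 3).
have mg0 (P : R -> R) (s : R) (f : space3 R -> 'rV[R]_3) : measurable_fun [set: measurableTypeR R] P -> (forall i, measurable_fun [set: mspace3 R] (vcomp f i)) ->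
    measurable_fun [set: mspace3 R * mspace3 R] (fun z => P (diff_quot s f z.1 z.2) / rho z.1 z.2 ^+ 3).
  move=> mP mf; apply: measurable_funM; first exact: (measurableT_comp mP (measurable_diff_quot s mf)).
  under eq_fun => z do rewrite -powR_mulrn ?rho_ge0// -powRN.
  exact: (measurableT_comp (measurable_powR _) measurable_rho2).
have gg (P : R -> R) (s : R) (f : space3 R -> 'rV[R]_3) : (forall r, 0 <= P r) -> forall z, 0 <= g P s f z.
  by move=> P0 z; rewrite mulr_ge0// divr_ge0// exprn_ge0// rho_ge0.
have ig (P : R -> R) (s : R) (f : space3 R -> 'rV[R]_3) : measurable_fun [set: measurableTypeR R] P -> (forall r, 0 <= P r) -> (forall i, measurable_fun [set: mspace3 R] (vcomp f i)) ->
    (\int[mu]_x \int[mu]_y (P (diff_quot s f x y) / rho x y ^+ 3)%:E <= M%:E)%E ->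
    (\int[mu]_x \int[mu]_y (g P s f (x, y))%:E <= (kappa * M)%:E)%E.
  move=> mP P0 mf hM.
  have m0 := (measurable_EFinP _ _).2 (mg0 P s f mP mf).
  have p0 z : (0 <= (P (diff_quot s f z.1 z.2) / rho z.1 z.2 ^+ 3)%:E)%E.
    by rewrite lee_fin divr_ge0// exprn_ge0// rho_ge0.
  rewrite (_ : (\int[mu]_x \int[mu]_y (g P s f (x, y))%:E)%E =
     (kappa%:E * \int[mu]_x \int[mu]_y (P (diff_quot s f x y) / rho x y ^+ 3)%:E)%E).
    by rewrite EFinM; apply: lee_wpmul2l.
  rewrite -ge0_integralZl//.
  - apply: eq_integral => x _; rewrite -ge0_integralZl//.
    + exact: (measurableT_comp m0 (pair1_measurable x)).
    + by move=> y _; exact: (p0 (x, y)).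
  - exact: (@measurable_fun_fubini_tonelli_F _ _ _ _ _ prb _ m0 p0).
  - by move=> x _; apply: integral_ge0 => y _; exact: (p0 (x, y)).
exists (g Phi theta u), (g Psi alpha w); split.
- by split; apply: measurable_funM => //; exact: mg0.
- by split; exact: gg.
- by split; exact: ig.
have aeE : {ae mu, forall y, (Eu `&` Ew) y} := @filterI _ _ ae_filter _ _ aeu aew.
apply: (@filterS _ _ ae_filter _ _ _ aeE) => x [xu xw].
exists (Eu `&` Ew) => // y z [yu yw] [zu zw] i j l.
have du k := vcomp_increment k x y theta0 pu.
have dw k := vcomp_increment k x z alpha0 pw.
have [_ Ay] := hEu x y xu yu; have [_ Bz] := hEw x z xw zw.
have [y1 y2 _ _] := yg (diff_quot_ge0 theta u x y) (diff_quot_ge0 alpha w x z) Ay Bz.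
have cancel (P : R -> R) (s : R) (f : space3 R -> 'rV[R]_3) t : rho x t != 0 ->
    rho x t ^+ 3 * g P s f (x, t) = kappa * P (diff_quot s f x t).
  by move=> r0; rewrite /g /= mulrCA [rho x t ^+ 3 * _]mulrC divfK// expf_neq0.
have G0 : 0 <= c + rho x y ^+ 3 * g Phi theta u (x, y) + rho x z ^+ 3 * g Psi alpha w (x, z).
  by rewrite !addr_ge0// mulr_ge0 ?exprn_ge0 ?rho_ge0 ?gg.
have zero_du k : rho x y = 0 -> `|vcomp u k y - vcomp u k x| = 0.
  move=> r0; apply/eqP; rewrite -normr_le0 normr_id; apply: (le_trans (du k)).
  by rewrite r0 powR0 ?gt_eqF// mul0r.
have zero_dw k : rho x z = 0 -> `|vcomp w k z - vcomp w k x| = 0.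
  move=> r0; apply/eqP; rewrite -normr_le0 normr_id; apply: (le_trans (dw k)).
  by rewrite r0 powR0 ?gt_eqF// mul0r.
have R0 s t : 0 <= rho x y `^ s * rho x z `^ t *
   (c + rho x y ^+ 3 * g Phi theta u (x, y) + rho x z ^+ 3 * g Psi alpha w (x, z)).
  by rewrite mulr_ge0// mulr_ge0 ?powR_ge0.
(* Where [rho] vanishes, so do the increments. *)
have [y0|y0] := eqVneq (rho x y) 0; first by rewrite !zero_du// !mul0r; split; exact: R0.
have [z0|z0] := eqVneq (rho x z) 0; first by rewrite !zero_dw// !mulr0; split; exact: R0.
rewrite !cancel//.
have E : c + kappa * Phi (diff_quot theta u x y) + kappa * Psi (diff_quot alpha w x z) =
  c + kappa * (Phi (diff_quot theta u x y) + Psi (diff_quot alpha w x z)) by rewrite mulrDr addrA.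
rewrite E; split.
  apply: (@le_trans _ _ ((rho x y `^ theta * diff_quot theta u x y) * (rho x y `^ theta * diff_quot theta u x y) *
     (rho x z `^ alpha * diff_quot alpha w x z))).
    by apply: ler_pM (dw l); [exact: mulr_ge0|exact: normr_ge0|apply: ler_pM].
  have -> : rho x y `^ (2 * theta) = rho x y `^ theta * rho x y `^ theta.
    by rewrite -powRD ?y0 ?implybT//; congr (_ `^ _); ring.
  by rewrite mulr_regroup ler_wpM2l// !mulr_ge0 ?powR_ge0.
apply: (@le_trans _ _ ((rho x y `^ theta * diff_quot theta u x y) * (rho x z `^ alpha * diff_quot alpha w x z))).
  by apply: ler_pM.
by rewrite mulrACA ler_wpM2l// mulr_ge0 ?powR_ge0.
Qed.

Let bnd : [/\ rintegrable mu (fun x => c + kappa * Phi (euclid (u x))),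
  \int[mu]_x (c + kappa * Phi (euclid (u x))) <= c + kappa * M,
  rintegrable mu (fun x => c + kappa * Psi (euclid (w x))) &
  rintegrable mu (fun x => c + kappa * (Phi (euclid (u x)) + Psi (euclid (w x))))].
Proof.
have [hu _ _] := cu; have [hw _ _] := cw.
have [iP bP] := @rintegrable_ge0 _ _ _ prb _ _ (measurableT_comp mPhi (measurable_euclid meas_u)) (fun x => Phi0 _) hu.
have [iQ bQ] := @rintegrable_ge0 _ _ _ prb _ _ (measurableT_comp mPsi (measurable_euclid mw)) (fun x => Psi0 _) hw.
have cst b : rintegrable mu (fun _ => b) by exact: (@rintegrable_cst _ _ _ prb).
have iK := @rintegrableZ _ _ _ prb kappa _ iP.
split.
- exact: (@rintegrableD _ _ _ prb _ _ (cst c) iK).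
- rewrite (@IntD _ _ _ prb _ _ (cst c) iK) (@Int_cst _ _ _ prb) (@IntZ _ _ _ prb _ _ iP).
  by rewrite lerD2l ler_wpM2l.
- exact: (@rintegrableD _ _ _ prb _ _ (cst c) (@rintegrableZ _ _ _ prb kappa _ iQ)).
- exact: (@rintegrableD _ _ _ prb _ _ (cst c) (@rintegrableZ _ _ _ prb kappa _ (@rintegrableD _ _ _ prb _ _ iP iQ))).
Qed.

Let pointwise : {ae mu, forall x : mspace3 R,
  [/\ euclid (u x) * euclid (w x) <= c + kappa * (Phi (euclid (u x)) + Psi (euclid (w x))),
      euclid (u x) ^+ 2 <= c + kappa * Phi (euclid (u x)) & euclid (w x) <= c + kappa * Psi (euclid (w x))]}.
Proof.
have [_ _ [Eu aeu hEu]] := cu; have [_ _ [Ew aew hEw]] := cw.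
apply: (@filterS _ _ ae_filter _ _ _ (@filterI _ _ ae_filter _ _ aeu aew)) => x [xu xw].
have [Ax _] := hEu x x xu xu; have [Bx _] := hEw x x xw xw.
by have [_ ? ? ?] := yg (euclid_ge0 (u x)) (euclid_ge0 (w x)) Ax Bx.
Qed.

Let iuu i j : rintegrable mu (fun x => vcomp u i x * vcomp u j x).
Proof.
have [i1 _ _ _] := bnd; apply: (@rintegrable_le_ae _ _ _ prb _ _ _ _ i1); first exact: measurable_funM.
apply: (@filterS _ _ ae_filter _ _ _ pointwise) => x [_ h _].
by apply: le_trans h; rewrite normrM expr2; apply: ler_pM => //; exact: norm_vcomp_le.
Qed.

Lemma young_second_moment i j : \int[mu]_x `|vcomp u i x * vcomp u j x| <= c + kappa * M.
Proof.
have [i1 b1 _ _] := bnd; apply: le_trans b1.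
apply: (@Int_le_ae _ _ _ prb) => //; first by apply: (@integrable_norm _ _ _ prb); exact: iuu.
apply: (@filterS _ _ ae_filter _ _ _ pointwise) => x [_ h _].
by apply: le_trans h; rewrite normrM expr2; apply: ler_pM => //; exact: norm_vcomp_le.
Qed.

Lemma young_first_moment i : \int[mu]_x `|vcomp w i x| <= c + kappa * M.
Proof.
have [_ _ i2 _] := bnd; have [hw _ _] := cw.
have [iQ bQ] := @rintegrable_ge0 _ _ _ prb _ _ (measurableT_comp mPsi (measurable_euclid mw)) (fun x => Psi0 _) hw.
have cst b : rintegrable mu (fun _ => b) by exact: (@rintegrable_cst _ _ _ prb).
have iK := @rintegrableZ _ _ _ prb kappa _ iQ.
apply: (@le_trans _ _ (\int[mu]_x (c + kappa * Psi (euclid (w x))))).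
  have ae : {ae mu, forall x : mspace3 R, `|vcomp w i x| <= c + kappa * Psi (euclid (w x))}.
    apply: (@filterS _ _ ae_filter _ _ _ pointwise) => x [_ _ h].
    by apply: le_trans h; exact: norm_vcomp_le.
  apply: (@Int_le_ae _ _ _ prb) => //.
  by apply: (@integrable_norm _ _ _ prb); exact: (@rintegrable_le_ae _ _ _ prb _ _ (mw i) ae i2).
rewrite (@IntD _ _ _ prb _ _ (cst c) iK) (@Int_cst _ _ _ prb) (@IntZ _ _ _ prb _ _ iQ).
by rewrite lerD2l ler_wpM2l.
Qed.

Lemma young_slice_integrable : slice_integrable (vcomp u) (vcomp w).
Proof.
have [i1 _ i2 i3] := bnd.
have ae := @filterS _ _ ae_filter _ _ _ pointwise; split.
- move=> i; apply: (@rintegrable_le_ae _ _ _ prb _ (fun x => 1 + (c + kappa * Phi (euclid (u x))))) => //.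
    apply: ae => x [_ h _]; apply: (le_trans (norm_vcomp_le u i x)).
    apply: le_trans (lerD (lexx 1) h).
    by have := sqr_ge0 (euclid (u x) - 1); have := euclid_ge0 (u x); rewrite sqrrB expr1n mulr1; lra.
  by apply: (@rintegrableD _ _ _ prb _ _ _ i1); exact: (@rintegrable_cst _ _ _ prb).
- exact: iuu.
- move=> i; apply: (@rintegrable_le_ae _ _ _ prb _ _ _ _ i2) => //.
  by apply: ae => x [_ _ h]; apply: le_trans h; exact: norm_vcomp_le.
- move=> i; apply: (@rintegrable_le_ae _ _ _ prb _ _ _ _ i3); first exact: measurable_funM.
  apply: ae => x [h _ _]; apply: le_trans h.
  by rewrite normrM; apply: ler_pM => //; exact: norm_vcomp_le.
Qed.

End YoungSlices.

(** * Conjugate exponents *)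

Section SobolevSlices.
Variable R : realType.
Local Notation mu := (torus_measure R).
Implicit Types (theta alpha N U W : R) (p q : \bar R).

Lemma le1_powR U (s : R) : 0 <= U -> 1 <= s -> U <= 1 + U `^ s.
Proof.
move=> U0 s1; have [U1|U1] := leP U 1; first by rewrite (le_trans U1)// lerDl powR_ge0.
apply: (@le_trans _ _ (U `^ s)); last by rewrite lerDr.
by rewrite -[leLHS]powRr1// ler_powR// ltW.
Qed.

Lemma le1_sqr U : U <= 1 + U ^+ 2.
Proof. have := sqr_ge0 (U - 1); have := sqr_ge0 U; rewrite sqrrB expr1n mulr1; lra. Qed.

(** Young's inequality for [U^2] and [W] with the exponents [r] and [s]; the
    other bounds follow because a lower power is at most one plus a higher
    one. *)
Lemma young_fin (r s : R) : 1 < r -> 1 < s -> r^-1 + s^-1 = 1 ->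
  young 1 2 (fun U => U `^ (2 * r)) (fun W => W `^ s) (fun _ => True) (fun _ => True).
Proof.
move=> r1 s1 rs U W U0 W0 _ _.
have r0 : 0 < r by exact: lt_trans r1.
have s0 : 0 < s by exact: lt_trans s1.
have E : (U ^+ 2) `^ r = U `^ (2 * r) by rewrite -powR_mulrn// -powRrM.
have y : U ^+ 2 * W <= U `^ (2 * r) + W `^ s.
  have := conjugate_powR (sqr_ge0 U) W0 r0 s0 rs; rewrite E => h; apply: (le_trans h).
  by apply: lerD; rewrite ler_piMr ?powR_ge0// invf_le1// ltW.
have a0 : 0 <= U `^ (2 * r) by exact: powR_ge0.
have b0 : 0 <= W `^ s by exact: powR_ge0.
have w1 := le1_powR W0 (ltW s1).
have u1 := le1_powR (sqr_ge0 U) (ltW r1); rewrite E in u1.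
have uw : U * W <= (1 + U ^+ 2) * W by rewrite ler_wpM2r// le1_sqr.
by split; lra.
Qed.

Lemma young_left N : 0 <= N ->
  young N (N + 1) (fun U => U `^ 2) (fun _ => 0) (fun _ => True) (fun W => W <= N).
Proof.
move=> N0 U W U0 W0 _ WN; rewrite (powR_mulrn 2 U0).
have h1 : U ^+ 2 * W <= U ^+ 2 * N by rewrite ler_wpM2l// sqr_ge0.
have h2 : U * W <= (1 + U ^+ 2) * N by apply: ler_pM => //; exact: le1_sqr.
have h3 := sqr_ge0 U.
have h4 : 0 <= N * U ^+ 2 by exact: mulr_ge0.
by split; lra.
Qed.

Lemma young_right N : 0 <= N ->
  young (N ^+ 2) (N ^+ 2 + N + 1) (fun _ => 0) (fun W => W `^ 1) (fun U => U <= N) (fun _ => True).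
Proof.
move=> N0 U W U0 W0 UN _; rewrite (powRr1 W0).
have U2 : U ^+ 2 <= N ^+ 2 by rewrite ler_sqr ?nnegrE.
have h1 : U ^+ 2 * W <= N ^+ 2 * W by exact: ler_wpM2r.
have h2 : U * W <= N * W by exact: ler_wpM2r.
have h3 : 0 <= N ^+ 2 * W by rewrite mulr_ge0// sqr_ge0.
have h4 : 0 <= N * W by exact: mulr_ge0.
have h5 := sqr_ge0 N.
by split; lra.
Qed.

Lemma conjugate_cases p q : (1 <= p)%E -> (1 <= q)%E -> (p^-1 + q^-1 = 1)%E ->
  [\/ exists r s : R, [/\ p = r%:E, q = s%:E, 1 < r, 1 < s & r^-1 + s^-1 = 1],
      p = 1%E /\ q = +oo%E | p = +oo%E /\ q = 1%E].
Proof.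
case: p => [r| |]//; case: q => [s| |]//.
- rewrite !lee_fin => r1 s1; have r0 := lt_le_trans ltr01 r1; have s0 := lt_le_trans ltr01 s1.
  rewrite !inver ?gt_eqF// => -[rs]; constructor 1; exists r, s; split => //.
    rewrite lt_neqAle r1 andbT eq_sym; apply/eqP => E; move: rs (invr_gt0 s); rewrite E invr1 => /eqP.
    by rewrite eq_sym addrC -subr_eq subrr => /eqP <-; rewrite ltxx s0.
  rewrite lt_neqAle s1 andbT eq_sym; apply/eqP => E; move: rs (invr_gt0 r); rewrite E invr1 => /eqP.
  by rewrite eq_sym -subr_eq subrr => /eqP <-; rewrite ltxx r0.
- rewrite lee_fin => r1 _; have r0 := lt_le_trans ltr01 r1.
  rewrite inver ?gt_eqF// invey adde0 => -[E]; constructor 2; split => //.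
  by congr (_%:E); rewrite -[r]invrK E invr1.
- rewrite lee_fin => _ s1; have s0 := lt_le_trans ltr01 s1.
  rewrite inver ?gt_eqF// invey add0e => -[E]; constructor 3; split => //.
  by congr (_%:E); rewrite -[s]invrK E invr1.
- by move=> _ _; rewrite !invey adde0 => -[] /esym/eqP; rewrite oner_eq0.
Qed.

(** In the endpoint cases one of the two fields is bounded and Hoelder
    continuous, and the corresponding [Phi] or [Psi] is zero. *)
Lemma sobolev_slices theta alpha p q N : 0 < theta -> 0 < alpha ->
  (1 <= p)%E -> (1 <= q)%E -> (p^-1 + q^-1 = 1)%E -> 0 <= N ->
  exists c M : R, [/\ 0 <= c, 0 <= M & forall u w : space3 R -> 'rV[R]_3,
    torus_periodic u -> torus_periodic w ->
    (forall i, measurable_fun [set: mspace3 R] (vcomp u i)) ->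
    (forall i, measurable_fun [set: mspace3 R] (vcomp w i)) ->
    (sobolev_norm theta (2%:E * p)%E u <= N%:E)%E -> (sobolev_norm alpha q w <= N%:E)%E ->
    [/\ slice_integrable (vcomp u) (vcomp w), slice_regular theta alpha c M (vcomp u) (vcomp w),
        forall i j, \int[mu]_x `|vcomp u i x * vcomp u j x| <= c + M &
        forall i, \int[mu]_x `|vcomp w i x| <= c + M]].
Proof.
move=> th0 al0 p1 q1 pq N0.
have mp (s : R) : measurable_fun [set: measurableTypeR R] (fun t : R => t `^ s) by exact: measurable_powR.
have mc : measurable_fun [set: measurableTypeR R] (fun t : R => 0 : R) by [].
have weaken th M M' Phi A f : M <= M' -> sobolev_class th M Phi A f -> @sobolev_class R th M' Phi A f.
  by move=> MM [h1 h2 h3]; split=> //; [exact: le_trans h1 _|exact: le_trans h2 _]; rewrite lee_fin.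
have N1 : 0 <= N + 1 by rewrite addr_ge0.
have conclude (c kappa M : R) (Phi Psi : R -> R) (A B : R -> Prop) (u w : space3 R -> 'rV[R]_3) : 0 <= c -> 0 <= kappa ->
    measurable_fun [set: measurableTypeR R] Phi -> measurable_fun [set: measurableTypeR R] Psi ->
    (forall s : R, 0 <= Phi s) -> (forall s : R, 0 <= Psi s) ->
    (forall i, measurable_fun [set: mspace3 R] (vcomp u i)) ->
    (forall i, measurable_fun [set: mspace3 R] (vcomp w i)) ->
    torus_periodic u -> torus_periodic w ->
    sobolev_class theta M Phi A u -> sobolev_class alpha M Psi B w -> young c kappa Phi Psi A B ->
    [/\ slice_integrable (vcomp u) (vcomp w),
        slice_regular theta alpha c (kappa * M) (vcomp u) (vcomp w),
        forall i j, \int[mu]_x `|vcomp u i x * vcomp u j x| <= c + kappa * M &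
        forall i, \int[mu]_x `|vcomp w i x| <= c + kappa * M].
  move=> c0 k0 mP mQ P0 Q0 mu' mw' pu pw cu cw yg; split.
  - exact: (young_slice_integrable k0 mP mQ P0 Q0 mu' mw' cu cw yg).
  - exact: (young_slice_regular th0 al0 c0 k0 mP mQ P0 Q0 mu' mw' pu pw cu cw yg).
  - by move=> i j; exact: (young_second_moment k0 mP mQ P0 Q0 mu' mw' cu cw yg).
  - by move=> i; exact: (young_first_moment k0 mP mQ P0 Q0 mu' mw' cu cw yg).
have [[r [s [-> -> r1 s1 rs]]]|[-> ->]|[-> ->]] := conjugate_cases p1 q1 pq.
- have r2 : 1 <= 2 * r by have := ltW r1; lra.
  pose M := N `^ (2 * r) + N `^ s.
  exists 1, (2 * M); split => // [|u w pu pw mu' mw' hu hw]; first by rewrite mulr_ge0// addr_ge0 ?powR_ge0.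
  have M1 : N `^ (2 * r) <= M by rewrite lerDl powR_ge0.
  have M2 : N `^ s <= M by rewrite lerDr powR_ge0.
  have cu := weaken _ _ _ _ _ _ M1 (sobolev_class_fin th0 r2 N0 hu).
  have cw := weaken _ _ _ _ _ _ M2 (sobolev_class_fin al0 (ltW s1) N0 hw).
  have yg := young_fin r1 s1 rs.
  by apply: (conclude _ _ _ _ _ _ _ _ _ _ _ _ _ _ _ mu' mw' pu pw cu cw yg) => // t; exact: powR_ge0.
- pose M := N `^ 2.
  have K0 : 0 <= N + 1 + 1 by rewrite addr_ge0.
  exists (N + 1), ((N + 1 + 1) * M); split => // [|u w pu pw mu' mw' hu hw]; first by rewrite mulr_ge0// powR_ge0.
  rewrite mule1 in hu.
  have cu := sobolev_class_fin th0 (ler1n R 2) N0 hu.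
  have cw := weaken _ _ _ _ _ _ (powR_ge0 N 2) (sobolev_class_inf al0 N0 hw).
  have yg := young_left N1.
  by apply: (conclude _ _ _ _ _ _ _ _ _ _ _ _ _ _ _ mu' mw' pu pw cu cw yg) => // t; exact: powR_ge0.
- pose M := N `^ 1.
  have C0 : 0 <= (N + 1) ^+ 2 by exact: sqr_ge0.
  have K0 : 0 <= (N + 1) ^+ 2 + (N + 1) + 1 by rewrite !addr_ge0.
  exists ((N + 1) ^+ 2), (((N + 1) ^+ 2 + (N + 1) + 1) * M); split => // [|u w pu pw mu' mw' hu hw].
    by rewrite mulr_ge0// powR_ge0.
  rewrite gt0_muley ?lte_fin// in hu.
  have cu := weaken _ _ _ _ _ _ (powR_ge0 N 1) (sobolev_class_inf th0 N0 hu).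
  have cw := sobolev_class_fin al0 (lexx 1) N0 hw.
  have yg := young_right N1.
  by apply: (conclude _ _ _ _ _ _ _ _ _ _ _ _ _ _ _ mu' mw' pu pw cu cw yg) => // t; exact: powR_ge0.
Qed.

End SobolevSlices.

(** * Pairing with spatial test functions *)

Section TimeSlices.
Context d (T : measurableType d) (R : realType) (mu : probability T R).
Local Notation leb := (@lebesgue_measure R).
Implicit Types (g : T * measurableTypeR R -> R) (chi : R -> R) (K M : R).

Lemma measurable_slice_Int g : measurable_fun [set: T * measurableTypeR R] g ->
  measurable_fun [set: measurableTypeR R] (fun t => \int[mu]_x g (x, t)).
Proof.
move=> mg; have mE : measurable_fun [set: T * measurableTypeR R] (EFin \o g) by exact/measurable_EFinP.
apply: (measurableT_comp (@fine_measurable R setT measurableT)).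
rewrite (_ : (fun t => _) = (fun t => \int[mu]_x ((EFin \o g)^\+ (x, t)) - \int[mu]_x ((EFin \o g)^\- (x, t)))%E).
  apply: emeasurable_funB.
    by apply: (@measurable_fun_fubini_tonelli_G _ _ _ _ _ mu _ (measurable_funepos mE)).
  by apply: (@measurable_fun_fubini_tonelli_G _ _ _ _ _ mu _ (measurable_funeneg mE)).
by apply/funext => t; rewrite integralE; congr (_ - _)%E; apply: eq_integral => x _; rewrite ?funeposE ?funenegE.
Qed.

Definition slices_bounded g K :=
  {ae leb, forall t, rintegrable mu (fun x => g (x, t)) /\ \int[mu]_x `|g (x, t)| <= K}.

Lemma slices_locally_integrable g K : measurable_fun [set: T * measurableTypeR R] g ->
  slices_bounded g K -> locally_integrable [set: R] (fun t => \int[mu]_x g (x, t)).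
Proof.
move=> mg bg; have mI := measurable_slice_Int mg.
split => //; first exact: openT.
move=> C _ cC; have mC := compact_measurable cC.
have Cfin := compact_finite_measure cC.
apply: (@le_lt_trans _ _ (\int[leb]_(x in C) (cst `|K|%:E x))%E); last first.
  by rewrite integral_cst// lte_mul_pinfty.
apply: ae_ge0_le_integral => //.
- by apply/measurable_EFinP; apply: measurable_funTS; exact: measurableT_comp.
- by move=> t _; rewrite lee_fin.
- apply: (@filterS _ _ (ae_filter_ringOfSetsType leb) _ _ _ bg) => t [it bt] _.
  by rewrite lee_fin (le_trans (norm_Int it))// (le_trans bt)// ler_norm.
Qed.

Lemma Int_time_slices g chi K M a b : measurable_fun [set: T * measurableTypeR R] g ->
  slices_bounded g K -> measurable_fun [set: measurableTypeR R] chi ->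
  (forall t, `|chi t| <= M) -> (forall t, ~ (a <= t <= b) -> chi t = 0) ->
  \int[(mu \x leb)%E]_z (g z * chi z.2) = \int[leb]_t (chi t * \int[mu]_x g (x, t)).
Proof.
move=> mg bg mc chiM chi0.
have M0 : 0 <= M by exact: le_trans (chiM 0).
pose h (z : T * measurableTypeR R) := g z * chi z.2.
have mh : measurable_fun [set: T * measurableTypeR R] h.
  by apply: measurable_funM => //; exact: (measurableT_comp mc measurable_snd).
have mE : measurable_fun [set: T * measurableTypeR R] (EFin \o h) by exact/measurable_EFinP.
pose I : set (measurableTypeR R) := `[a, b]%classic.
have mI : measurable I by exact: measurable_itv.
have slice t : rintegrable mu (fun x => g (x, t)) ->
    (\int[mu]_x (h (x, t))%:E = (chi t * \int[mu]_x g (x, t))%:E)%E.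
  move=> it; rewrite -IntZ// EFin_Int; last exact: rintegrableZ.
  by apply: eq_integral => x _; rewrite mulrC.
have nslice t : rintegrable mu (fun x => g (x, t)) ->
    (\int[mu]_x `|(h (x, t))%:E| = (`|chi t| * \int[mu]_x `|g (x, t)|)%:E)%E.
  move=> it; have nt : rintegrable mu (fun x => `|g (x, t)|) by exact: integrable_norm.
  rewrite -IntZ// EFin_Int; last exact: rintegrableZ.
  by apply: eq_integral => x _; rewrite abse_EFin normrM mulrC.
have ih : (mu \x leb)%E.-integrable [set: T * measurableTypeR R] (EFin \o h).
  apply/integrable21ltyP => //.
  apply: (@le_lt_trans _ _ (\int[leb]_t ((cst (M * `|K|)%:E) \_ I) t)%E); last first.
    rewrite -integral_mkcond integral_cst// lte_mul_pinfty ?lee_fin ?mulr_ge0//.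
    by apply: compact_finite_measure; exact: segment_compact.
  apply: ae_ge0_le_integral => //.
  - by move=> t _; exact: integral_ge0.
  - apply: (@measurable_fun_fubini_tonelli_G _ _ _ _ _ mu (abse \o (EFin \o h))) => //.
    + exact: measurableT_comp.
    + by move=> z; rewrite /= lee_fin.
  - by move=> t _; rewrite patchE; case: ifP => // _; rewrite lee_fin mulr_ge0.
  - by apply/(measurable_restrictT _ mI).
  - apply: (@filterS _ _ (ae_filter_ringOfSetsType leb) _ _ _ bg) => t [it bt] _.
    rewrite nslice// patchE; case: ifPn => [_|tI].
      rewrite lee_fin; apply: ler_pM => //; first by apply: Rintegral_ge0.
      by rewrite (le_trans bt)// ler_norm.
    rewrite chi0 ?normr0 ?mul0r// => tab.
    by move: tI; rewrite notin_setE /I /= in_itv /= tab.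
rewrite [LHS]/Rintegral -[LHS]/(fine (\int[(mu \x leb)%E]_z ((EFin \o h) z))%E).
rewrite -(integral21_prod_meas1 ih) /Rintegral; congr fine; apply: ae_eq_integral => //.
- exact: measurable_fubini_G ih.
- by apply/measurable_EFinP; apply: measurable_funM => //; exact: measurable_slice_Int.
- by apply: (@filterS _ _ (ae_filter_ringOfSetsType leb) _ _ _ bg) => t [it _] _; exact: slice.
Qed.

End TimeSlices.

Section Pairing.
Variable R : realType.
Local Notation mu := (torus_measure R).
Local Notation prb := (mu : probability (mspace3 R) R).
Local Notation leb := (@lebesgue_measure R).
Implicit Types (f : spacetime R -> R) (e : space3 R -> R) (chi : R -> R) (t K : R).

(** A field is only known to be measurable at positive times; its extension by
    zero is measurable on the whole product, where Fubini applies. *)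
Definition cutoff f : mspace3 R * measurableTypeR R -> R := fun z => if 0 < z.2 then f z else 0.

Definition slices_le f K := {ae leb, forall t, 0 < t ->
  rintegrable mu (fun x => f (x, t)) /\ \int[mu]_x `|f (x, t)| <= K}.

Definition pairing f e t : R := \int[mu]_x (cutoff f (x, t) * e x).

Lemma pairingE f e t : 0 < t -> pairing f e t = \int[mu]_x (f (x, t) * e x).
Proof. by move=> t0; rewrite /pairing /cutoff /= t0. Qed.

Lemma in_time_domain z : (z \in time_domain R) = (0 < z.2).
Proof. by apply/idP/idP; rewrite inE. Qed.

Lemma measurable_time_domain : measurable (time_domain R).
Proof.
rewrite (_ : time_domain R = [set: mspace3 R * measurableTypeR R] `&` (snd @^-1` `]0, +oo[)); last first.
  by apply/seteqP; split=> z; rewrite /time_domain /= in_itv /= andbT => // -[].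
exact: (@measurable_snd _ _ (mspace3 R) (measurableTypeR R) measurableT _ (measurable_itv `]0%R : R, +oo[)).
Qed.

Lemma measurable_cutoff f : measurable_fun (time_domain R) f ->
  measurable_fun [set: mspace3 R * measurableTypeR R] (cutoff f).
Proof.
move=> mf; rewrite (_ : cutoff f = f \_ (time_domain R)); last first.
  by apply/funext => z; rewrite patchE in_time_domain.
exact/(measurable_restrictT _ measurable_time_domain).
Qed.

Section OneFunction.
Variables (f : spacetime R -> R) (K : R) (e : space3 R -> R).
Hypotheses (mf : measurable_fun (time_domain R) f) (bf : slices_le f K) (ne : tensor_sum e).

Let g (z : mspace3 R * measurableTypeR R) := cutoff f z * e z.1.

Let mg : measurable_fun [set: mspace3 R * measurableTypeR R] g.
Proof.
apply: measurable_funM; first exact: measurable_cutoff.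
exact: (measurableT_comp (tensor_sum_measurable ne) measurable_fst).
Qed.

Let bg : exists K', slices_bounded prb g K'.
Proof.
have [B B0 eB] := tensor_sum_bounded ne; exists (B * `|K|).
apply: (@filterS _ _ (ae_filter_ringOfSetsType leb) _ _ _ bf) => t h.
have [t0|t0] := ltP 0 t; last first.
  have E : (fun x => g (x, t)) = (fun=> 0).
    by apply/funext => x; rewrite /g /cutoff /= ltNge t0 mul0r.
  rewrite E; split; first exact: (@rintegrable_cst _ _ _ prb).
  have -> : \int[mu]_x `|g (x, t)| = \int[mu]_x (0 : R).
    by apply: eq_Rintegral => x _; rewrite -[g (x, t)]/((fun x => g (x, t)) x) E normr0.
  by rewrite (@Int_cst _ _ _ prb) mulr_ge0.
have E : (fun x => g (x, t)) = (fun x => f (x, t) * e x).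
  by apply/funext => x; rewrite /g /cutoff /= t0.
have -> : \int[mu]_x `|g (x, t)| = \int[mu]_x `|f (x, t) * e x|.
  by apply: eq_Rintegral => x _; rewrite -[g (x, t)]/((fun x => g (x, t)) x) E.
rewrite E.
have [it bt] := h t0; have ie := rintegrable_tensor_sum it ne; split=> //.
apply: (@le_trans _ _ (\int[mu]_x (B * `|f (x, t)|))).
  apply: (@Int_le _ _ _ prb).
  - exact: (@integrable_norm _ _ _ prb).
  - by apply: (@rintegrableZ _ _ _ prb); exact: (@integrable_norm _ _ _ prb).
  - by move=> x; rewrite normrM mulrC ler_wpM2r.
rewrite (@IntZ _ _ _ prb); last exact: (@integrable_norm _ _ _ prb).
by rewrite ler_wpM2l// (le_trans bt)// ler_norm.
Qed.

Lemma pairing_locally_integrable : locally_integrable [set: R] (pairing f e).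
Proof. by have [K' h] := bg; exact: (slices_locally_integrable mg h). Qed.

Lemma dist_of_pairing chi : time_test chi ->
  dist_of f (fun z => e z.1 * chi z.2) = \int[leb]_t (chi t * pairing f e t).
Proof.
move=> tc; have [M hM] := time_test_bounded tc.
have [sc [a [b [a0 hab]]]] := tc; have [K' h] := bg.
have c0 t : ~ (a <= t <= b) -> chi t = 0.
  by move=> n; apply/eqP; apply: contra_notT n => /hab.
rewrite -(Int_time_slices mg h (measurable_smooth1 sc) hM c0).
rewrite /dist_of /Rintegral integral_mkcond; congr fine; apply: eq_integral => z _.
by rewrite patchE in_time_domain /g /cutoff; case: ifP => _; rewrite ?mul0r// mulrA.
Qed.

End OneFunction.

End Pairing.

(** * Weak evolution of the regularized vorticity *)

Section AlmostEverywhere.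
Variable R : realType.
Local Notation leb := (@lebesgue_measure R).
Implicit Types (F G chi : R -> R) (P : R -> Prop) (t : R).

Lemma ae_countable (I : countType) (Q : I -> R -> Prop) :
  (forall i, {ae leb, forall t, Q i t}) -> {ae leb, forall t, forall i, Q i t}.
Proof.
move=> h.
have h' n : {ae leb, forall t, forall i, @unpickle I n = Some i -> Q i t}.
  case E : (@unpickle I n) => [i|]; last by apply: (@filterE _ _ (ae_filter_ringOfSetsType leb)).
  by apply: (@filterS _ _ (ae_filter_ringOfSetsType leb) _ _ _ (h i)) => t Qt j [<-].
have := ae_foralln h'; apply: (@filterS _ _ (ae_filter_ringOfSetsType leb)) => t Qt i.
by apply: (Qt (pickle i)); rewrite pickleK.
Qed.

Lemma ae_mollifier_limit F : locally_integrable [set: R] F -> {ae leb, forall t, mollifier_limit F t}.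
Proof.
move=> lF; have := lebesgue_differentiation lF.
by apply: (@filterS _ _ (ae_filter_ringOfSetsType leb)) => t; exact: lebesgue_pt_mollifier_limit.
Qed.

Lemma ae_weak_zero F : locally_integrable [set: R] F ->
  (forall chi, time_test chi -> \int[leb]_t (chi t * F t) = 0) ->
  {ae leb, forall t, 0 < t -> F t = 0}.
Proof.
move=> lF h; have := ae_mollifier_limit lF.
by apply: (@filterS _ _ (ae_filter_ringOfSetsType leb)) => t mt t0; exact: weak_zero.
Qed.

Lemma ae_time_measure P : {ae time_measure R, forall t, P t} -> {ae leb, forall t, 0 < t -> P t}.
Proof.
move=> [N [mN N0 hN]]; exists (N `&` `]0, +oo[); split => //.
  exact: measurableI.
move=> t /= h; have [t0 nP] : 0 < t /\ ~ P t by apply/not_implyP.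
by split; [apply: hN|rewrite /= in_itv /= t0].
Qed.

Lemma ess_sup_finite (f : R -> \bar R) : (ess_sup (time_measure R) f < +oo)%E ->
  exists2 N : R, 0 <= N & {ae leb, forall t, 0 < t -> (f t <= N%:E)%E}.
Proof.
move=> h; have ge := ess_sup_ge (time_measure R) f.
have [N N0 hN] : exists2 N : R, 0 <= N & (ess_sup (time_measure R) f <= N%:E)%E.
  move: h; case: (ess_sup (time_measure R) f) => // [r|] _.
    by exists `|r| => //; rewrite lee_fin ler_norm.
  by exists 0 => //; rewrite leNye.
exists N => //; apply: ae_time_measure.
apply: (@filterS _ _ (ae_filter_ringOfSetsType (time_measure R)) _ _ _ ge) => t ht.
exact: le_trans hN.
Qed.

Lemma time_test_integrable chi F : time_test chi -> locally_integrable [set: R] F ->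
  leb.-integrable [set: measurableTypeR R] (EFin \o (fun t => chi t * F t)).
Proof.
move=> tc lF; have [M hM] := time_test_bounded tc; have [sc [a [b [a0 hab]]]] := tc.
apply: (lint_bounded_support (c := a) (d := b) lF (measurable_smooth1 sc) hM) => t n.
by apply/eqP; apply: contra_notT n => /hab.
Qed.

Lemma time_testB chi F G : time_test chi -> locally_integrable [set: R] F ->
  locally_integrable [set: R] G ->
  \int[leb]_t (chi t * (F t - G t)) = \int[leb]_t (chi t * F t) - \int[leb]_t (chi t * G t).
Proof.
move=> tc lF lG; rewrite -RintegralB//; try exact: time_test_integrable.
by apply: eq_Rintegral => t _; rewrite mulrBr.
Qed.

Lemma locally_integrable_sum (I : Type) (r : seq I) (F : I -> R -> R) :
  (forall i, locally_integrable [set: R] (F i)) ->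
  locally_integrable [set: R] (fun t => \sum_(i <- r) F i t).
Proof.
move=> lF; elim: r => [|i r IH].
  under eq_fun do rewrite big_nil; apply: open_integrable_locally; first exact: openT.
  exact: integrable0.
by under eq_fun do rewrite big_cons; exact: locally_integrableD.
Qed.

Lemma time_test_sum (I : Type) (r : seq I) chi (F : I -> R -> R) : time_test chi ->
  (forall i, locally_integrable [set: R] (F i)) ->
  \int[leb]_t (chi t * \sum_(i <- r) F i t) = \sum_(i <- r) \int[leb]_t (chi t * F i t).
Proof.
move=> tc lF; elim: r => [|i r IH].
  rewrite big_nil; under eq_Rintegral do rewrite big_nil mulr0.
  by rewrite Rintegral_cst// mul0r.
rewrite big_cons -IH -RintegralD//.
- by apply: eq_Rintegral => t _; rewrite big_cons mulrDr.
- exact: time_test_integrable.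
- by apply: time_test_integrable => //; exact: locally_integrable_sum.
Qed.

Lemma time_test_derive1 chi : time_test chi -> time_test (derive1 chi).
Proof.
move=> [sc [a [b [a0 hab]]]]; split; first exact: smooth1_derive1.
have c0 t : ~~ (a <= t <= b) -> chi t = 0.
  by move=> n; apply/eqP; apply: contraNT n => /hab.
exists a, b; split => // t; apply: contraNT; rewrite negb_and -!ltNge => h.
apply/eqP; rewrite derive1E.
suff d : is_derive t (1 : R) chi 0 by rewrite derive_val.
apply: (near_eq_is_derive _ (is_derive_cst (0 : R) t (1 : R))).
case/orP: h => h; near=> r; apply/esym/c0; rewrite negb_and -!ltNge; apply/orP; [left|right]; near: r.
  exact: lt_nbhsl.
exact: lt_nbhsr.
Unshelve. all: by end_near. Qed.

End AlmostEverywhere.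

Lemma sub_sub_eq0 (V : comPzRingType) (T X Y Y1 Z : V) : T = X - Y -> Y = Y1 - Z ->
  X = - Z - - Y1 -> T = 0.
Proof. by move=> -> -> ->; ring. Qed.

Lemma eliminate_pressure (V : comPzRingType) (A B S1 S2 P : V) : A + S1 = - P -> B + S2 = - P ->
  A - B = - (S1 - S2).
Proof.
move=> h1 h2; have -> : A = - P - S1 by rewrite -h1 addrK.
by have -> : B = - P - S2; [rewrite -h2 addrK|ring].
Qed.

Section SpacetimeFields.
Variable R : realType.
Local Notation mu := (torus_measure R).
Local Notation prb := (mu : probability (mspace3 R) R).
Local Notation leb := (@lebesgue_measure R).
Implicit Types (chi : R -> R) (t : R) (i j l : 'I_3) (n : nat).

Definition slice (u : spacetime R -> 'rV[R]_3) t : space3 R -> 'rV[R]_3 := fun x => u (x, t).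
Definition at_time u t i : space3 R -> R := vcomp (slice u t) i.

Lemma measurable_slice u t : vector_field u -> 0 < t ->
  forall i, measurable_fun [set: mspace3 R] (at_time u t i).
Proof.
move=> [_ mu'] t0 i; have mc := measurable_cutoff (mu' i).
have := measurableT_comp mc (pair2_measurable t).
by apply: eq_measurable_fun => x _ /=; rewrite /cutoff /= t0.
Qed.

Lemma test_tens (f : 'I_3 -> R -> R) chi : (forall i, per1 (f i)) -> time_test chi ->
  test_function (tens4 f chi).
Proof. by move=> pf [sc [a [b [a0 hab]]]]; exact: test_function_tens4 pf sc a0 hab. Qed.

Variables (u omega : spacetime R -> 'rV[R]_3) (K : R).
Hypotheses (u_sol : euler_weak_solution u) (omega_curl : weak_curl u omega).
Hypothesis slices : {ae leb, forall t, 0 < t ->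
  [/\ slice_integrable (at_time u t) (at_time omega t),
      forall i j, \int[mu]_x `|at_time u t i x * at_time u t j x| <= K,
      forall i, \int[mu]_x `|at_time omega t i x| <= K &
      forall i, \int[mu]_x `|at_time u t i x| <= K]}.

Let ae_filter := ae_filter_ringOfSetsType leb.

Let vu : vector_field u. Proof. by case: u_sol. Qed.
Let vo : vector_field omega. Proof. by case: omega_curl. Qed.

Let m1 i : measurable_fun (time_domain R) (coordv u i). Proof. exact: (proj2 vu). Qed.
Let mo i : measurable_fun (time_domain R) (coordv omega i). Proof. exact: (proj2 vo). Qed.
Let m2 i j : measurable_fun (time_domain R) (fun z => coordv u i z * coordv u j z).
Proof. exact: measurable_funM. Qed.

Let b1 i : slices_le (coordv u i) K.
Proof. by apply: (@filterS _ _ ae_filter _ _ _ slices) => t h t0; have [[hi _ _ _] _ _ hb] := h t0; split; [exact: hi|exact: hb]. Qed.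
Let bo i : slices_le (coordv omega i) K.
Proof. by apply: (@filterS _ _ ae_filter _ _ _ slices) => t h t0; have [[_ _ hi _] _ hb _] := h t0; split; [exact: hi|exact: hb]. Qed.
Let b2 i j : slices_le (fun z => coordv u i z * coordv u j z) K.
Proof. by apply: (@filterS _ _ ae_filter _ _ _ slices) => t h t0; have [[_ hi _ _] hb _ _] := h t0; split; [exact: hi|exact: hb]. Qed.

Section OneTensor.
Variable f : 'I_3 -> R -> R.
Hypothesis pf : forall i, per1 (f i).
Let e := tens f.
Let ne : tensor_sum e. Proof. exact: tensor_sum_tens. Qed.
Let ne1 i : tensor_sum (pd i e). Proof. exact: tensor_sum_pd. Qed.
Let ne2 i j : tensor_sum (pd j (pd i e)). Proof. by do 2 apply: tensor_sum_pd. Qed.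

Let test_split g chi : tens4 g chi = (fun z => tens g z.1 * chi z.2). Proof. by []. Qed.

Let sf i : smooth1 (f i). Proof. by case: (pf i). Qed.
Let pf1 j i : per1 (diff_at j f i). Proof. exact: per1_diff_at. Qed.
Let sf1 j i : smooth1 (diff_at j f i). Proof. by case: (pf1 j i). Qed.
Let pd1 j : pd j e = tens (diff_at j f). Proof. exact: pd_tens. Qed.
Let pd2 i j : pd j (pd i e) = tens (diff_at j (diff_at i f)). Proof. by rewrite pd1 pd_tens. Qed.

Lemma curl_pairing i : {ae leb, forall t, 0 < t ->
  pairing (coordv omega i) e t =
  pairing (coordv u (i + 1)) (pd (i + 2) e) t - pairing (coordv u (i + 2)) (pd (i + 1) e) t}.
Proof.
have l0 := pairing_locally_integrable (mo i) (bo i) ne.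
have l1 := pairing_locally_integrable (m1 (i + 1)) (b1 (i + 1)) (ne1 (i + 2)).
have l2 := pairing_locally_integrable (m1 (i + 2)) (b1 (i + 2)) (ne1 (i + 1)).
have l12 := locally_integrableB l1 l2.
suff H : {ae leb, forall t, 0 < t -> pairing (coordv omega i) e t -
   (pairing (coordv u (i + 1)) (pd (i + 2) e) t - pairing (coordv u (i + 2)) (pd (i + 1) e) t) = 0}.
  by apply: (@filterS _ _ ae_filter _ _ _ H) => t h t0; apply/eqP; rewrite -subr_eq0 h.
apply: (@ae_weak_zero _ _ (locally_integrableB l0 l12)) => chi tc.
have [_ _ wc] := omega_curl.
have := wc _ (test_tens pf tc) i; rewrite /dist_partial !partial_tens4_Some// !test_split.
rewrite (dist_of_pairing (mo i) (bo i) ne tc) -!pd1.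
rewrite (dist_of_pairing (m1 _) (b1 _) (ne1 _) tc) (dist_of_pairing (m1 _) (b1 _) (ne1 _) tc) => E.
exact: sub_sub_eq0 (time_testB tc l0 l12) (time_testB tc l1 l2) E.
Qed.

Lemma div_pairing : {ae leb, forall t, 0 < t -> \sum_i pairing (coordv u i) (pd i e) t = 0}.
Proof.
have l i := pairing_locally_integrable (m1 i) (b1 i) (ne1 i).
apply: (@ae_weak_zero _ _ (locally_integrable_sum _ l)) => chi tc.
have [_ _ _ wd] := u_sol; have := wd _ (test_tens pf tc); rewrite /dist_partial.
rewrite (time_test_sum _ tc l) sumrN => /eqP; rewrite oppr_eq0 => /eqP E; rewrite -[RHS]E.
apply: eq_bigr => i _; rewrite partial_tens4_Some// test_split -pd1.
by rewrite (dist_of_pairing (m1 i) (b1 i) (ne1 i) tc).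
Qed.

(** The component [l] of the curl tested with [e], expressed through [u]: in
    this form its evolution follows from the momentum equation. *)
Definition vorticity_pairing l t : R :=
  pairing (coordv u (l + 1)) (pd (l + 2) e) t - pairing (coordv u (l + 2)) (pd (l + 1) e) t.

Definition vorticity_flux_pairing l t : R :=
  \sum_j (pairing (fun z => coordv u (l + 1) z * coordv u j z) (pd j (pd (l + 2) e)) t -
          pairing (fun z => coordv u (l + 2) z * coordv u j z) (pd j (pd (l + 1) e)) t).

Lemma vorticity_locally_integrable l : locally_integrable [set: R] (vorticity_pairing l).
Proof.
apply: locally_integrableB.
  exact: pairing_locally_integrable (m1 (l + 1)) (b1 (l + 1)) (ne1 (l + 2)).
exact: pairing_locally_integrable (m1 (l + 2)) (b1 (l + 2)) (ne1 (l + 1)).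
Qed.

Let lflux i k j := pairing_locally_integrable (m2 i j) (b2 i j) (ne2 k j).

Lemma vorticity_flux_locally_integrable l : locally_integrable [set: R] (vorticity_flux_pairing l).
Proof.
by apply: locally_integrable_sum => j; apply: locally_integrableB; exact: lflux.
Qed.

(** The pressure is tested with the mixed derivative of the tensor product
    along [i] and [k], which is symmetric: exchanging the two directions and
    subtracting eliminates it. *)
Let momentum (p : (spacetime R -> R) -> R) chi i k : time_test chi -> time_test (derive1 chi) ->
  (forall phi, test_function phi -> forall i,
           dist_partial None (dist_of (coordv u i)) phi
           + (\sum_(j < 3) dist_partial (Some j)
                (dist_of (fun z => coordv u i z * coordv u j z)) phi)
           + dist_partial (Some i) p phi = 0) ->
  \int[leb]_t (derive1 chi t * pairing (coordv u i) (pd k e) t) +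
  \sum_j \int[leb]_t (chi t * pairing (fun z => coordv u i z * coordv u j z) (pd j (pd k e)) t) =
  - p (tens4 (diff_at i (diff_at k f)) chi).
Proof.
move=> tc tc' eq; have [sc _] := tc.
have N : dist_of (coordv u i) (partial None (tens4 (diff_at k f) chi)) =
    \int[leb]_t (derive1 chi t * pairing (coordv u i) (pd k e) t).
  rewrite (partial_tens4_None _ sc) test_split -pd1.
  exact: (dist_of_pairing (m1 i) (b1 i) (ne1 k) tc').
have P : partial (Some i) (tens4 (diff_at k f) chi) = tens4 (diff_at i (diff_at k f)) chi.
  by rewrite partial_tens4_Some.
have E j : dist_of (fun z => coordv u i z * coordv u j z) (partial (Some j) (tens4 (diff_at k f) chi)) =
    \int[leb]_t (chi t * pairing (fun z => coordv u i z * coordv u j z) (pd j (pd k e)) t).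
  have -> : partial (Some j) (tens4 (diff_at k f) chi) = (fun z => pd j (pd k e) z.1 * chi z.2).
    by rewrite (partial_tens4_Some _ _ (sf1 k)) pd2.
  exact: (dist_of_pairing (m2 i j) (b2 i j) (ne2 k j) tc).
have := eq _ (test_tens (pf1 k) tc) i; rewrite /dist_partial N P.
under eq_bigr do rewrite E.
by rewrite sumrN -opprD => /eqP; rewrite subr_eq0 => /eqP <-; rewrite opprK.
Qed.

Lemma vorticity_equation l chi : time_test chi -> time_test (derive1 chi) ->
  \int[leb]_t (derive1 chi t * vorticity_pairing l t) = - \int[leb]_t (chi t * vorticity_flux_pairing l t).
Proof.
move=> tc tc'; have [_ _ [p [_ eq]] _] := u_sol.
have M1 := momentum (l + 1) (l + 2) tc tc' eq.
have M2 := momentum (l + 2) (l + 1) tc tc' eq.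
have lv i k := pairing_locally_integrable (m1 i) (b1 i) (ne1 k).
rewrite (time_testB tc' (lv _ _) (lv _ _)) (time_test_sum _ tc); last first.
  by move=> j; apply: locally_integrableB; exact: lflux.
have -> : \sum_j \int[leb]_t (chi t * (pairing (fun z => coordv u (l + 1) z * coordv u j z) (pd j (pd (l + 2) e)) t -
          pairing (fun z => coordv u (l + 2) z * coordv u j z) (pd j (pd (l + 1) e)) t)) =
   \sum_j \int[leb]_t (chi t * pairing (fun z => coordv u (l + 1) z * coordv u j z) (pd j (pd (l + 2) e)) t) -
   \sum_j \int[leb]_t (chi t * pairing (fun z => coordv u (l + 2) z * coordv u j z) (pd j (pd (l + 1) e)) t).
  by rewrite -sumrB; apply: eq_bigr => j _; rewrite (time_testB tc (lflux _ _ _) (lflux _ _ _)).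
rewrite diff_atC in M2; exact: eliminate_pressure M1 M2.
Qed.

End OneTensor.

(** The times that avoid the null sets of all basis functions of all indices,
    a countable family. *)
Definition good_time t := [/\ 0 < t, forall n, curl_div n (at_time u t) (at_time omega t),
  forall n l (k : idx n), mollifier_limit (vorticity_pairing (fun i => phi n (k i)) l) t &
  slice_integrable (at_time u t) (at_time omega t) /\
  forall i j, \int[mu]_x `|at_time u t i x * at_time u t j x| <= K].

Lemma ae_good_time : {ae leb, forall t, 0 < t -> good_time t}.
Proof.
have pphi n (k : idx n) : forall i, per1 (phi n (k i) : R -> R) := @per1_bas R n k.
have C1 n : {ae leb, forall t, forall a : 'I_3 * idx n, 0 < t ->
    coef (at_time omega t a.1) a.2 = vorticity_pairing (fun i => phi n (a.2 i)) a.1 t}.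
  apply: ae_countable => -[i k]; apply: (@filterS _ _ ae_filter _ _ _ (curl_pairing (pphi n k) i)) => t h t0.
  by rewrite /vorticity_pairing -(h t0) pairingE.
have C2 n : {ae leb, forall t, forall k : idx n, 0 < t ->
    \sum_i pairing (coordv u i) (pd i (bas k)) t = 0}.
  by apply: ae_countable => k; exact: div_pairing (pphi n k).
have C3 n : {ae leb, forall t, forall a : 'I_3 * idx n,
    mollifier_limit (vorticity_pairing (fun i => phi n (a.2 i)) a.1) t}.
  by apply: ae_countable => -[i k]; apply: ae_mollifier_limit; exact: vorticity_locally_integrable (pphi n k) i.
have := @filterI _ _ ae_filter _ _ (ae_foralln C1) (@filterI _ _ ae_filter _ _ (ae_foralln C2)
  (@filterI _ _ ae_filter _ _ (ae_foralln C3) slices)).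
apply: (@filterS _ _ ae_filter) => t [h1 [h2 [h3 h4]]] t0; split => //.
- move=> n; split.
    by move=> i k; rewrite (h1 n (i, k) t0) /vorticity_pairing !pairingE.
  by move=> k; rewrite -[RHS](h2 n k t0); apply: eq_bigr => i _; rewrite pairingE.
- by move=> n l k; exact: (h3 n (l, k)).
- by have [] := h4 t0.
Qed.

Lemma vorticity_pairing_coef t n l (k : idx n) : good_time t ->
  vorticity_pairing (fun i => phi n (k i)) l t = coef (at_time omega t l) k.
Proof. by move=> [t0 cd _ _]; rewrite (proj1 (cd n)) /vorticity_pairing !pairingE. Qed.

Lemma vorticity_flux_pairingE t n l (k : idx n) : good_time t ->
  vorticity_flux_pairing (fun i => phi n (k i)) l t = vorticity_flux (at_time u t) l k.
Proof. by move=> [t0 _ _ _]; apply: eq_bigr => j _; rewrite !pairingE. Qed.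

Lemma good_vorticity_equation n l (k : idx n) chi : time_test chi ->
  \int[leb]_x (derive1 chi x * vorticity_pairing (fun i => phi n (k i)) l x) =
  - \int[leb]_x (chi x * vorticity_flux_pairing (fun i => phi n (k i)) l x).
Proof.
move=> tc; apply: vorticity_equation => //; first exact: (@per1_bas R n k).
exact: time_test_derive1.
Qed.

Let loc1 n l (k : idx n) := vorticity_locally_integrable (@per1_bas R n k : forall i, per1 (phi n (k i) : R -> R)) l.
Let loc2 n l (k : idx n) := vorticity_flux_locally_integrable (@per1_bas R n k : forall i, per1 (phi n (k i) : R -> R)) l.

Lemma coef_lipschitz n : exists2 L : R, 0 <= L & forall s t l (k : idx n),
  good_time s -> good_time t -> `|coef (at_time omega t l) k - coef (at_time omega s l) k| <= L * `|t - s|.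
Proof.
have [B B0 hB] := @vorticity_flux_bounded R n; exists (B * `|K|) => [|s t l k]; first exact: mulr_ge0.
have lt_case s' t' : s' < t' -> good_time s' -> good_time t' ->
    `|coef (at_time omega t' l) k - coef (at_time omega s' l) k| <= B * `|K| * (t' - s').
  move=> st gs gt; have [s0 _ ms _] := gs; have [_ _ mt _] := gt.
  have := @weak_mean_value R unit [:: tt] (fun _ => vorticity_pairing (fun i => phi n (k i)) l)
    (fun _ => vorticity_flux_pairing (fun i => phi n (k i)) l) (fun _ => 1) (B * `|K|) 0 s' t'
    (mulr_ge0 B0 (normr_ge0 K)) (lexx 0) s0 st (fun _ => loc1 l k) (fun _ => loc2 l k)
    (fun _ => ms n l k) (fun _ => mt n l k) (fun _ chi tc => good_vorticity_equation l k tc).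
  rewrite !big_seq1 !mul1r mul0r addr0 (vorticity_pairing_coef _ _ gs) (vorticity_pairing_coef _ _ gt); apply.
  apply: (@filterS _ _ ae_filter _ _ _ ae_good_time) => x gx x0.
  rewrite big_seq1 mul1r mul0r addr0 (vorticity_flux_pairingE _ _ (gx x0)).
  have [_ _ _ [[_ iuu _ _] hK]] := gx x0.
  by apply: hB => // i j; apply: le_trans (hK i j) (ler_norm K).
move=> gs gt; have [st|ts|->] := ltgtP s t.
- by rewrite (gtr0_norm (_ : 0 < t - s)) ?subr_gt0//; exact: lt_case.
- by rewrite distrC (distrC t) (gtr0_norm (_ : 0 < s - t)) ?subr_gt0//; exact: lt_case.
- by rewrite !subrr normr0 mulr0.
Qed.

Section RegularizedHelicity.
Variables (n : nat) (A : R).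
Hypotheses (A0 : 0 <= A).
Hypothesis fluxA : {ae leb, forall t, 0 < t -> `|helicity_flux n (at_time u t) (at_time omega t)| <= A}.

Let h t := reg_helicity n (at_time u t) (at_time omega t).

(** By [reg_helicityB] the increment pairs the vorticity coefficients with the
    regularized fields at [s] and [t], frozen in time. At an intermediate time
    [r] this produces the flux of [u(r)] against [w(s)] and [w(t)] instead of
    [w(r)]; the difference is Lipschitz in the distance of [r] to [s] and [t],
    and the flux at [r] itself is at most [A]. *)
Lemma reg_helicity_quadratic : exists2 L : R, 0 <= L & forall s t, s < t -> good_time s -> good_time t ->
  `|h t - h s| <= (2 * A + L * (t - s)) * (t - s).
Proof.
have [L L0 hL] := coef_lipschitz n; have [B B0 hB] := @helicity_flux_lipschitz R n.
pose D : R := B * `|K| * \sum_(i < 3) \sum_(k : idx n) L.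
have D0 : 0 <= D by rewrite !mulr_ge0//; apply: sumr_ge0 => i _; apply: sumr_ge0.
exists D => // s t st gs gt; have [s0 cds ms [is_ ks]] := gs; have [t0 cdt mt [it kt]] := gt.
pose c (a : 'I_3 * idx n) := coef (reg n (at_time u t a.1)) a.2 + coef (reg n (at_time u s a.1)) a.2.
have := @weak_mean_value R _ (index_enum ('I_3 * idx n)%type)
  (fun a => vorticity_pairing (fun i => phi n (a.2 i)) a.1) (fun a => vorticity_flux_pairing (fun i => phi n (a.2 i)) a.1)
  c (2 * A) D s t (mulr_ge0 (ler0n R 2) A0) D0 s0 st (fun a => loc1 a.1 a.2) (fun a => loc2 a.1 a.2)
  (fun a => ms n a.1 a.2) (fun a => mt n a.1 a.2) (fun a chi tc => good_vorticity_equation a.1 a.2 tc).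
have E r : good_time r -> \sum_a c a * vorticity_pairing (fun i => phi n (a.2 i)) a.1 r =
   \sum_l \sum_(k : idx n) (coef (reg n (at_time u t l)) k + coef (reg n (at_time u s l)) k) * coef (at_time omega r l) k.
  by move=> gr; rewrite pair_big; apply: eq_bigr => a _; rewrite vorticity_pairing_coef.
rewrite (E t gt) (E s gs) -(reg_helicityB is_ it (cds n) (cdt n)); apply.
apply: (@filterS _ _ ae_filter _ _ _ (@filterI _ _ ae_filter _ _ fluxA ae_good_time)) => r [hA gr] r0.
have {}gr := gr r0; have {}hA := hA r0; have [_ cdr _ [ir kr]] := gr.
have near q : good_time q -> `|helicity_flux n (at_time u r) (at_time omega q)| <= A + D * `|r - q|.
  move=> gq; have [_ _ _ [iq _]] := gq; have [_ iuu iw _] := ir; have [_ _ iwq _] := iq.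
  rewrite -[helicity_flux _ _ _](subrK (helicity_flux n (at_time u r) (at_time omega r))) addrC.
  apply: (le_trans (ler_normD _ _)); apply: lerD => //.
  apply: (le_trans (hB _ _ _ `|K| iw iwq iuu (fun i j => le_trans (kr i j) (ler_norm K)))).
  rewrite /D -[leRHS]mulrA ler_wpM2l ?mulr_ge0// mulr_suml; apply: ler_sum => i _.
  by rewrite mulr_suml; apply: ler_sum => k _; rewrite (distrC r); exact: hL.
have -> : \sum_a c a * vorticity_flux_pairing (fun i => phi n (a.2 i)) a.1 r =
    helicity_flux n (at_time u r) (at_time omega t) + helicity_flux n (at_time u r) (at_time omega s).
  have F q : good_time q -> helicity_flux n (at_time u r) (at_time omega q) =
      \sum_(a : 'I_3 * idx n) vorticity_flux (at_time u r) a.1 a.2 * coef (reg n (at_time u q a.1)) a.2.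
    by move=> [_ cdq _ [iq _]]; rewrite -(helicity_flux_coef ir iq (cdq n)) pair_big.
  rewrite (F t gt) (F s gs) -big_split.
  apply: eq_bigr => a _ /=; rewrite (vorticity_flux_pairingE _ _ gr) /c mulrDl; congr (_ + _); exact: mulrC.
apply: (le_trans (ler_normD _ _)); apply: (le_trans (lerD (near t gt) (near s gs))).
by rewrite le_eqVlt; apply/orP; left; apply/eqP; ring.
Qed.

End RegularizedHelicity.

End SpacetimeFields.

(** * From almost all times to all times *)

Section HoelderExtension.
Variable R : realType.
Implicit Types (h H : R -> R) (G : R -> Prop) (s t r : R).

Definition dense_times G := forall a b, 0 <= a -> a < b -> exists2 r, a < r < b & G r.

Lemma ae_dense G : {ae (@lebesgue_measure R), forall t, 0 < t -> G t} -> dense_times G.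
Proof.
move=> [N [mN N0 hN]] a b a0 ab; apply: contrapT => h.
have sub : (`]a, b[%classic : set (measurableTypeR R)) `<=` N.
  move=> t; rewrite /= in_itv /= => /andP[at_ tb]; apply: hN => /= Gt; apply: h.
  by exists t; [rewrite at_|apply: Gt; exact: le_lt_trans at_].
have : (@lebesgue_measure R `]a, b[%classic <= 0)%E.
  by rewrite -N0; apply: le_measure => //; rewrite inE.
by rewrite lebesgue_measure_itv /= lte_fin ab -EFinB lee_fin subr_le0 leNgt ab.
Qed.

(** Splitting an interval at a point of its middle half multiplies the
    quadratic error by at most [3/4], and leaves the linear term unchanged;
    the splitting is iterated. Exact midpoints need not belong to [G]. *)
Lemma linear_of_quadratic h G A L : 0 <= L -> dense_times G -> (forall t, G t -> 0 < t) ->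
  (forall s t, s < t -> G s -> G t -> `|h t - h s| <= (A + L * (t - s)) * (t - s)) ->
  forall s t, G s -> G t -> `|h t - h s| <= A * `|t - s|.
Proof.
move=> L0 dG G0 hq.
have step (j : nat) s t : s < t -> G s -> G t ->
    `|h t - h s| <= (A + L * ((3 / 4) ^+ j * (t - s))) * (t - s).
  elim: j s t => [|j IH] s t st Gs Gt; first by rewrite expr0 mul1r; exact: hq.
  (* A point of [G] in the middle half: both pieces have length at most [3/4]
     of the whole. *)
  have [r /andP[r1 r2] Gr] := dG (s + (t - s) / 4) (s + 3 * (t - s) / 4) ltac:(have := G0 s Gs; lra) ltac:(lra).
  have sr : s < r by lra.
  have rt : r < t by lra.
  have h1 := IH s r sr Gs Gr; have h2 := IH r t rt Gr Gt.
  have q0 : 0 <= L * (3 / 4) ^+ j by rewrite mulr_ge0// exprn_ge0//; lra.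
  set q := L * (3 / 4) ^+ j in q0 *.
  have e1 x y : L * ((3 / 4) ^+ j * x) * y = q * (x * y) by rewrite /q; ring.
  have e2 x : L * ((3 / 4) ^+ j.+1 * x) = q * (3 / 4 * x) by rewrite /q exprS; ring.
  rewrite mulrDl e1 in h1; rewrite mulrDl e1 in h2; rewrite mulrDl e2.
  have p1 : q * ((r - s) * (r - s)) <= q * (3 / 4 * (t - s) * (r - s)).
    by rewrite ler_wpM2l// ler_wpM2r//; lra.
  have p2 : q * ((t - r) * (t - r)) <= q * (3 / 4 * (t - s) * (t - r)).
    by rewrite ler_wpM2l// ler_wpM2r//; lra.
  have E : h t - h s = (h t - h r) + (h r - h s) by ring.
  rewrite E; apply: (le_trans (ler_normD _ _)); apply: (le_trans (lerD h2 h1)).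
  have -> : A * (t - s) + q * (3 / 4 * (t - s)) * (t - s) =
    (A * (t - r) + q * (3 / 4 * (t - s) * (t - r))) + (A * (r - s) + q * (3 / 4 * (t - s) * (r - s))) by ring.
  by apply: lerD; rewrite lerD2l.
have lt_case s t : s < t -> G s -> G t -> `|h t - h s| <= A * (t - s).
  move=> st Gs Gt; set x := t - s; have x0 : 0 <= x by rewrite /x; lra.
  have cv : (fun j : nat => A * x + L * x * x * (3 / 4) ^+ j) @ \oo --> A * x + L * x * x * 0.
    apply: cvgD; first exact: cvg_cst.
    apply: cvgM; first exact: cvg_cst.
    by apply: cvg_expr; rewrite ger0_norm; lra.
  rewrite mulr0 addr0 in cv; rewrite -(cvg_lim (@Rhausdorff R) cv).
  apply: limr_ge; first by apply: cvgP cv.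
  by apply: nearW => j; have := step j s t st Gs Gt; rewrite -/x; congr (_ <= _); ring.
move=> s t Gs Gt; have [st|ts|->] := ltgtP s t.
- by rewrite (gtr0_norm (_ : 0 < t - s)) ?subr_gt0//; exact: lt_case.
- by rewrite distrC (distrC t) (gtr0_norm (_ : 0 < s - t)) ?subr_gt0//; exact: lt_case.
- by rewrite !subrr normr0 mulr0.
Qed.

(** The exponent may exceed 1, so the power need not be subadditive; the sum
    is at most twice the larger term. *)
Lemma powR_add_le (a b beta : R) : 0 <= a -> 0 <= b -> 0 <= beta ->
  (a + b) `^ beta <= 2 `^ beta * (a `^ beta + b `^ beta).
Proof.
move=> a0 b0 be0.
have key x y : 0 <= x -> x <= y -> (x + y) `^ beta <= 2 `^ beta * y `^ beta.
  move=> x0 xy; have y0 := le_trans x0 xy; rewrite -powRM//.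
  by apply: ge0_ler_powR; rewrite ?nnegrE ?addr_ge0 ?mulr_ge0//; lra.
have [ab|/ltW ba] := leP a b.
  by apply: (le_trans (key a b a0 ab)); rewrite ler_wpM2l ?powR_ge0// lerDr powR_ge0.
by rewrite addrC; apply: (le_trans (key b a b0 ba)); rewrite ler_wpM2l ?powR_ge0// lerDl powR_ge0.
Qed.

(** The extension is a supremum of downward cusps with vertices on the graph,
    as in McShane's theorem. The exponent may exceed 1, in which case a
    supremum of such cusps need not satisfy the same bound; the cusps are
    widened by the factor of [powR_add_le], and the bound at two arbitrary
    times is obtained from points of [G] next to them. *)
Lemma hoelder_extension H G (C beta : R) : 0 < C -> 0 < beta -> dense_times G ->
  (forall s t, G s -> G t -> `|H t - H s| <= C * `|t - s| `^ beta) ->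
  exists Hc : R -> R, (forall t, G t -> H t = Hc t) /\
    exists2 C' : R, 0 < C' & forall t s, 0 < t -> 0 < s -> `|Hc t - Hc s| <= C' * `|t - s| `^ beta.
Proof.
move=> C0 be0 dG hH; pose D := C * 2 `^ beta.
have D0 : 0 <= D by rewrite mulr_ge0 ?powR_ge0 ?ltW.
have [r0 _ Gr0] := dG 0 1 (lexx 0) ltr01.
(* The lower cusps at [t]; [cross] shows that they stay below the upper
   ones. *)
pose V t := [set H s - D * `|s - t| `^ beta | s in G].
have cross s s' t : G s -> G s' -> H s - D * `|s - t| `^ beta <= H s' + D * `|s' - t| `^ beta.
  move=> Gs Gs'; rewrite lerBlDr -addrA -lerBlDl -mulrDr.
  apply: (le_trans (ler_norm _)); apply: (le_trans (hH _ _ Gs' Gs)).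
  rewrite /D -mulrA ler_wpM2l ?(ltW C0)//.
  apply: le_trans (powR_add_le (normr_ge0 _) (normr_ge0 _) (ltW be0)).
  apply: ge0_ler_powR; rewrite ?nnegrE ?(ltW be0) ?addr_ge0//.
  have -> : s - s' = (t - s') + (s - t) by ring.
  by rewrite (le_trans (ler_normD _ _))// (distrC t s').
pose Hc t := sup (V t).
have hc t s : G s -> `|Hc t - H s| <= D * `|s - t| `^ beta.
  move=> Gs; rewrite ler_distl; apply/andP; split.
    apply: ub_le_sup; last by exists s.
    by exists (H s + D * `|s - t| `^ beta) => _ [s' Gs' <-]; exact: cross.
  apply: ge_sup; first by exists (H s - D * `|s - t| `^ beta), s.
  by move=> _ [s' Gs' <-]; exact: cross.
exists Hc; split.
  move=> t Gt; apply/eqP; rewrite eq_sym -subr_eq0 -normr_le0; apply: (le_trans (hc t t Gt)).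
  by rewrite subrr normr0 powR0 ?gt_eqF// mulr0.
exists (2 * D + C * 3 `^ beta) => [|t s t0 s0].
  by apply: ltr_wpDl; [exact: mulr_ge0|rewrite mulr_gt0 ?powR_gt0].
have [->|ts] := eqVneq t s; first by rewrite !subrr normr0 mulr_ge0 ?powR_ge0// addr_ge0 ?mulr_ge0 ?powR_ge0 ?(ltW C0).
set e := `|t - s|; have e0 : 0 < e by rewrite normr_gt0 subr_eq0.
have [t' /andP[t1 t2] Gt'] := dG t (t + e) (ltW t0) ltac:(lra).
have [s' /andP[s1 s2] Gs'] := dG s (s + e) (ltW s0) ltac:(lra).
have pw x y : 0 <= x -> x <= y -> x `^ beta <= y `^ beta.
  by move=> x0 xy; apply: ge0_ler_powR; rewrite ?nnegrE ?(ltW be0)//; exact: le_trans xy.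
have h1 : `|Hc t - H t'| <= D * e `^ beta.
  by apply: (le_trans (hc t t' Gt')); rewrite ler_wpM2l// pw// ger0_norm; lra.
have h2 : `|Hc s - H s'| <= D * e `^ beta.
  by apply: (le_trans (hc s s' Gs')); rewrite ler_wpM2l// pw// ger0_norm; lra.
have h3 : `|H t' - H s'| <= C * (3 `^ beta * e `^ beta).
  apply: (le_trans (hH _ _ Gs' Gt')); rewrite ler_wpM2l ?(ltW C0)// -powRM ?(ltW e0)// pw//.
  have := ler_norm (t - s); have := ler_norm (s - t); rewrite -/e (distrC s t) -/e => p1 p2.
  by rewrite ler_norml; apply/andP; split; lra.
have -> : Hc t - Hc s = (Hc t - H t') + ((H t' - H s') + (H s' - Hc s)) by ring.
apply: (le_trans (ler_normD _ _)).
apply: (@le_trans _ _ (D * e `^ beta + (C * (3 `^ beta * e `^ beta) + D * e `^ beta))).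
  apply: lerD => //; apply: (le_trans (ler_normD _ _)); apply: lerD => //.
  by rewrite distrC.
by rewrite le_eqVlt; apply/orP; left; apply/eqP; ring.
Qed.

Lemma hoelder_continuous H (C beta : R) : 0 < C -> 0 < beta ->
  (forall t s, 0 < t -> 0 < s -> `|H t - H s| <= C * `|t - s| `^ beta) ->
  {in `]0, +oo[, continuous H}.
Proof.
move=> C0 be0 hH x; rewrite in_itv /= andbT => x0.
apply/cvgrPdist_le => /= e e0.
have d0 : 0 < (C^-1 * e) `^ beta^-1 by rewrite powR_gt0// mulr_gt0// invr_gt0.
near=> y.
have y0 : 0 < y by near: y; exact: lt_nbhsr.
apply: (le_trans (hH x y x0 y0)); rewrite -ler_pdivlMl//.
have xy : `|x - y| <= (C^-1 * e) `^ beta^-1.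
  by near: y; exists ((C^-1 * e) `^ beta^-1) => //= z /ltW.
apply: (@le_trans _ _ (((C^-1 * e) `^ beta^-1) `^ beta)).
  by apply: ge0_ler_powR; rewrite ?nnegrE ?(ltW be0) ?(ltW d0).
by rewrite -powRrM mulVf ?gt_eqF// powRr1// mulr_ge0 ?invr_ge0 ?(ltW C0) ?(ltW e0).
Unshelve. all: by end_near. Qed.

End HoelderExtension.

(** * Choice of the scale *)

Section ScaleChoice.
Variable R : realType.

(** For [tau < 1] the width is chosen below [eps = tau^(1 / (1 - theta))] and
    at least [eps / 2]; the bound from below matters for the second term,
    whose power of the width may be negative. For [tau >= 1] the bound by [C1]
    is enough. *)
Lemma optimal_scale (theta alpha C1 C2 E tau : R) : 0 < theta < 1 -> 0 < alpha < 1 ->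
  0 <= C1 -> 0 <= C2 -> 0 < tau -> E <= C1 ->
  (forall m, E <= C1 * width R m `^ (theta + alpha) + C2 * width R m `^ (2 * theta + alpha - 1) * tau) ->
  E <= (C1 + 2 * C2) * tau `^ ((alpha + theta) / (1 - theta)).
Proof.
move=> /andP[th0 th1] /andP[al0 al1] C10 C20 t0 E1 Em.
have T0 : 0 < 1 - theta by rewrite subr_gt0.
set beta := (alpha + theta) / (1 - theta).
have be0 : 0 <= beta by rewrite divr_ge0// ?ltW// addr_gt0.
have tb0 : 0 <= tau `^ beta by exact: powR_ge0.
have [t1|t1] := leP 1 tau.
  apply: (le_trans E1); apply: (@le_trans _ _ (C1 * tau `^ beta)).
    by rewrite ler_peMr// -[leLHS](powRr0 tau) ler_powR.
  by rewrite ler_wpM2r// lerDl mulr_ge0.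
(* At this scale the two terms have the same order in [tau]. *)
pose eps := tau `^ (1 - theta)^-1.
have e0 : 0 < eps by exact: powR_gt0.
have e1 : eps < 1.
  have := @gt0_ltr_powR R (1 - theta)^-1; rewrite invr_gt0 => /(_ T0 tau 1); rewrite powR1; apply => //.
    by rewrite nnegrE ltW.
  by rewrite nnegrE.
have ee : (eps ^+ 2)^-1 * eps ^+ 2 = 1 by rewrite mulVf// expf_neq0// gt_eqF.
have x1 : 1 <= (eps ^+ 2)^-1 by rewrite invf_ge1 ?exprn_gt0// exprn_ile1// ltW.
(* Then [m + 1] is comparable with [eps^-2], and the width of index [m] with
   [eps]. *)
pose m := Num.truncn (eps ^+ 2)^-1.
have /andP[m1 m2] : (m%:R <= (eps ^+ 2)^-1 < m.+1%:R) by apply: truncn_itv; exact: le_trans x1.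
have d0 := width_gt0 R m; have dd := width_sqr R m.
have de : width R m <= eps.
  rewrite -(@ler_pXn2r _ 2)// ?nnegrE ?(ltW d0) ?(ltW e0)// -(ler_pM2l (_ : 0 < m.+1%:R))// dd.
  by rewrite -[leLHS]ee ler_wpM2r ?sqr_ge0// ltW.
have ed : eps <= 2 * width R m.
  rewrite -(@ler_pXn2r _ 2)// ?nnegrE ?mulr_ge0 ?(ltW d0) ?(ltW e0)// -(ler_pM2l (_ : 0 < m.+1%:R))//.
  rewrite exprMn [leRHS]mulrCA dd mulr1; apply: (@le_trans _ _ (2 * (eps ^+ 2)^-1 * eps ^+ 2)).
    by rewrite ler_wpM2r ?sqr_ge0// -natr1; lra.
  by rewrite -mulrA ee; lra.
have eb : eps `^ (theta + alpha) = tau `^ beta.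
  by rewrite /eps -powRrM /beta; congr (_ `^ _); rewrite mulrC addrC.
have p1 : width R m `^ (theta + alpha) <= tau `^ beta.
  by rewrite -eb; apply: ge0_ler_powR; rewrite ?nnegrE ?(ltW d0) ?(ltW e0) ?addr_ge0 ?(ltW th0) ?(ltW al0).
have p2 : width R m `^ (2 * theta + alpha - 1) * tau <= 2 * tau `^ beta.
  have -> : 2 * theta + alpha - 1 = (theta + alpha) + (- (1 - theta)) by ring.
  rewrite powRD; last by rewrite (gt_eqF d0) implybT.
  have q : width R m `^ (- (1 - theta)) * tau <= 2.
    have -> : tau = eps `^ (1 - theta) by rewrite /eps -powRrM mulVf ?gt_eqF// powRr1// ltW.
    apply: (@le_trans _ _ (width R m `^ (- (1 - theta)) * (2 * width R m) `^ (1 - theta))).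
      rewrite ler_wpM2l ?powR_ge0//; apply: ge0_ler_powR; rewrite ?nnegrE ?(ltW T0) ?(ltW e0)//.
      by rewrite mulr_ge0 ?(ltW d0).
    rewrite powRM ?(ltW d0)// mulrCA powRN mulVf ?mulr1 ?gt_eqF ?powR_gt0//.
    by rewrite -[leRHS]powRr1// ler_powR//; lra.
  have q0 : 0 <= width R m `^ (- (1 - theta)) * tau by rewrite mulr_ge0 ?powR_ge0 ?(ltW t0).
  by rewrite -mulrA mulrC; exact: ler_pM q0 (powR_ge0 _ _) q p1.
have -> : (C1 + 2 * C2) * tau `^ beta = C1 * tau `^ beta + C2 * (2 * tau `^ beta) by ring.
apply: (le_trans (Em m)); rewrite -[C2 * _ * tau]mulrA.
by apply: lerD; exact: ler_wpM2l.
Qed.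

End ScaleChoice.

Lemma norm_sub3_le (R : realDomainType) (H1 H2 h1 h2 a b : R) : `|H1 - h1| <= a -> `|H2 - h2| <= a ->
  `|h1 - h2| <= b -> `|H1 - H2| <= 2 * a + b.
Proof.
move=> p1 p2 p3; have -> : H1 - H2 = (H1 - h1) + ((h1 - h2) + (h2 - H2)) by ring.
rewrite (le_trans (ler_normD _ _))// (_ : 2 * a + b = a + (b + a)); last by ring.
rewrite lerD// (le_trans (ler_normD _ _))// lerD//.
by rewrite distrC.
Qed.

Local Notation mu R := (torus_measure R).
Local Notation prb R := (torus_measure R : probability (mspace3 R) R).
Local Notation leb R := (@lebesgue_measure R).

Theorem theorem1p3 (R : realType) (theta alpha : R) (p q : \bar R)
    (u omega : spacetime R -> 'rV[R]_3)
    (theta01 : 0 < theta < 1) (alpha01 : 0 < alpha < 1)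
    (p1 : (1 <= p)%E) (q1 : (1 <= q)%E) (pq : (p^-1 + q^-1 = 1)%E)
    (u_sol : euler_weak_solution u)
    (u_reg : Linfty_sobolev theta (2%:E * p)%E u)
    (omega_curl : weak_curl u omega)
    (omega_reg : Linfty_sobolev alpha q omega) :
  exists Hc : R -> R,
    [/\ {in `]0, +oo[, continuous Hc},
        {ae (@lebesgue_measure R),
          forall t, 0 < t -> helicity u omega t = Hc t} &
        exists2 C : R, 0 < C &
          forall t s : R, 0 < t -> 0 < s ->
            `|Hc t - Hc s| <= C * `|t - s| `^ ((alpha + theta) / (1 - theta))].
Proof.
have F := ae_filter_ringOfSetsType (leb R).
have [th0 th1] := andP theta01; have [al0 al1] := andP alpha01.
have [Nu Nu0 aeu] := ess_sup_finite u_reg; have [No No0 aeo] := ess_sup_finite omega_reg.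
have [c [M [c0 M0 hsob]]] := sobolev_slices th0 al0 p1 q1 pq (addr_ge0 Nu0 No0).
have vu : vector_field u by case: u_sol.
have vo : vector_field omega by case: omega_curl.
pose K := 1 + (c + M).
have sreg : {ae leb R, forall t, 0 < t -> [/\ slice_integrable (at_time u t) (at_time omega t),
    slice_regular theta alpha c M (at_time u t) (at_time omega t),
    forall i j, \int[mu R]_x `|at_time u t i x * at_time u t j x| <= K,
    forall i, \int[mu R]_x `|at_time omega t i x| <= K & forall i, \int[mu R]_x `|at_time u t i x| <= K]}.
  apply: (@filterS _ _ F _ _ _ (@filterI _ _ F _ _ aeu aeo)) => t [hu ho] t0.
  have hu' : (sobolev_norm theta (2%:E * p) (slice u t) <= (Nu + No)%:E)%E.
    by apply: le_trans (hu t0) _; rewrite lee_fin lerDl.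
  have ho' : (sobolev_norm alpha q (slice omega t) <= (Nu + No)%:E)%E.
    by apply: le_trans (ho t0) _; rewrite lee_fin lerDr.
  have [si sr s2 s1] := hsob _ _ ((proj1 vu) t) ((proj1 vo) t) (measurable_slice vu t0) (measurable_slice vo t0) hu' ho'.
  have k1 : c + M <= K by rewrite /K lerDr.
  have iu : forall i, rintegrable (mu R) (at_time u t i) by case: si.
  have iuu : forall i j, rintegrable (mu R) (fun x => at_time u t i x * at_time u t j x) by case: si.
  split => //; [by move=> i j; exact: le_trans (s2 i j) k1|by move=> i; exact: le_trans (s1 i) k1|].
  move=> i; have cst1 := @rintegrable_cst _ _ _ (prb R) 1.
  have n2 : rintegrable (mu R) (fun x => `|at_time u t i x * at_time u t i x|) by apply: integrable_norm; exact: iuu.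
  apply: (@le_trans _ _ (\int[mu R]_x (1 + `|at_time u t i x * at_time u t i x|))).
    apply: (@Int_le _ _ _ (prb R)).
    - by apply: integrable_norm; exact: iu.
    - exact: (@rintegrableD _ _ _ (prb R)).
    - by move=> x; rewrite normrM -expr2; exact: le1_sqr.
  by rewrite (@IntD _ _ _ (prb R))// (@Int_cst _ _ _ (prb R)) lerD2l; exact: s2.
have slices : {ae leb R, forall t, 0 < t ->
  [/\ slice_integrable (at_time u t) (at_time omega t),
      forall i j, \int[mu R]_x `|at_time u t i x * at_time u t j x| <= K,
      forall i, \int[mu R]_x `|at_time omega t i x| <= K &
      forall i, \int[mu R]_x `|at_time u t i x| <= K]}.
  by apply: (@filterS _ _ F _ _ _ sreg) => t h t0; have [? _ ? ? ?] := h t0.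
pose G t := good_time u omega K t /\ slice_regular theta alpha c M (at_time u t) (at_time omega t).
have aeG : {ae leb R, forall t, 0 < t -> G t}.
  have ag := ae_good_time u_sol omega_curl slices.
  apply: (@filterS _ _ F _ _ _ (@filterI _ _ F _ _ ag sreg)) => t [h1 h2] t0.
  by split; [exact: h1|case: (h2 t0)].
have dG := ae_dense aeG.
have G0 t : G t -> 0 < t by case=> -[].
(* The constants of [helicity_regularization_le] and [helicity_flux_le]. *)
pose C1 := 216 * Ker_cst R ^+ 2 * (c + 2 * M); pose C2 := 4608 * pi * Ker_cst R ^+ 2 * (c + 2 * M).
have cM0 : 0 <= c + 2 * M by rewrite addr_ge0// mulr_ge0.
have C10 : 0 <= C1 := mulr_ge0 (mulr_ge0 (ler0n R 216) (sqr_ge0 _)) cM0.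
have C20 : 0 <= C2 := mulr_ge0 (mulr_ge0 (mulr_ge0 (ler0n R 4608) (pi_ge0 R)) (sqr_ge0 _)) cM0.
have close m t : G t -> `|helicity u omega t - reg_helicity m.*2 (at_time u t) (at_time omega t)| <= C1 * width R m `^ (theta + alpha).
  move=> [[_ _ _ [si _]] sr].
  exact: (helicity_regularization_le theta01 alpha01 c0 si sr).
have fluxA m : {ae leb R, forall t, 0 < t ->
    `|helicity_flux m.*2 (at_time u t) (at_time omega t)| <= C2 * width R m `^ (2 * theta + alpha - 1)}.
  apply: (@filterS _ _ F _ _ _ aeG) => t h t0; have [[_ cd _ [si _]] sr] := h t0.
  rewrite (helicity_flux_stress si (cd m.*2)).
  exact: (helicity_flux_le theta01 alpha01 c0 si sr).
clearbody C1 C2.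
have lin m s t : G s -> G t ->
    `|reg_helicity m.*2 (at_time u t) (at_time omega t) - reg_helicity m.*2 (at_time u s) (at_time omega s)| <=
    2 * (C2 * width R m `^ (2 * theta + alpha - 1)) * `|t - s|.
  have A0 : 0 <= C2 * width R m `^ (2 * theta + alpha - 1) by rewrite mulr_ge0 ?powR_ge0.
  have [L L0 hL] := reg_helicity_quadratic u_sol omega_curl slices A0 (fluxA m).
  apply: (@linear_of_quadratic _ (fun r => reg_helicity m.*2 (at_time u r) (at_time omega r)) _ _ _ L0 dG G0) => s' t' st [gs _] [gt _].
  exact: hL.
have bnd t : G t -> `|helicity u omega t| <= C1.
  move=> Gt; have [[_ cd _ [si _]] _] := Gt.
  (* The width of index 0 is 1, and the regularized helicity of index 0
     vanishes. *)
  have := close 0 t Gt; rewrite (reg_helicity0 si (cd 0)) subr0.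
  by rewrite /width sqrtr1 invr1 powR1 mulr1.
have C0 : 0 < 2 * C1 + 2 * (2 * C2) + 1 by rewrite ltr_wpDl ?addr_ge0 ?mulr_ge0.
have holder s t : G s -> G t -> `|helicity u omega t - helicity u omega s| <=
    (2 * C1 + 2 * (2 * C2) + 1) * `|t - s| `^ ((alpha + theta) / (1 - theta)).
  move=> Gs Gt; have [->|ts] := eqVneq t s.
    by rewrite subrr normr0 mulr_ge0 ?powR_ge0// ltW.
  apply: (@le_trans _ _ ((2 * C1 + 2 * (2 * C2)) * `|t - s| `^ ((alpha + theta) / (1 - theta)))).
    apply: optimal_scale => //; rewrite ?mulr_ge0 ?normr_gt0 ?subr_eq0//.
      apply: (le_trans (ler_normB _ _)).
      by rewrite mulr_natl mulr2n lerD ?bnd.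
    move=> m; apply: (le_trans (norm_sub3_le (close m t Gt) (close m s Gs) (lin m s t Gs Gt))).
    by rewrite !mulrA.
  by rewrite ler_wpM2r ?powR_ge0// lerDl.
have be0 : 0 < (alpha + theta) / (1 - theta) by apply: divr_gt0; [exact: addr_gt0|rewrite subr_gt0].
have [Hc [HHc [C C_gt0 hC]]] := hoelder_extension C0 be0 dG holder.
exists Hc; split.
- exact: hoelder_continuous C_gt0 be0 hC.
- by apply: (@filterS _ _ F _ _ _ aeG) => t h t0; exact: HHc (h t0).
- by exists C.
Qed.
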